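(* Let $r\ge1$ and let $N\subset A$ be a non-zero proper ideal satisfying the level assumption. For any $d\ge1$ we have natural isomorphisms $$R^{\mathrm{norm}}_{A,V^r_N,d}\ \xrightarrow{\ \sim\ }\ \Gamma(\overline{M}^r_{A,N},\mathcal{O}(d))\qquad\text{and}\qquad I^{\mathrm{norm}}_{A,V^r_N,d}\ \xrightarrow{\ \sim\ }\ \Gamma(\overline{M}^r_{A,N},\mathcal{I}(d)).$$
   Context: $\mathbb{F}_q$ is a finite field with $q$ elements. $A$ is an admissible coefficient ring containing $\mathbb{F}_q$, i.e. the ring of elements of a global function field $F\supset\mathbb{F}_q$ that are regular outside one fixed place $\infty$; so $F=\mathrm{Quot}(A)$. For $a\in A\setminus\{0\}$ put $\deg_A(a)=\dim_{\mathbb{F}_q}(A/(a))$, and $\deg_A(0)=-\infty$. For a non-zero ideal $N\subset A$ put $\mathrm{Div}(N)=\{a\in A\mid N\subset (a)\}$. Level assumption on a non-zero proper ideal $N\subset A$: there exists a subset $D\subset\mathrm{Div}(N)$ such that (i) for any $a\in A\setminus\{0\}$ there is $b\in A\setminus\{0\}$ which is a product of elements of $D$ with $\deg_A(a-b)<\deg_A(a)$; (ii) for any distinct $a,b\in D$ we have $ab\in\mathrm{Div}(N)$; (iii) any element of $\mathrm{Div}(N)$ is a product of elements of $D$; (iv) $N$ is principal. $V^r_N=(N^{-1}/A)^{\oplus r}$ and $V^r_a=(a^{-1}A/A)^{\oplus r}$ for $a\in A\setminus\{0\}$; for $a\in\mathrm{Div}(N)$ we have $V^r_a\subset V^r_N$.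 For a finite dimensional $\mathbb{F}_q$-vector space $V$ let $K_V$ be the field of quotients of the symmetric algebra of $V$ over $\mathbb{F}_q$, and $R_V\subset K_V$ the $\mathbb{F}_q$-subalgebra generated by all $\frac1v$, $v\in V\setminus\{0\}$, graded so that each $\frac1v$ has degree $1$. For $s\ge1$, $R_{A,V^s_N}$ is the graded factor ring of $R_{V^s_N}\otimes_{\mathbb{F}_q}F$ by the ideal generated by $\frac{1}{av}\otimes a-\sum_{v'\in V^s_a}\frac{1}{v-v'}\otimes 1$ for all $a\in\mathrm{Div}(N)$ and $v\in V^s_N\setminus V^s_a$; $[f]$ denotes the image of $f$. $RS_{A,V^s_N}$ is its localization obtained by inverting $[\frac1v\otimes1]$ for all $v\in V^s_N\setminus\{0\}$. $R^{\mathrm{norm}}_{A,V^r_N}$ is the integral closure of $R_{A,V^r_N}$ in $RS_{A,V^r_N}$, with the induced grading. For $1\le s<r$ and an injective $A$-linear map $i\colon V^s_N\hookrightarrow V^r_N$ let $\tilde\pi_i\colon R_{A,V^r_N}\to RS_{A,V^s_N}$ be the $F$-algebra homomorphism sending $[\frac{1}{i(v')}\otimes1]$ to $[\frac1{v'}\otimes1]$ for $v'\in V^s_N\setminus\{0\}$ and $[\frac1v\otimes1]$ to $0$ for $v\in V^r_N\setminus i(V^s_N)$. Let $R_{A,V^r_N,+}$ be the ideal of elements of positive degree and put $$I_{A,V^r_N}=R_{A,V^r_N,+}\cap\bigcap_{s,i}\mathrm{Ker}(\tilde\pi_i)\subset R_{A,V^r_N},\qquad I^{\mathrm{norm}}_{A,V^r_N}=\sqrt{I_{A,V^r_N}\cdot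 R^{\mathrm{norm}}_{A,V^r_N}}\subset R^{\mathrm{norm}}_{A,V^r_N}.$$ These are graded ideals; a subscript $d$ denotes the homogeneous part of degree $d$. $\overline{M}^r_{A,N}=\mathrm{Proj}(R^{\mathrm{norm}}_{A,V^r_N})$; this is the Satake compactification of the moduli space $M^r_{A,N}\cong\mathrm{Proj}(RS_{A,V^r_N})$ of Drinfeld $A$-modules of rank $r$ with level $N$-structure. $\mathcal{O}(1)$ on $\overline{M}^r_{A,N}$ is the pullback of the very ample sheaf $\mathcal{O}(1)$ on $\mathrm{Proj}(R_{A,V^r_N})$ under the finite morphism induced by $R_{A,V^r_N}\to R^{\mathrm{norm}}_{A,V^r_N}$; for a quasicoherent sheaf $\mathcal{F}$ put $\mathcal{F}(d)=\mathcal{F}\otimes\mathcal{O}(1)^{\otimes d}$. $\mathcal{I}\subset\mathcal{O}_{\overline{M}^r_{A,N}}$ is the ideal sheaf of the reduced boundary $(\overline{M}^r_{A,N}\setminus M^r_{A,N})^{\mathrm{red}}$, equivalently the ideal sheaf associated to $I^{\mathrm{norm}}_{A,V^r_N}$. The natural maps are those sending a homogeneous element of degree $d$ to the associated global section. The spaces $\Gamma(\overline{M}^r_{A,N},\mathcal{O}(d))$ and $\Gamma(\overline{M}^r_{A,N},\mathcal{I}(d))$ are called the spaces of modular forms, resp. cusp forms, of rank $r$, level $N$ and weight $d$. *)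

(* Defs.v *)
From HB Require Import structures.
From mathcomp Require Import all_boot all_algebra ring.
From mathcomp Require Import boolp classical_sets functions fsbigop.
From mathcomp Require Import mpoly.

Set Implicit Arguments.
Unset Strict Implicit.
Unset Printing Implicit Defensive.

Import GRing.Theory.

Local Open Scope classical_set_scope.
Local Open Scope quotient_scope.
Local Open Scope ring_scope.

(** * Commutative algebra

    Rings are [comPzRingType]s: nontriviality of the localizations and
    quotients below is not decided at the level of definitions. *)

Definition is_ideal (R : comPzRingType) (J : set R) : Prop :=
  [/\ J 0, forall x y, J x -> J y -> J (x + y) & forall a x, J x -> J (a * x)].

Record ideal (R : comPzRingType) :=
  Ideal { idealset :> R -> Prop; idealP : is_ideal idealset }.
Coercion ideal_set (R : comPzRingType) (J : ideal R) : set R := J.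

Section Ideals.
Variable R : comPzRingType.
Implicit Types (J : ideal R) (G : set R).

Lemma ideal0 J : J 0. Proof. by case: J => ? []. Qed.
Lemma idealD J x y : J x -> J y -> J (x + y).
Proof. by case: J => ? [] ? h ?; apply: h. Qed.
Lemma idealM J a x : J x -> J (a * x).
Proof. by case: J => ? [] ? ? h; apply: h. Qed.
Lemma idealB J x y : J x -> J y -> J (x - y).
Proof. by move=> Jx Jy; rewrite -mulN1r; apply/idealD/idealM. Qed.
Lemma ideal_sum J n (F : 'I_n -> R) :
  (forall i, J (F i)) -> J (\sum_(i < n) F i).
Proof. by move=> h; apply: big_ind => //; [exact: ideal0|exact: idealD]. Qed.

Lemma ideal_full_subproof : is_ideal [set: R]. Proof. by []. Qed.
Definition ideal_full : ideal R := Ideal ideal_full_subproof.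

Lemma ideal_gen_subproof G :
  is_ideal [set x | forall J : ideal R, G `<=` J -> J x].
Proof.
split=> [J _|x y hx hy J GJ|a x hx J GJ]; first exact: ideal0.
  by apply: idealD; [exact: hx|exact: hy].
by apply: idealM; exact: hx.
Qed.
Definition ideal_gen G : ideal R := Ideal (ideal_gen_subproof G).

Lemma ideal_rad_subproof J : is_ideal [set x | exists n, J (x ^+ n)].
Proof.
split=> [|x y [m Jx] [n Jy]|a x [n Jx]].
- by exists 1%N; rewrite expr1; exact: ideal0.
- exists (m + n)%N; rewrite exprDn; apply: ideal_sum => i.
  rewrite -mulr_natl; apply: idealM.
  have [nm|nm] := leqP m (m + n - i).
    by rewrite mulrC -(subnK nm) exprD mulrA; apply: idealM.
  have ni : (n <= i)%N.
    rewrite leqNgt; apply/negP => ni; move: nm; rewrite ltnNge => /negP; apply.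
    by rewrite -addnBA ?leq_addr// ltnW.
  by rewrite -(subnK ni) exprD mulrA; apply: idealM.
- by exists n; rewrite exprMn; apply: idealM.
Qed.
Definition ideal_rad J : ideal R := Ideal (ideal_rad_subproof J).

End Ideals.
Arguments ideal_full {R}.

Section QuotientRing.
Variables (R : comPzRingType) (J : ideal R).

Definition ideal_pred : {pred R} := fun x => `[< J x >].

Lemma ideal_pred_zmod : zmod_closed ideal_pred.
Proof.
split=> [|x y /asboolP Jx /asboolP Jy]; apply/asboolP; first exact: ideal0.
exact: idealB.
Qed.
HB.instance Definition _ := GRing.isZmodClosed.Build R ideal_pred ideal_pred_zmod.

Definition quoring := {ideal_quot ideal_pred}.
HB.instance Definition _ := GRing.Zmodule.on quoring.

Definition qproj (x : R) : quoring := \pi x.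

Lemma qprojP x y : qproj x = qproj y <-> J (x - y).
Proof.
rewrite /qproj; split=> [/eqP|h]; first by rewrite piE => /asboolP.
by apply/eqP; rewrite piE; apply/asboolP.
Qed.
Lemma qproj_repr (x : quoring) : qproj (repr x) = x. Proof. exact: reprK. Qed.
Lemma qprojD : {morph qproj : x y / x + y}.
Proof. by move=> x y; rewrite /qproj !piE. Qed.

Definition quo_one : quoring := qproj 1.
Definition quo_mul (x y : quoring) : quoring := qproj (repr x * repr y).

Lemma qprojM x y : quo_mul (qproj x) (qproj y) = qproj (x * y).
Proof.
apply/qprojP; set x' := repr _; set y' := repr _.
have hx : J (x' - x) by apply/qprojP; rewrite qproj_repr.
have hy : J (y' - y) by apply/qprojP; rewrite qproj_repr.
have -> : x' * y' - x * y = y' * (x' - x) + x * (y' - y).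
  by rewrite !mulrBr (mulrC y' x') (mulrC y' x) addrA subrK.
by apply: idealD; apply: idealM.
Qed.

Lemma quo_mulA : associative quo_mul.
Proof.
move=> x y z; rewrite -[x]qproj_repr -[y]qproj_repr -[z]qproj_repr.
by rewrite !qprojM mulrA.
Qed.
Lemma quo_mulC : commutative quo_mul.
Proof. by move=> x y; rewrite /quo_mul mulrC. Qed.
Lemma quo_mul1 : left_id quo_one quo_mul.
Proof. by move=> x; rewrite -[x]qproj_repr qprojM mul1r. Qed.
Lemma quo_mulD : left_distributive quo_mul +%R.
Proof.
move=> x y z; rewrite -[x]qproj_repr -[y]qproj_repr -[z]qproj_repr.
by rewrite -qprojD !qprojM mulrDl qprojD.
Qed.
HB.instance Definition _ :=
  GRing.Zmodule_isComPzRing.Build quoring quo_mulA quo_mulC quo_mul1 quo_mulD.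

Lemma qproj_is_zmod_morphism : zmod_morphism qproj.
Proof. by move=> x y; rewrite /qproj !piE. Qed.
Lemma qproj_is_monoid_morphism : monoid_morphism qproj.
Proof. by split=> // x y; rewrite -qprojM. Qed.
HB.instance Definition _ :=
  GRing.isZmodMorphism.Build R quoring qproj qproj_is_zmod_morphism.
HB.instance Definition _ :=
  GRing.isMonoidMorphism.Build R quoring qproj qproj_is_monoid_morphism.

End QuotientRing.

(** ** Localization *)

Definition mulgen (R : comPzRingType) (T : set R) : set R :=
  [set x | exists2 l : seq R, (forall y, y \in l -> T y) & x = \prod_(y <- l) y].

Section Localization.
Variables (R : comPzRingType) (T : set R).

Lemma mulgen1 : mulgen T 1.
Proof. by exists [::]; rewrite ?big_nil. Qed.
Lemma mulgenM s t : mulgen T s -> mulgen T t -> mulgen T (s * t).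
Proof.
move=> [l hl ->] [m hm ->]; exists (l ++ m); last by rewrite big_cat.
by move=> y; rewrite mem_cat => /orP[/hl|/hm].
Qed.
Lemma mulgen_sub t : T t -> mulgen T t.
Proof. by exists [:: t]; rewrite ?big_seq1// => y; rewrite inE => /eqP->. Qed.

Definition denom := {s : R | `[< mulgen T s >]}.

Lemma denomP (s : denom) : mulgen T (val s).
Proof. exact/asboolP/(valP s). Qed.

Definition loc_rel (u v : R * denom) : bool :=
  `[< exists2 w, mulgen T w & w * (u.1 * val v.2) = w * (v.1 * val u.2) >].

Lemma loc_rel_equiv : equiv_class_of loc_rel.
Proof.
split=> [u|u v|v u z].
- by apply/asboolP; exists 1; first exact: mulgen1.
- by apply/asboolP/asboolP => -[w hw e]; exists w.
- move=> /asboolP[w hw e] /asboolP[w' hw' e']; apply/asboolP.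
  exists (w * w' * val v.2); first by do !apply: mulgenM => //; exact: denomP.
  transitivity (w' * val z.2 * (w * (u.1 * val v.2))); first by ring.
  rewrite e; transitivity (w * val u.2 * (w' * (v.1 * val z.2))); first by ring.
  by rewrite e'; ring.
Qed.

Canonical loc_equiv := EquivRelPack loc_rel_equiv.
Canonical loc_encModRel := defaultEncModRel loc_rel.

Definition loc := {eq_quot loc_rel}.
HB.instance Definition _ := EqQuotient.on loc.
HB.instance Definition _ := Choice.on loc.

Definition denom1 : denom := Sub 1 (asboolT mulgen1).

(* [lfrac x s] is the fraction x/s; like division in a field it is total, and
   it is only meaningful when s is a product of elements of T. *)
Definition lfrac (x s : R) : loc := \pi_loc (x, insubd denom1 s).

Lemma insub_denom s : mulgen T s -> val (insubd denom1 s) = s.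
Proof. by move=> hs; rewrite insubdK//; apply/asboolP. Qed.

Lemma lfracP x s y t : mulgen T s -> mulgen T t ->
  lfrac x s = lfrac y t <-> exists2 w, mulgen T w & w * (x * t) = w * (y * s).
Proof.
move=> hs ht; rewrite /lfrac; split=> [/eqP|h].
  by rewrite piE => /asboolP /=; rewrite !insub_denom.
by apply/eqP; rewrite piE; apply/asboolP => /=; rewrite !insub_denom.
Qed.

Definition lnum (u : loc) : R := (repr u).1.
Definition lden (u : loc) : R := val (repr u).2.

Lemma ldenP u : mulgen T (lden u). Proof. exact: denomP. Qed.

Lemma lfrac_repr u : lfrac (lnum u) (lden u) = u.
Proof.
rewrite /lfrac /lnum /lden valKd -surjective_pairing; exact: reprK.
Qed.

Lemma lfrac_ind (P : loc -> Prop) :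
  (forall x s, mulgen T s -> P (lfrac x s)) -> forall u, P u.
Proof. by move=> h u; rewrite -(lfrac_repr u); apply/h/ldenP. Qed.

Definition loc_zero := lfrac 0 1.
Definition loc_one := lfrac 1 1.
Definition loc_opp u := lfrac (- lnum u) (lden u).
Definition loc_add u v :=
  lfrac (lnum u * lden v + lnum v * lden u) (lden u * lden v).
Definition loc_mul u v := lfrac (lnum u * lnum v) (lden u * lden v).

Lemma lfrac_oppE x s : mulgen T s -> loc_opp (lfrac x s) = lfrac (- x) s.
Proof.
move=> hs; have /lfracP[||w hw e] := lfrac_repr (lfrac x s) => //.
  exact: ldenP.
apply/lfracP => //; first exact: ldenP.
by exists w => //; rewrite !mulNr !mulrN e.
Qed.

Lemma lfrac_addE x s y t : mulgen T s -> mulgen T t ->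
  loc_add (lfrac x s) (lfrac y t) = lfrac (x * t + y * s) (s * t).
Proof.
move=> hs ht.
have /lfracP[||w hw e] := lfrac_repr (lfrac x s) => //; first exact: ldenP.
have /lfracP[||z hz f] := lfrac_repr (lfrac y t) => //; first exact: ldenP.
apply/lfracP; do ?[exact: mulgenM | by apply: mulgenM; exact: ldenP].
set a := lnum _ in e *; set b := lden _ in e *.
set c := lnum _ in f *; set d := lden _ in f *.
exists (w * z); first exact: mulgenM.
transitivity (z * t * d * (w * (a * s)) + w * s * b * (z * (c * t))).
  by ring.
by rewrite e f; ring.
Qed.

Lemma lfrac_mulE x s y t : mulgen T s -> mulgen T t ->
  loc_mul (lfrac x s) (lfrac y t) = lfrac (x * y) (s * t).
Proof.
move=> hs ht.
have /lfracP[||w hw e] := lfrac_repr (lfrac x s) => //; first exact: ldenP.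
have /lfracP[||z hz f] := lfrac_repr (lfrac y t) => //; first exact: ldenP.
apply/lfracP; do ?[exact: mulgenM | by apply: mulgenM; exact: ldenP].
set a := lnum _ in e *; set b := lden _ in e *.
set c := lnum _ in f *; set d := lden _ in f *.
exists (w * z); first exact: mulgenM.
transitivity ((w * (a * s)) * (z * (c * t))); first by ring.
by rewrite e f; ring.
Qed.

Lemma lfrac_eq x s y t : mulgen T s -> mulgen T t -> x * t = y * s ->
  lfrac x s = lfrac y t.
Proof. by move=> hs ht e; apply/lfracP => //; exists 1; rewrite ?e//; exact: mulgen1. Qed.

Let g1 := mulgen1.
Let gM := mulgenM.

Lemma loc_addA : associative loc_add.
Proof.
move=> u v z; elim/lfrac_ind: u => x s hs; elim/lfrac_ind: v => y t ht.
elim/lfrac_ind: z => z w hw.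
by rewrite !lfrac_addE//; do ?[exact: gM|apply: gM => //; exact: gM]; apply: lfrac_eq; do ?[exact: gM|apply: gM => //; exact: gM]; ring.
Qed.
Lemma loc_addC : commutative loc_add.
Proof. by move=> u v; rewrite /loc_add addrC (mulrC (lden u)). Qed.
Lemma loc_add0 : left_id loc_zero loc_add.
Proof.
by elim/lfrac_ind => x s hs; rewrite lfrac_addE// mul0r add0r mul1r mulr1.
Qed.
Lemma loc_addN : left_inverse loc_zero loc_opp loc_add.
Proof.
elim/lfrac_ind => x s hs; rewrite lfrac_oppE// lfrac_addE//.
by apply: lfrac_eq => //; [exact: gM|ring].
Qed.
HB.instance Definition _ :=
  GRing.isZmodule.Build loc loc_addA loc_addC loc_add0 loc_addN.

Lemma loc_mulA : associative loc_mul.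
Proof.
move=> u v z; elim/lfrac_ind: u => x s hs; elim/lfrac_ind: v => y t ht.
elim/lfrac_ind: z => z w hw.
by rewrite !lfrac_mulE//; do ?[exact: gM|apply: gM => //; exact: gM]; rewrite !mulrA.
Qed.
Lemma loc_mulC : commutative loc_mul.
Proof. by move=> u v; rewrite /loc_mul mulrC (mulrC (lden u)). Qed.
Lemma loc_mul1 : left_id loc_one loc_mul.
Proof. by elim/lfrac_ind => x s hs; rewrite lfrac_mulE// !mul1r. Qed.
Lemma loc_mulD : left_distributive loc_mul loc_add.
Proof.
move=> u v z; elim/lfrac_ind: u => x s hs; elim/lfrac_ind: v => y t ht.
elim/lfrac_ind: z => z w hw.
rewrite lfrac_addE// !lfrac_mulE//; last exact: gM.
rewrite lfrac_addE//; do ?[exact: gM|apply: gM => //; exact: gM].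
by apply: lfrac_eq; do ?[exact: gM|apply: gM => //; exact: gM]; ring.
Qed.
HB.instance Definition _ :=
  GRing.Zmodule_isComPzRing.Build loc loc_mulA loc_mulC loc_mul1 loc_mulD.

Lemma lfracD x s y t : mulgen T s -> mulgen T t ->
  lfrac x s + lfrac y t = lfrac (x * t + y * s) (s * t).
Proof. exact: lfrac_addE. Qed.
Lemma lfracN x s : mulgen T s -> - lfrac x s = lfrac (- x) s.
Proof. exact: lfrac_oppE. Qed.
Lemma lfracB x s y t : mulgen T s -> mulgen T t ->
  lfrac x s - lfrac y t = lfrac (x * t - y * s) (s * t).
Proof. by move=> hs ht; rewrite lfracN// lfracD// mulNr. Qed.
Lemma lfracM x s y t : mulgen T s -> mulgen T t ->
  lfrac x s * lfrac y t = lfrac (x * y) (s * t).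
Proof. exact: lfrac_mulE. Qed.

Definition lof (x : R) : loc := lfrac x 1.

Lemma lof_is_zmod_morphism : zmod_morphism lof.
Proof. by move=> x y; rewrite /lof lfracB// !mulr1. Qed.
Lemma lof_is_monoid_morphism : monoid_morphism lof.
Proof. by split=> // x y; rewrite /lof lfracM// mulr1. Qed.
HB.instance Definition _ :=
  GRing.isZmodMorphism.Build R loc lof lof_is_zmod_morphism.
HB.instance Definition _ :=
  GRing.isMonoidMorphism.Build R loc lof lof_is_monoid_morphism.

End Localization.

Section LocalizationMap.
Variables (R R' : comPzRingType) (T : set R) (T' : set R').
Variable f : {rmorphism R -> R'}.
Hypothesis fT : forall t, T t -> T' (f t).

Definition locmap (u : loc T) : loc T' := lfrac T' (f (lnum u)) (f (lden u)).

Lemma mulgen_map t : mulgen T t -> mulgen T' (f t).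
Proof.
move=> [l hl ->]; exists (map f l); last by rewrite rmorph_prod big_map.
by move=> _ /mapP[y /hl Ty ->]; exact: fT.
Qed.

Lemma locmap_lfrac x t :
  mulgen T t -> locmap (lfrac T x t) = lfrac T' (f x) (f t).
Proof.
move=> ht; have /lfracP[||w hw e] := lfrac_repr (lfrac T x t) => //.
  exact: ldenP.
apply/lfracP; do ?[exact: mulgen_map | by apply: mulgen_map; exact: ldenP].
by exists (f w); [exact: mulgen_map | rewrite -!rmorphM e].
Qed.

End LocalizationMap.

(** ** Tensor product of two commutative algebras *)

Section TensorRing.
Variables (k B C : comPzRingType) (iB : {rmorphism k -> B}) (iC : {rmorphism k -> C}).

(* Elements are classes of finite formal sums of [b (x) c]. Two formal sums
   are identified when they have the same image in every commutative ring
   receiving B and C compatibly with k: B (x)_k C is the coproduct of B and C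
   in the category of commutative k-algebras. *)
Definition tring_ev (U : comPzRingType) (f : B -> U) (g : C -> U)
    (l : seq (B * C)) : U := \sum_(p <- l) f p.1 * g p.2.

Definition tring_rel (l m : seq (B * C)) : bool :=
  `[< forall (U : comPzRingType) (f : {rmorphism B -> U}) (g : {rmorphism C -> U}),
      (forall x, f (iB x) = g (iC x)) -> tring_ev f g l = tring_ev f g m >].

Lemma tring_rel_equiv : equiv_class_of tring_rel.
Proof.
split=> [l|l m|l m n].
- exact/asboolP.
- by apply/asboolP/asboolP => h U f g fg; rewrite h.
- by move=> /asboolP h /asboolP h'; apply/asboolP => U f g fg; rewrite h ?h'.
Qed.
Canonical tring_equiv := EquivRelPack tring_rel_equiv.
Canonical tring_encModRel := defaultEncModRel tring_rel.

Definition tring := {eq_quot tring_rel}.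
HB.instance Definition _ := EqQuotient.on tring.
HB.instance Definition _ := Choice.on tring.

Definition tring_class (l : seq (B * C)) : tring := \pi l.
Definition tring_pure (b : B) (c : C) : tring := tring_class [:: (b, c)].

Lemma tring_classP l m : tring_class l = tring_class m <->
  forall (U : comPzRingType) (f : {rmorphism B -> U}) (g : {rmorphism C -> U}),
      (forall x, f (iB x) = g (iC x)) -> tring_ev f g l = tring_ev f g m.
Proof.
split=> [/eqP|h]; first by rewrite piE => /asboolP.
by apply/eqP; rewrite piE; apply/asboolP.
Qed.

Lemma tring_eq (x y : tring) :
  (forall (U : comPzRingType) (f : {rmorphism B -> U}) (g : {rmorphism C -> U}),
      (forall x, f (iB x) = g (iC x)) ->
      tring_ev f g (repr x) = tring_ev f g (repr y)) -> x = y.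
Proof.
by move=> h; rewrite -[x]reprK -[y]reprK; apply/tring_classP.
Qed.

Definition tring_zero := tring_class [::].
Definition tring_one := tring_pure 1 1.
Definition tring_opp (x : tring) :=
  tring_class [seq (- p.1, p.2) | p <- repr x].
Definition tring_add (x y : tring) := tring_class (repr x ++ repr y).
Definition tring_mul (x y : tring) :=
  tring_class [seq (p.1 * q.1, p.2 * q.2) | p <- repr x, q <- repr y].

Section Ev.
Variables (U : comPzRingType) (f : {rmorphism B -> U}) (g : {rmorphism C -> U}).
Hypothesis fg : forall x, f (iB x) = g (iC x).
Let ev (x : tring) := tring_ev f g (repr x).

Lemma tring_ev_class l : ev (tring_class l) = tring_ev f g l.
Proof. by apply: (tring_classP _ _).1 => //; exact: reprK. Qed.
Lemma tring_ev0 : ev tring_zero = 0.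
Proof. by rewrite tring_ev_class /tring_ev big_nil. Qed.
Lemma tring_ev1 : ev tring_one = 1.
Proof. by rewrite tring_ev_class /tring_ev big_seq1 !rmorph1 mulr1. Qed.
Lemma tring_evN x : ev (tring_opp x) = - ev x.
Proof.
rewrite tring_ev_class /ev /tring_ev big_map -sumrN.
by apply: eq_bigr => p _; rewrite rmorphN mulNr.
Qed.
Lemma tring_evD x y : ev (tring_add x y) = ev x + ev y.
Proof. by rewrite tring_ev_class /ev /tring_ev big_cat. Qed.
Lemma tring_evM x y : ev (tring_mul x y) = ev x * ev y.
Proof.
rewrite tring_ev_class /ev /tring_ev big_allpairs_dep /= mulr_suml.
apply: eq_bigr => p _; rewrite mulr_sumr; apply: eq_bigr => q _.
by rewrite !rmorphM mulrACA.
Qed.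
End Ev.

Definition tring_evE := (tring_ev0, tring_ev1, tring_evN, tring_evD, tring_evM).

Lemma tring_addA : associative tring_add.
Proof. by move=> x y z; apply: tring_eq => U f g fg; rewrite !tring_evE// addrA. Qed.
Lemma tring_addC : commutative tring_add.
Proof. by move=> x y; apply: tring_eq => U f g fg; rewrite !tring_evE// addrC. Qed.
Lemma tring_add0 : left_id tring_zero tring_add.
Proof. by move=> x; apply: tring_eq => U f g fg; rewrite !tring_evE// add0r. Qed.
Lemma tring_addN : left_inverse tring_zero tring_opp tring_add.
Proof. by move=> x; apply: tring_eq => U f g fg; rewrite !tring_evE// addNr. Qed.
HB.instance Definition _ :=
  GRing.isZmodule.Build tring tring_addA tring_addC tring_add0 tring_addN.
Lemma tring_mulA : associative tring_mul.
Proof. by move=> x y z; apply: tring_eq => U f g fg; rewrite !tring_evE// mulrA. Qed.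
Lemma tring_mulC : commutative tring_mul.
Proof. by move=> x y; apply: tring_eq => U f g fg; rewrite !tring_evE// mulrC. Qed.
Lemma tring_mul1 : left_id tring_one tring_mul.
Proof. by move=> x; apply: tring_eq => U f g fg; rewrite !tring_evE// mul1r. Qed.
Lemma tring_mulD : left_distributive tring_mul tring_add.
Proof. by move=> x y z; apply: tring_eq => U f g fg; rewrite !tring_evE// mulrDl. Qed.
HB.instance Definition _ :=
  GRing.Zmodule_isComPzRing.Build tring tring_mulA tring_mulC tring_mul1 tring_mulD.

Definition tring_inr (c : C) : tring := tring_pure 1 c.

Lemma tring_inr_is_zmod_morphism : zmod_morphism tring_inr.
Proof.
move=> c d; apply: tring_eq => U f g fg; rewrite !tring_evE// !tring_ev_class//.
by rewrite /tring_ev !big_seq1 /= rmorph1 !mul1r rmorphB.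
Qed.
Lemma tring_inr_is_monoid_morphism : monoid_morphism tring_inr.
Proof.
split=> // c d; apply: tring_eq => U f g fg; rewrite tring_evM// !tring_ev_class//.
by rewrite /tring_ev !big_seq1 /= rmorph1 !mul1r rmorphM.
Qed.
HB.instance Definition _ :=
  GRing.isZmodMorphism.Build C tring tring_inr tring_inr_is_zmod_morphism.
HB.instance Definition _ :=
  GRing.isMonoidMorphism.Build C tring tring_inr tring_inr_is_monoid_morphism.

End TensorRing.

(** ** Tensor product of modules along a ring homomorphism *)

Section Tensor.
Variables (A B : comPzRingType) (f : A -> B) (M : lmodType A) (P : lmodType B).

Definition balanced (G : zmodType) (b : M -> P -> G) : Prop :=
  [/\ forall m m' p, b (m + m') p = b m p + b m' p,
      forall m p p', b m (p + p') = b m p + b m p' &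
      forall a m p, b (a *: m) p = b m (f a *: p)].

Definition tens_ev (G : zmodType) (b : M -> P -> G) (l : seq (M * P)) : G :=
  \sum_(x <- l) b x.1 x.2.

(* M (x)_A P: formal sums of [m (x) p], identified when they have the same
   image under every A-balanced biadditive map. Its B-module structure is the
   one of P, so that P := B gives the base change of M, and f := id the
   tensor product of two modules over the same ring. *)
Definition tens_rel (l m : seq (M * P)) : bool :=
  `[< forall (G : zmodType) (b : M -> P -> G),
      balanced b -> tens_ev b l = tens_ev b m >].

Lemma tens_rel_equiv : equiv_class_of tens_rel.
Proof.
split=> [l|l m|l m n].
- exact/asboolP.
- by apply/asboolP/asboolP => h G b hb; rewrite h.
- by move=> /asboolP h /asboolP h'; apply/asboolP => G b hb; rewrite h ?h'.
Qed.
Canonical tens_equiv := EquivRelPack tens_rel_equiv.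
Canonical tens_encModRel := defaultEncModRel tens_rel.

Definition tens := {eq_quot tens_rel}.
HB.instance Definition _ := EqQuotient.on tens.
HB.instance Definition _ := Choice.on tens.

Definition tens_class (l : seq (M * P)) : tens := \pi l.
Definition tens_pure (m : M) (p : P) : tens := tens_class [:: (m, p)].

Lemma tens_classP l m : tens_class l = tens_class m <->
  forall (G : zmodType) (b : M -> P -> G),
      balanced b -> tens_ev b l = tens_ev b m.
Proof.
split=> [/eqP|h]; first by rewrite piE => /asboolP.
by apply/eqP; rewrite piE; apply/asboolP.
Qed.

Lemma tens_eq (x y : tens) :
  (forall (G : zmodType) (b : M -> P -> G),
      balanced b -> tens_ev b (repr x) = tens_ev b (repr y)) -> x = y.
Proof. by move=> h; rewrite -[x]reprK -[y]reprK; apply/tens_classP. Qed.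

Definition tens_zero := tens_class [::].
Definition tens_opp (x : tens) := tens_class [seq (- p.1, p.2) | p <- repr x].
Definition tens_add (x y : tens) := tens_class (repr x ++ repr y).
Definition tens_scale (c : B) (x : tens) :=
  tens_class [seq (p.1, c *: p.2) | p <- repr x].

Section TensEv.
Variables (G : zmodType) (b : M -> P -> G).
Hypothesis hb : balanced b.
Let ev (x : tens) := tens_ev b (repr x).

Lemma tens_ev_class l : ev (tens_class l) = tens_ev b l.
Proof. by apply: (tens_classP _ _).1 => //; exact: reprK. Qed.
Lemma tens_ev0 : ev tens_zero = 0.
Proof. by rewrite tens_ev_class /tens_ev big_nil. Qed.
Lemma balanced_opp m p : b (- m) p = - b m p.
Proof.
case: hb => bD _ _; apply/eqP; rewrite -addr_eq0 -bD addNr.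
by rewrite -[_ == 0](inj_eq (addrI (b 0 p))) -bD !addr0.
Qed.
Lemma tens_evN x : ev (tens_opp x) = - ev x.
Proof.
rewrite tens_ev_class /ev /tens_ev big_map -sumrN.
by apply: eq_bigr => p _; rewrite balanced_opp.
Qed.
Lemma tens_evD x y : ev (tens_add x y) = ev x + ev y.
Proof. by rewrite tens_ev_class /ev /tens_ev big_cat. Qed.
Lemma tens_evZ c x :
  ev (tens_scale c x) = tens_ev (fun m p => b m (c *: p)) (repr x).
Proof. by rewrite tens_ev_class /ev /tens_ev big_map. Qed.
Lemma balancedZ c : balanced (fun m p => b m (c *: p)).
Proof.
case: hb => h1 h2 h3; split=> [m m' p|m p p'|a m p] //.
  by rewrite scalerDr h2.
by rewrite h3 !scalerA mulrC.
Qed.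
End TensEv.

Lemma tens_addA : associative tens_add.
Proof. by move=> x y z; apply: tens_eq => G b hb; rewrite !tens_evD// addrA. Qed.
Lemma tens_addC : commutative tens_add.
Proof. by move=> x y; apply: tens_eq => G b hb; rewrite !tens_evD// addrC. Qed.
Lemma tens_add0 : left_id tens_zero tens_add.
Proof. by move=> x; apply: tens_eq => G b hb; rewrite tens_evD// tens_ev0// add0r. Qed.
Lemma tens_addN : left_inverse tens_zero tens_opp tens_add.
Proof.
by move=> x; apply: tens_eq => G b hb; rewrite tens_evD// tens_evN// tens_ev0// addNr.
Qed.
HB.instance Definition _ :=
  GRing.isZmodule.Build tens tens_addA tens_addC tens_add0 tens_addN.

Lemma tens_scaleA c d x : tens_scale c (tens_scale d x) = tens_scale (c * d) x.
Proof.
apply: tens_eq => G b hb; rewrite !tens_evZ//; last exact: balancedZ.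
by apply: eq_bigr => p _; rewrite scalerA.
Qed.
Lemma tens_scale1 : left_id 1 tens_scale.
Proof.
move=> x; apply: tens_eq => G b hb; rewrite tens_evZ//.
by apply: eq_bigr => p _; rewrite scale1r.
Qed.
Lemma tens_scaleDr : right_distributive tens_scale +%R.
Proof.
move=> c x y; apply: tens_eq => G b hb; rewrite tens_evD// !tens_evZ//.
by rewrite tens_evD//; exact: balancedZ.
Qed.
Lemma tens_scaleDl x : {morph tens_scale^~ x : c d / c + d}.
Proof.
move=> c d; apply: tens_eq => G b hb; rewrite tens_evD// !tens_evZ//.
rewrite /tens_ev -big_split; apply: eq_bigr => p _ /=.
by case: hb => _ h _; rewrite scalerDl h.
Qed.
HB.instance Definition _ := GRing.Zmodule_isLmodule.Build B tens
  tens_scaleA tens_scale1 tens_scaleDr tens_scaleDl.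

End Tensor.

(** ** Integral closure *)

Definition integral (R S : comPzRingType) (f : R -> S) (x : S) : Prop :=
  exists n (c : 'I_n -> R), x ^+ n + \sum_(i < n) f (c i) * x ^+ i = 0.

Definition icl_pred (R S : comPzRingType) (f : R -> S) : {pred S} :=
  fun x => `[< integral f x >].

Lemma integralE (R S : comNzRingType) (f : {rmorphism R -> S}) x :
  integral f x <-> integralOver f x.
Proof.
split=> [[n [c e]]|[p pm]].
  pose q : {poly R} := \sum_(i < n) c i *: 'X^i.
  have qn : (size q <= n)%N.
    apply: (leq_trans (size_sum _ _ _)); apply/bigmax_leqP => i _.
    by rewrite (leq_trans (size_scale_leq _ _))// size_polyXn.
  exists ('X^n + q).
    by rewrite monicE lead_coefDl ?lead_coefXn// size_polyXn ltnS.
  rewrite rmorphD /= map_polyXn rootE hornerD hornerXn rmorph_sum horner_sum.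
  apply/eqP; rewrite -[RHS]e; congr (_ + _).
  by apply: eq_bigr => i _; rewrite /= map_polyZ map_polyXn hornerZ hornerXn.
rewrite rootE => /eqP px; exists (size p).-1, (fun i => p`_i).
have pn0 : p != 0 := monic_neq0 pm.
move: px; rewrite horner_coef size_map_poly_id0; last first.
  by rewrite (monicP pm) (rmorph1 f) oner_neq0.
rewrite (polySpred pn0) big_ord_recr/= => e; rewrite -[RHS]e.
rewrite [LHS]addrC; congr (_ + _); last first.
  suff -> : (map_poly f p)`_(size p).-1 = 1 by rewrite mul1r.
  by rewrite coef_map -lead_coefE (monicP pm); exact: rmorph1.
by apply: eq_bigr => i _; rewrite coef_map.
Qed.

Lemma icl_subring_nz (R S : comNzRingType) (f : {rmorphism R -> S}) :
  subring_closed (icl_pred f).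
Proof.
have key x : x \in icl_pred f <-> integralOver f x.
  rewrite -integralE; split; [exact: (fun h => asboolP _ h)|exact: asboolT].
split=> [|x y /key hx /key hy|x y /key hx /key hy]; apply/key.
- exact: integral1.
- exact: integral_sub.
- exact: integral_mul.
Qed.

Section IntegralClosure.
Variables (R S : comPzRingType) (f : {rmorphism R -> S}).
Local Notation icl_pred := (icl_pred f).

Lemma icl_subring : subring_closed icl_pred.
Proof.
have [S0|S1] := eqVneq (1 : S) 0.
  have z (x : S) : x = 0 by rewrite -[x]mul1r S0 mul0r.
  have h x : x \in icl_pred by apply/asboolP; exists 0, (fun=> 0); exact: z.
  by split=> [|x y _ _|x y _ _]; apply: h.
have R1 : (1 : R) != 0.
  by apply: contraNneq S1 => /(congr1 f); rewrite rmorph1 rmorph0 => ->.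
pose Rn : comNzRingType := HB.pack (GRing.ComPzRing.sort R)
  (GRing.PzSemiRing_isNonZero.Build (GRing.ComPzRing.sort R) R1).
pose Sn : comNzRingType := HB.pack (GRing.ComPzRing.sort S)
  (GRing.PzSemiRing_isNonZero.Build (GRing.ComPzRing.sort S) S1).
exact: (@icl_subring_nz Rn Sn f).
Qed.
HB.instance Definition _ := GRing.isSubringClosed.Build S icl_pred icl_subring.

Definition icl := {x : S | icl_pred x}.
HB.instance Definition _ := SubType.on icl.
HB.instance Definition _ := Choice.on icl.
HB.instance Definition _ := 
  GRing.SubChoice_isSubComPzRing.Build S icl_pred icl icl_subring.

Lemma integral_base y : icl_pred (f y).
Proof.
apply/asboolP; exists 1%N, (fun=> - y).
by rewrite big_ord1 expr1 expr0 mulr1 rmorphN subrr.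
Qed.
Definition to_icl (y : R) : icl := exist _ (f y) (integral_base y).

Lemma to_icl_is_zmod_morphism : zmod_morphism to_icl.
Proof. by move=> x y; apply: val_inj; rewrite rmorphB /= rmorphB. Qed.
Lemma to_icl_is_monoid_morphism : monoid_morphism to_icl.
Proof.
split; first by apply: val_inj; rewrite rmorph1 /= rmorph1.
by move=> x y; apply: val_inj; rewrite rmorphM /= rmorphM.
Qed.
HB.instance Definition _ :=
  GRing.isZmodMorphism.Build R icl to_icl to_icl_is_zmod_morphism.
HB.instance Definition _ :=
  GRing.isMonoidMorphism.Build R icl to_icl to_icl_is_monoid_morphism.

End IntegralClosure.

(** * Projective schemes *)

(* Only the closure properties of the homogeneous parts are recorded: they are
   what is needed to form Proj and its sheaves. *)
Record gradedRing := GradedRing {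
  gcarrier :> comPzRingType;
  gpart : nat -> set gcarrier;
  gpart0 : forall d, gpart d 0;
  gpartB : forall d x y, gpart d x -> gpart d y -> gpart d (x - y);
  gpart1 : gpart 0 1;
  gpartM : forall d e x y, gpart d x -> gpart e y -> gpart (d + e) (x * y) }.
Arguments gpart {_}.

Lemma gpartD (S : gradedRing) d (x y : S) :
  gpart d x -> gpart d y -> gpart d (x + y).
Proof.
move=> hx hy; rewrite -[y]opprK; apply: gpartB => //.
by rewrite -sub0r; apply: gpartB => //; exact: gpart0.
Qed.

Record gradedMorphism (S S' : gradedRing) := GradedMorphism {
  gmor :> {rmorphism S -> S'};
  gmorP : forall d x, gpart d x -> gpart d (gmor x) }.

(* Points of Proj S: homogeneous primes not containing all elements of
   positive degree. *)
Record proj (S : gradedRing) := Proj {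
  pideal : ideal S;
  proj_prime1 : ~ pideal 1;
  proj_primeM : forall x y, pideal (x * y) -> pideal x \/ pideal y;
  proj_homog : forall n (x : 'I_n -> S), (forall i : 'I_n, gpart i (x i)) ->
    pideal (\sum_(i < n) x i) -> forall i, pideal (x i);
  proj_relevant : exists d x, [/\ (0 < d)%N, gpart d x & ~ pideal x] }.

Definition zopen (S : gradedRing) (U : set (proj S)) : Prop :=
  exists E : set S, (forall x, E x -> exists d, gpart d x) /\
    U = [set p | exists x, E x /\ ~ pideal p x].

Section HomogeneousFractions.
Variables (S : gradedRing) (J : ideal S) (n : nat) (p : proj S).

Definition hden : set S := [set t | exists e, gpart e t /\ ~ pideal p t].

(* Fractions x/t of degree n with x homogeneous in the homogeneous ideal J and
   t homogeneous outside p: the stalk at p of the sheaf attached to J(n). *)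
Definition hfrac_pred : {pred loc hden} := fun u =>
  `[< exists e x t, [/\ J x, gpart (n + e) x, gpart e t, ~ pideal p t
                      & u = lfrac hden x t] >].

Lemma hden_mulgen e t : gpart e t -> ~ pideal p t -> mulgen hden t.
Proof. by move=> ht hp; apply: mulgen_sub; exists e. Qed.

Lemma hfrac_zmod : zmod_closed hfrac_pred.
Proof.
split=> [|u v /asboolP[e [x [t [Jx gx gt pt ->]]]]].
  apply/asboolP; exists 0%N, 0, 1; split=> //.
  - exact: ideal0.
  - exact: gpart0.
  - exact: gpart1.
  - exact: proj_prime1.
move=> /asboolP[e' [x' [t' [Jx' gx' gt' pt' ->]]]].
apply/asboolP; exists (e + e')%N, (x * t' - x' * t), (t * t'); split.
- by apply: idealB; rewrite mulrC; apply: idealM.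
- apply: gpartB; first by rewrite addnA; exact: gpartM.
  by rewrite (addnC e) addnA; exact: gpartM.
- exact: gpartM.
- by case/proj_primeM.
- by rewrite lfracB//; apply: hden_mulgen; eassumption.
Qed.
HB.instance Definition _ :=
  GRing.isZmodClosed.Build (loc hden) hfrac_pred hfrac_zmod.

Definition hfrac := {u : loc hden | hfrac_pred u}.
HB.instance Definition _ := SubType.on hfrac.
HB.instance Definition _ := Choice.on hfrac.
HB.instance Definition _ :=
  GRing.SubChoice_isSubZmodule.Build (loc hden) hfrac_pred hfrac hfrac_zmod.

(* The class of x/t, meaningful when x/t satisfies [hfrac_pred]. *)
Definition hfrac_elt (x t : S) : hfrac := insubd 0 (lfrac hden x t).

End HomogeneousFractions.
Arguments hden {S} p.
Arguments hfrac_pred {S} J n p.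
Arguments hfrac {S} J n p.
Arguments hfrac_elt {S} J n p x t.
Arguments hfrac_zmod {S} J n p.

Section StructureStalk.
Variables (S : gradedRing) (p : proj S).

Definition ostalk_pred : {pred loc (hden p)} := hfrac_pred ideal_full 0 p.

Lemma ostalk_subring : subring_closed ostalk_pred.
Proof.
have [_ hB] := hfrac_zmod ideal_full 0 p; split=> //.
  apply/asboolP; exists 0%N, 1, 1; split=> //.
  - exact: gpart1.
  - exact: gpart1.
  - exact: proj_prime1.
move=> u v /asboolP[e [x [t [_ gx gt pt ->]]]].
move=> /asboolP[e' [x' [t' [_ gx' gt' pt' ->]]]].
apply/asboolP; exists (e + e')%N, (x * x'), (t * t'); split.
- by [].
- exact: (gpartM (d := e) (e := e')).
- exact: gpartM.
- by case/proj_primeM.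
- by rewrite lfracM//; apply: hden_mulgen; eassumption.
Qed.
HB.instance Definition _ :=
  GRing.isSubringClosed.Build (loc (hden p)) ostalk_pred ostalk_subring.

Definition ostalk := {u : loc (hden p) | ostalk_pred u}.
HB.instance Definition _ := SubType.on ostalk.
HB.instance Definition _ := Choice.on ostalk.
HB.instance Definition _ :=
  GRing.SubChoice_isSubComPzRing.Build _ ostalk_pred ostalk ostalk_subring.

Section StalkModule.
Variables (J : ideal S) (n : nat).

Lemma hfrac_scale_subproof (a : ostalk) (u : hfrac J n p) :
  hfrac_pred J n p (val a * val u).
Proof.
case: a => _ /=/asboolP[e [x [t [_ gx gt pt ->]]]].
case: u => _ /=/asboolP[e' [x' [t' [Jx' gx' gt' pt' ->]]]].
apply/asboolP; exists (e + e')%N, (x * x'), (t * t'); split.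
- exact: idealM.
- by rewrite addnCA; exact: gpartM.
- exact: gpartM.
- by case/proj_primeM.
- by rewrite lfracM//; apply: hden_mulgen; eassumption.
Qed.
Definition hfrac_scale a u : hfrac J n p :=
  exist (fun w => hfrac_pred J n p w) _ (hfrac_scale_subproof a u).

Lemma hfrac_scaleA a b u : hfrac_scale a (hfrac_scale b u) = hfrac_scale (a * b) u.
Proof. by apply: val_inj; rewrite /= mulrA. Qed.
Lemma hfrac_scale1 : left_id 1 hfrac_scale.
Proof. by move=> u; apply: val_inj; rewrite /= mul1r. Qed.
Lemma hfrac_scaleDr : right_distributive hfrac_scale +%R.
Proof. by move=> a u v; apply: val_inj; rewrite /= mulrDr. Qed.
Lemma hfrac_scaleDl u : {morph hfrac_scale^~ u : a b / a + b}.
Proof. by move=> a b; apply: val_inj; rewrite /= mulrDl. Qed.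
HB.instance Definition _ := GRing.Zmodule_isLmodule.Build ostalk (hfrac J n p)
  hfrac_scaleA hfrac_scale1 hfrac_scaleDr hfrac_scaleDl.

End StalkModule.
End StructureStalk.
Arguments ostalk_pred {S} p.
Arguments ostalk {S} p.

(** ** Sheaves of modules on Proj

    A sheaf of modules is given by its stalks and, for every open U, by the
    families of germs which are sections over U.  A family is indexed by all
    points, but only its values on U matter for being a section over U. *)

Record modSheaf (S : gradedRing) := ModSheaf {
  mstalk : forall p : proj S, lmodType (ostalk p);
  msection : set (proj S) -> (forall p, mstalk p) -> Prop }.

Definition global_sections (S : gradedRing) (F : modSheaf S) :
    set (forall p, mstalk F p) := msection setT.
Arguments global_sections {S} F.

Section Sheaves.
Variable S : gradedRing.
Implicit Types F G L : modSheaf S.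

(* The sheaf attached to the graded module J(n): n = 0 gives the ideal sheaf
   associated with J, and J = S gives O(n). *)
Definition sheaf_of (J : ideal S) (n : nat) : modSheaf S :=
  @ModSheaf S (fun p => hfrac J n p) (fun U s =>
    forall p, U p -> exists W e x t,
      [/\ zopen W, W p & W `<=` U] /\ [/\ J x, gpart (n + e) x, gpart e t &
        forall q, W q -> ~ pideal q t /\ val (s q) = lfrac (hden q) x t]).

Definition osheaf (n : nat) : modSheaf S := sheaf_of ideal_full n.

(* The sheaf associated with the presheaf tensor product. *)
Definition tensor_sheaf F G : modSheaf S :=
  @ModSheaf S (fun p => tens idfun (mstalk F p) (mstalk G p)) (fun U s =>
    forall p, U p -> exists W (l : seq ((forall q, mstalk F q) * (forall q, mstalk G q))),
      [/\ zopen W, W p & W `<=` U] /\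
      [/\ List.Forall (fun ab => msection W ab.1 /\ msection W ab.2) l &
        forall q, W q -> s q = \sum_(ab <- l) tens_pure idfun (ab.1 q) (ab.2 q)]).

Fixpoint tensor_power L (d : nat) : modSheaf S :=
  if d is d'.+1 then tensor_sheaf L (tensor_power L d') else osheaf 0.

Fixpoint stalk_power L (p : proj S) (u : mstalk L p) (d : nat) :
    mstalk (tensor_power L d) p :=
  if d is d'.+1 then tens_pure idfun u (stalk_power u d') else hfrac_elt _ _ _ 1 1.

End Sheaves.

Section Pullback.
Variables (S S' : gradedRing) (f : gradedMorphism S S').

(* The morphism Proj S' -> Proj S induced by f, in case it is defined on all of
   Proj S'; it is then unique. *)
Record projMorphism := ProjMorphism {
  pmap :> proj S' -> proj S;
  pmapP : forall p x, pideal (pmap p) x <-> pideal p (f x) }.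

Variable rho : projMorphism.

Lemma hden_pmap p t : hden (rho p) t -> hden p (f t).
Proof. by move=> [e [gt pt]]; exists e; split; [exact: gmorP|move/pmapP]. Qed.

Lemma ostalk_map_subproof p (u : ostalk (rho p)) :
  ostalk_pred p (locmap (hden p) f (val u)).
Proof.
case: u => _ /=/asboolP[e [x [t [_ gx gt pt ->]]]].
rewrite locmap_lfrac; [|exact: hden_pmap|by apply: hden_mulgen; eassumption].
apply/asboolP; exists e, (f x), (f t); split=> //; [exact: gmorP..|].
by move/pmapP.
Qed.
Definition ostalk_map p (u : ostalk (rho p)) : ostalk p :=
  exist (fun w => ostalk_pred p w) _ (ostalk_map_subproof u).

Definition pullback (F : modSheaf S) : modSheaf S' :=
  @ModSheaf S' (fun p => tens (@ostalk_map p) (mstalk F (rho p)) (hfrac ideal_full 0 p))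
  (fun U s => forall p, U p -> exists W V
      (l : seq ((forall q, mstalk F q) * (forall q, hfrac ideal_full 0 q))),
      [/\ zopen W, W p, W `<=` U, zopen V & forall q, W q -> V (rho q)] /\
      [/\ List.Forall (fun ab => msection V ab.1 /\
                         @msection _ (osheaf S' 0) W ab.2) l &
        forall q, W q ->
          s q = \sum_(ab <- l) tens_pure (@ostalk_map q) (ab.1 (rho q)) (ab.2 q)]).

Definition pullback_O1 : modSheaf S' := pullback (osheaf S 1).

(* F(d) *)
Definition twist (F : modSheaf S') (d : nat) : modSheaf S' :=
  tensor_sheaf F (tensor_power pullback_O1 d).

(* The germ at p of the section of the pullback of O(1) given by y of degree 1. *)
Definition germ_O1 (y : S) (p : proj S') : mstalk pullback_O1 p :=
  tens_pure (@ostalk_map p) (hfrac_elt ideal_full 1 (rho p) y 1)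
                            (hfrac_elt ideal_full 0 p 1 1).

(* s is the section of J(d) associated with x of degree d: at every point p
   and for every y of degree 1 not vanishing at p, it is x/y^d (x) y^(x)d. *)
Definition is_associated_section (J : ideal S') (d : nat) (x : S')
    (s : forall p, mstalk (twist (sheaf_of J 0) d) p) : Prop :=
  forall p y, gpart 1 y -> ~ pideal p (f y) ->
    s p = tens_pure idfun (hfrac_elt J 0 p x (f y ^+ d))
                          (stalk_power (germ_O1 y p) d).

(* The natural map from J_d to the global sections of J(d) is an isomorphism;
   linearity is over the ring of elements of degree 0. *)
Definition natural_isomorphism (J : ideal S') (d : nat) : Prop :=
  exists Phi : S' -> forall p, mstalk (twist (sheaf_of J 0) d) p,
  [/\ forall x, J x -> gpart d x -> is_associated_section x (Phi x),
      set_bij [set x | J x /\ gpart d x]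
        (global_sections (twist (sheaf_of J 0) d)) Phi,
      forall x y, J x -> gpart d x -> J y -> gpart d y ->
        Phi (x + y) = (fun p => Phi x p + Phi y p) &
      forall c x, gpart 0 c -> J x -> gpart d x ->
        Phi (c * x) = (fun p => (insubd 0 (lfrac (hden p) c 1) : ostalk p) *: Phi x p)].

End Pullback.

(** * The rings R_V *)

Section RV.
Variables (Fq : finFieldType) (V : lmodType Fq).

Record coordinates := Coordinates {
  cdim : nat;
  cmap : {linear V -> 'rV[Fq]_cdim};
  cmap_bij : bijective cmap }.

(* For finite dimensional V, coordinates with respect to some chosen basis;
   they identify the symmetric algebra of V with a polynomial ring.  The value
   for V of infinite dimension is irrelevant. *)
Definition chosen_coordinates : {n : nat & V -> 'rV[Fq]_n} :=
  match pselect (exists c : coordinates, True) with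
  | left h => let c := projT1 (cid h) in existT _ (cdim c) (fun v => cmap c v)
  | right _ => existT _ 0%N (fun=> 0)
  end.

Definition symdim : nat := projT1 chosen_coordinates.
Definition coords (v : V) : 'rV[Fq]_symdim := projT2 chosen_coordinates v.

Definition symalg := {mpoly Fq[symdim]}.
Definition sym_of (v : V) : symalg := \sum_(i < symdim) coords v 0 i *: 'X_i.

Definition KV := {fraction symalg}.
HB.instance Definition _ := GRing.Field.on KV.

Definition KV_of (v : V) : KV := @tofrac symalg (sym_of v).
Definition KV_const (c : Fq) : KV := @tofrac symalg c%:MP.

Definition is_subalg (P : set KV) : Prop :=
  [/\ forall c, P (KV_const c), forall x y, P x -> P y -> P (x - y)
    & forall x y, P x -> P y -> P (x * y)].

Definition RV_pred : {pred KV} := fun x =>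
  `[< forall P, is_subalg P -> (forall v, v != 0 -> P (KV_of v)^-1) -> P x >].

Lemma KV_const_is_zmod_morphism : zmod_morphism KV_const.
Proof. by move=> x y; rewrite /KV_const mpolyCB rmorphB. Qed.
Lemma KV_const_is_monoid_morphism : monoid_morphism KV_const.
Proof.
split; first by rewrite /KV_const mpolyC1 rmorph1.
by move=> x y; rewrite /KV_const mpolyCM rmorphM.
Qed.
HB.instance Definition _ :=
  GRing.isZmodMorphism.Build Fq KV KV_const KV_const_is_zmod_morphism.
HB.instance Definition _ :=
  GRing.isMonoidMorphism.Build Fq KV KV_const KV_const_is_monoid_morphism.

Lemma RV_const c : RV_pred (KV_const c).
Proof. by apply/asboolP => P [h _ _] _; exact: h. Qed.

Lemma RV_subring : subring_closed RV_pred.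
Proof.
split=> [|x y /asboolP hx /asboolP hy|x y /asboolP hx /asboolP hy].
- by rewrite -(rmorph1 KV_const); exact: RV_const.
- by apply/asboolP => P PA PV; have [_ h _] := PA; apply: h; [exact: hx|exact: hy].
- by apply/asboolP => P PA PV; have [_ _ h] := PA; apply: h; [exact: hx|exact: hy].
Qed.
HB.instance Definition _ := GRing.isSubringClosed.Build KV RV_pred RV_subring.

Definition RV := {x : KV | RV_pred x}.
HB.instance Definition _ := SubType.on RV.
HB.instance Definition _ := Choice.on RV.
HB.instance Definition _ :=
  GRing.SubChoice_isSubComNzRing.Build KV RV_pred RV RV_subring.

Definition RV_of (c : Fq) : RV := exist (fun x => RV_pred x) _ (RV_const c).
Lemma RV_of_is_zmod_morphism : zmod_morphism RV_of.
Proof. by move=> x y; apply: val_inj; rewrite rmorphB /= rmorphB. Qed.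
Lemma RV_of_is_monoid_morphism : monoid_morphism RV_of.
Proof.
split; first by apply: val_inj; rewrite rmorph1 /= rmorph1.
by move=> x y; apply: val_inj; rewrite rmorphM /= rmorphM.
Qed.
HB.instance Definition _ :=
  GRing.isZmodMorphism.Build Fq RV RV_of RV_of_is_zmod_morphism.
HB.instance Definition _ :=
  GRing.isMonoidMorphism.Build Fq RV RV_of RV_of_is_monoid_morphism.

Lemma coords0 : coords 0 = 0.
Proof.
rewrite /coords /symdim /chosen_coordinates.
by case: pselect => //= h; rewrite raddf0.
Qed.

Lemma RV_inv v : RV_pred (KV_of v)^-1.
Proof.
have [->|v0] := eqVneq v 0; last by apply/asboolP => P _; exact.
suff -> : (KV_of 0)^-1 = KV_const 0 by exact: RV_const.
rewrite raddf0 /KV_of /sym_of big1 ?rmorph0 ?invr0// => i _.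
by rewrite coords0 mxE scale0r.
Qed.

(* 1/v, with 1/0 = 0 *)
Definition rinv (v : V) : RV := exist (fun x => RV_pred x) _ (RV_inv v).

End RV.
Arguments RV_of {Fq} V.

(** * Admissible coefficient rings *)

Section CoefficientRing.
Variables (Fq : finFieldType) (F : fieldType) (iota : {rmorphism Fq -> F}).

(* F is a finite extension of a rational function field Fq(t). *)
Definition global_function_field : Prop :=
  exists t : F, ~ algebraicOver iota t /\
  exists n (b : 'I_n -> F), forall x, exists p q : 'I_n -> {poly Fq},
    (forall i, (map_poly iota (q i)).[t] != 0) /\
    x = \sum_(i < n) (map_poly iota (p i)).[t] / (map_poly iota (q i)).[t] * b i.

(* A place is given by its valuation ring. *)
Definition place (O : set F) : Prop :=
  [/\ forall c, O (iota c),
      forall x y, O x -> O y -> O (x - y),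
      forall x y, O x -> O y -> O (x * y),
      forall x, O x \/ O x^-1 &
      exists x, ~ O x].

Variable infty : set F.

Definition coef_pred : {pred F} := fun x =>
  `[< forall O, place O -> O <> infty -> O x >].

Lemma coef_const c : coef_pred (iota c).
Proof. by apply/asboolP => O [h]. Qed.

Lemma coef_subring : subring_closed coef_pred.
Proof.
split=> [|x y /asboolP hx /asboolP hy|x y /asboolP hx /asboolP hy].
- by rewrite -(rmorph1 iota); exact: coef_const.
- by apply/asboolP => O PO Oi; have [_ h _ _ _] := PO; apply: h; [exact: hx|exact: hy].
- by apply/asboolP => O PO Oi; have [_ _ h _ _] := PO; apply: h; [exact: hx|exact: hy].
Qed.
HB.instance Definition _ := GRing.isSubringClosed.Build F coef_pred coef_subring.

Definition coefRing := {x : F | coef_pred x}.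
HB.instance Definition _ := SubType.on coefRing.
HB.instance Definition _ := Choice.on coefRing.
HB.instance Definition _ :=
  GRing.SubChoice_isSubComNzRing.Build F coef_pred coefRing coef_subring.
Local Notation A := coefRing.

Definition coef_of (c : Fq) : A := exist (fun x => coef_pred x) _ (coef_const c).
Lemma coef_of_is_zmod_morphism : zmod_morphism coef_of.
Proof. by move=> x y; apply: val_inj; rewrite rmorphB /= rmorphB. Qed.
Lemma coef_of_is_monoid_morphism : monoid_morphism coef_of.
Proof.
split; first by apply: val_inj; rewrite rmorph1 /= rmorph1.
by move=> x y; apply: val_inj; rewrite rmorphM /= rmorphM.
Qed.
HB.instance Definition _ :=
  GRing.isZmodMorphism.Build Fq A coef_of coef_of_is_zmod_morphism.
HB.instance Definition _ :=
  GRing.isMonoidMorphism.Build Fq A coef_of coef_of_is_monoid_morphism.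

(* The dimension of A/(a) over Fq. *)
Definition quodim (a : A) : nat :=
  xget 0%N [set n | exists e : 'I_n -> A, forall x : A,
    exists! c : 'rV[Fq]_n, exists b, x = \sum_(i < n) coef_of (c 0 i) * e i + a * b].

(* [None] stands for the degree -oo of 0. *)
Definition degA (a : A) : option nat := if a == 0 then None else Some (quodim a).

Definition deg_lt (d e : option nat) : Prop :=
  match d, e with
  | _, None => False
  | None, Some _ => True
  | Some m, Some n => (m < n)%N
  end.

Variable N : ideal A.

Definition Div : set A := [set a | forall x, N x -> exists b, x = a * b].

(* [mulgen D] is the set of finite products of elements of D. *)
Definition level_assumption : Prop :=
  exists D : set A, D `<=` Div /\
  [/\ forall a, a != 0 ->
        exists b, [/\ b != 0, mulgen D b & deg_lt (degA (a - b)) (degA a)],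
      forall a b, D a -> D b -> a <> b -> Div (a * b),
      forall a, Div a -> mulgen D a &
      exists a, forall x, N x <-> exists b, x = a * b].

(** ** The modules V^s_N *)

Definition FA := {ideal_quot coef_pred}.
HB.instance Definition _ := GRing.Zmodule.on FA.

Definition FAproj (x : F) : FA := \pi x.

Lemma FAprojP x y : FAproj x = FAproj y <-> coef_pred (x - y).
Proof.
by rewrite /FAproj; split=> [/eqP|h]; [rewrite piE|apply/eqP; rewrite piE].
Qed.
Lemma FAprojD x y : FAproj (x + y) = FAproj x + FAproj y.
Proof. by rewrite /FAproj !piE. Qed.
Lemma FAprojB x y : FAproj (x - y) = FAproj x - FAproj y.
Proof. by rewrite /FAproj !piE. Qed.
Lemma FAproj_repr (x : FA) : FAproj (repr x) = x. Proof. exact: reprK. Qed.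

Definition FAscale (a : A) (x : FA) : FA := FAproj (val a * repr x).

Lemma FAscaleE a x : FAscale a (FAproj x) = FAproj (val a * x).
Proof.
have [_ _ hM] := coef_subring.
apply/FAprojP; rewrite -mulrBr; apply: hM; first exact: (valP a).
by apply/FAprojP; rewrite FAproj_repr.
Qed.

Lemma FAscaleA a b x : FAscale a (FAscale b x) = FAscale (a * b) x.
Proof. by rewrite -[x]FAproj_repr !FAscaleE rmorphM mulrA. Qed.
Lemma FAscale1 : left_id 1 FAscale.
Proof. by move=> x; rewrite -[x]FAproj_repr !FAscaleE rmorph1 mul1r. Qed.
Lemma FAscaleDr : right_distributive FAscale +%R.
Proof.
move=> a x y; rewrite -[x]FAproj_repr -[y]FAproj_repr.
by rewrite -FAprojD !FAscaleE mulrDr FAprojD.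
Qed.
Lemma FAscaleDl x : {morph FAscale^~ x : a b / a + b}.
Proof.
by move=> a b; rewrite -[x]FAproj_repr !FAscaleE rmorphD mulrDl FAprojD.
Qed.
HB.instance Definition _ := GRing.Zmodule_isLmodule.Build A FA
  FAscaleA FAscale1 FAscaleDr FAscaleDl.

Definition invN : set F := [set x | forall n, N n -> coef_pred (x * val n)].

(* (N^-1/A)^s inside (F/A)^s *)
Definition VN_pred (s : nat) : {pred {ffun 'I_s -> FA}} := fun v =>
  `[< forall j, exists2 x, invN x & v j = FAproj x >].

Lemma VN_submod s : submod_closed (@VN_pred s).
Proof.
have [h1 hB hM] := coef_subring.
have h0 : coef_pred 0 by rewrite -(subrr 1); exact: hB.
split=> [|a u v /asboolP hu /asboolP hv].
  apply/asboolP => j; exists 0; last by rewrite ffunE -[LHS](subrr (FAproj 0)) -FAprojB subrr.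
  by move=> n _; rewrite mul0r.
apply/asboolP => j; have [x hx ux] := hu j; have [y hy vy] := hv j.
exists (val a * x + y); last by rewrite !ffunE ux vy FAprojD -FAscaleE.
move=> n Nn; rewrite mulrDl -mulrA -[y * _]opprK; apply/hB.
  by apply: hM; [exact: (valP a)|exact: hx].
by rewrite -sub0r; apply/hB => //; exact: hy.
Qed.

Definition VN (s : nat) := {v : {ffun 'I_s -> FA} | VN_pred v}.
HB.instance Definition _ s := SubType.on (VN s).
HB.instance Definition _ s := Choice.on (VN s).
HB.instance Definition _ s :=
  GRing.SubChoice_isSubLmodule.Build A {ffun 'I_s -> FA} (@VN_pred s) (VN s) (VN_submod s).

(* V^s_a, for a in Div(N) *)
Definition Va (s : nat) (a : A) : set (VN s) :=
  [set v : VN s | forall j : 'I_s, exists b : A, val v j = FAproj ((val a)^-1 * val b)].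

(* V^s_N as a vector space over Fq *)
Definition VNq (s : nat) : Type := VN s.
HB.instance Definition _ s := GRing.Zmodule.on (VNq s).
Definition VNq_scale s (c : Fq) (v : VNq s) : VNq s := coef_of c *: (v : VN s).
Lemma VNq_scaleA s c d v : @VNq_scale s c (VNq_scale d v) = VNq_scale (c * d) v.
Proof. by rewrite /VNq_scale scalerA rmorphM. Qed.
Lemma VNq_scale1 s : left_id 1 (@VNq_scale s).
Proof. by move=> v; rewrite /VNq_scale rmorph1 scale1r. Qed.
Lemma VNq_scaleDr s : right_distributive (@VNq_scale s) +%R.
Proof. by move=> c v w; rewrite /VNq_scale scalerDr. Qed.
Lemma VNq_scaleDl s v : {morph (@VNq_scale s)^~ v : c d / c + d}.
Proof. by move=> c d; rewrite /VNq_scale rmorphD scalerDl. Qed.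
HB.instance Definition _ s := GRing.Zmodule_isLmodule.Build Fq (VNq s)
  (@VNq_scaleA s) (@VNq_scale1 s) (@VNq_scaleDr s) (@VNq_scaleDl s).

(** ** The rings R_{A,V^s_N}, RS_{A,V^s_N} and their normalization *)

Section Rings.
Variable s : nat.

Definition RVF := tring (RV_of (VNq s)) iota.
HB.instance Definition _ := GRing.ComPzRing.on RVF.

Definition RVF_inv (v : VN s) : RVF := tring_pure _ _ (rinv (v : VNq s)) 1.

Definition RA_relations : set RVF := [set x | exists a v,
  [/\ Div a, ~ Va a v &
      x = tring_pure _ _ (rinv (a *: v : VNq s)) (val a)
          - \sum_(v' \in @Va s a) RVF_inv (v - v')]].

Definition RA := quoring (ideal_gen RA_relations).
HB.instance Definition _ := GRing.ComPzRing.on RA.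

Definition RA_const (c : F) : RA :=
  qproj (ideal_gen RA_relations) (tring_inr (RV_of (VNq s)) iota c).

Lemma RA_const_is_zmod_morphism : zmod_morphism RA_const.
Proof. by move=> x y; rewrite /RA_const !rmorphB. Qed.
Lemma RA_const_is_monoid_morphism : monoid_morphism RA_const.
Proof.
by split=> [|x y]; rewrite /RA_const; [rewrite !rmorph1|rewrite !rmorphM].
Qed.
HB.instance Definition _ :=
  GRing.isZmodMorphism.Build F RA RA_const RA_const_is_zmod_morphism.
HB.instance Definition _ :=
  GRing.isMonoidMorphism.Build F RA RA_const RA_const_is_monoid_morphism.

(* [1/v (x) 1] *)
Definition RA_gen (v : VN s) : RA := qproj (ideal_gen RA_relations) (RVF_inv v).

Definition nonzero_word (d : nat) (l : seq (VN s)) : Prop :=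
  size l = d /\ all (fun v => v != 0) l.

Definition RA_prod (l : seq (VN s)) : RA := \prod_(v <- l) RA_gen v.

(* The F-span of the products of d generators. *)
Definition RA_part (d : nat) : set RA := [set x | exists2 l : seq (F * seq (VN s)),
  (forall y, y \in l -> nonzero_word d y.2) &
  x = \sum_(y <- l) RA_const y.1 * RA_prod y.2].

Lemma RA_part0 d : RA_part d 0.
Proof. by exists [::]; rewrite ?big_nil. Qed.
Lemma RA_partB d x y : RA_part d x -> RA_part d y -> RA_part d (x - y).
Proof.
move=> [l hl ->] [m hm ->].
exists (l ++ [seq (- y.1, y.2) | y <- m]).
  by move=> z; rewrite mem_cat => /orP[/hl//|/mapP[w /hm ? ->]].
rewrite big_cat big_map -sumrN; congr (_ + _).
by apply: eq_bigr => z _; rewrite rmorphN mulNr.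
Qed.
Lemma RA_part1 : RA_part 0 1.
Proof.
exists [:: (1, [::])]; first by move=> z; rewrite inE => /eqP->.
by rewrite big_seq1 /RA_prod big_nil rmorph1 mulr1.
Qed.
Lemma RA_partM d e x y : RA_part d x -> RA_part e y -> RA_part (d + e) (x * y).
Proof.
move=> [l hl ->] [m hm ->].
exists [seq (y.1 * z.1, y.2 ++ z.2) | y <- l, z <- m].
  move=> _ /allpairsP[[y' z] [/hl[ly ay] /hm[lz az] ->]] /=.
  by split; rewrite ?size_cat ?ly ?lz// all_cat ay.
rewrite big_allpairs_dep /= mulr_suml; apply: eq_bigr => z _.
rewrite mulr_sumr; apply: eq_bigr => w _.
by rewrite /RA_prod big_cat rmorphM mulrACA.
Qed.
Definition RA_graded : gradedRing :=
  GradedRing RA_part0 RA_partB RA_part1 RA_partM.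

Definition RS := loc [set x : RA | exists2 v, v != 0 & x = RA_gen v].
HB.instance Definition _ := GRing.ComPzRing.on RS.

Definition RA_to_RS : RA -> RS := @lof RA _.
HB.instance Definition _ := GRing.RMorphism.on RA_to_RS.

(* The nonnegative part of the grading of RS. *)
Definition RS_part (d : nat) : set RS := [set u | exists e x l,
  [/\ RA_part (d + e) x, nonzero_word e l & u = lfrac _ x (RA_prod l)]].

Lemma RA_prod_mulgen e l : nonzero_word e l ->
  mulgen [set x : RA | exists2 v, v != 0 & x = RA_gen v] (RA_prod l).
Proof.
move=> [_ /allP hl]; exists [seq RA_gen v | v <- l]; last by rewrite big_map.
by move=> _ /mapP[v /hl v0 ->]; exists v.
Qed.

Lemma nonzero_word_cat d e l m :
  nonzero_word d l -> nonzero_word e m -> nonzero_word (d + e) (l ++ m).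
Proof. by move=> [<- al] [<- am]; split; rewrite ?size_cat// all_cat al. Qed.

Lemma RA_prod_part d l : nonzero_word d l -> RA_part d (RA_prod l).
Proof.
move=> hl; exists [:: (1, l)]; first by move=> z; rewrite inE => /eqP->.
by rewrite big_seq1 rmorph1 mul1r.
Qed.

Lemma RS_part0 d : RS_part d 0.
Proof.
exists 0%N, 0, [::]; split=> //; first exact: RA_part0.
by rewrite /RA_prod big_nil.
Qed.
Lemma RS_partB d u v : RS_part d u -> RS_part d v -> RS_part d (u - v).
Proof.
move=> [e [x [l [hx hl ->]]]] [e' [y [m [hy hm ->]]]].
exists (e + e')%N, (x * RA_prod m - y * RA_prod l), (l ++ m); split.
- apply: RA_partB; first by rewrite addnA; apply: RA_partM => //; exact: RA_prod_part.
  by rewrite (addnC e) addnA; apply: RA_partM => //; exact: RA_prod_part.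
- exact: nonzero_word_cat.
- by rewrite lfracB; [rewrite /RA_prod big_cat|exact: RA_prod_mulgen hl|
    exact: RA_prod_mulgen hm].
Qed.
Lemma RS_part1 : RS_part 0 1.
Proof.
exists 0%N, 1, [::]; split=> //; first exact: RA_part1.
by rewrite /RA_prod big_nil.
Qed.
Lemma RS_partM d d' u v : RS_part d u -> RS_part d' v -> RS_part (d + d') (u * v).
Proof.
move=> [e [x [l [hx hl ->]]]] [e' [y [m [hy hm ->]]]].
exists (e + e')%N, (x * y), (l ++ m); split.
- by rewrite addnACA; exact: RA_partM.
- exact: nonzero_word_cat.
- by rewrite lfracM; [rewrite /RA_prod big_cat|exact: RA_prod_mulgen hl|
    exact: RA_prod_mulgen hm].
Qed.

Definition Rnorm := icl RA_to_RS.
HB.instance Definition _ := GRing.ComPzRing.on Rnorm.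

Definition Rnorm_part (d : nat) : set Rnorm := [set x | RS_part d (val x)].

Lemma Rnorm_part0 d : Rnorm_part d 0. Proof. exact: RS_part0. Qed.
Lemma Rnorm_partB d x y : Rnorm_part d x -> Rnorm_part d y -> Rnorm_part d (x - y).
Proof. exact: RS_partB. Qed.
Lemma Rnorm_part1 : Rnorm_part 0 1. Proof. exact: RS_part1. Qed.
Lemma Rnorm_partM d e x y :
  Rnorm_part d x -> Rnorm_part e y -> Rnorm_part (d + e) (x * y).
Proof. exact: RS_partM. Qed.
Definition Rnorm_graded : gradedRing :=
  GradedRing Rnorm_part0 Rnorm_partB Rnorm_part1 Rnorm_partM.

Definition RA_to_Rnorm : {rmorphism RA -> Rnorm} := @to_icl RA RS RA_to_RS.

Lemma RA_to_Rnorm_graded d (x : RA) : RA_part d x -> Rnorm_part d (RA_to_Rnorm x).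
Proof.
move=> hx; exists 0%N, x, [::]; split=> //; first by rewrite addn0.
by rewrite /RA_prod big_nil.
Qed.
Definition RA_to_Rnorm_gmor : gradedMorphism RA_graded Rnorm_graded :=
  @GradedMorphism RA_graded Rnorm_graded RA_to_Rnorm RA_to_Rnorm_graded.

End Rings.

(** ** The boundary ideals *)

Section Boundary.
Variable r : nat.

(* The defining property of the F-algebra homomorphism attached to i. *)
Definition is_boundary_map (s : nat) (i : {linear VN s -> VN r})
    (f : {rmorphism RA r -> RS s}) : Prop :=
  [/\ forall c, f (RA_const r c) = RA_to_RS (RA_const s c),
      forall v', v' != 0 -> f (RA_gen (i v')) = RA_to_RS (RA_gen v') &
      forall v, ~ range i v -> f (RA_gen v) = 0].

Definition RA_positive : set (RA r) := [set x | exists n (y : 'I_n -> RA r),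
  (forall i : 'I_n, RA_part i.+1 (y i)) /\ x = \sum_(i < n) y i].

(* The homomorphism f attached to i is determined by [is_boundary_map], so that
   quantifying over f amounts to x being in its kernel. *)
Definition I_RA : set (RA r) := [set x | RA_positive x /\
  forall s (i : {linear VN s -> VN r}) (f : {rmorphism RA r -> RS s}),
    (1 <= s < r)%N -> injective i -> is_boundary_map i f -> f x = 0].

Definition I_norm : ideal (Rnorm r) :=
  ideal_rad (ideal_gen [set RA_to_Rnorm r x | x in I_RA]).

End Boundary.
End CoefficientRing.

(* Main.v *)
Require Import Defs.
From HB Require Import structures.
From mathcomp Require Import all_boot all_algebra ring zify.
From mathcomp Require Import boolp classical_sets functions fsbigop cardinality.
From mathcomp Require Import mpoly.

(* A section of O(d) over the open stratum, where all generators 1/v are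
   invertible, glues to a homogeneous element u of RS of degree d.  Extending
   over the boundary means that (1/v)^m u lies in the normalization for every v.
   If d >= 0, the module spanned by the words of large length in the generators
   times 1, u, ..., u^(n-1) is then stable under u, so u is integral.  For an
   ideal sheaf attached to a radical ideal J and d >= 1, a prime containing J but
   not u would contain all generators, hence u itself by the integral equation
   of u, a contradiction.  Injectivity and quasi-compactness rest on the
   existence of enough homogeneous primes: starting from any prime of the
   normalization, the elements with all components in it form a prime of the
   subring of sums of homogeneous elements, over which the normalization is
   integral, and one applies lying over.

   If V is not finite dimensional, [rinv] vanishes and so do all positive
   degree parts, so that finiteness of V need not be proved. *)

Set Implicit Arguments.
Unset Strict Implicit.
Unset Printing Implicit Defensive.

Import GRing.Theory.

Local Open Scope classical_set_scope.
Local Open Scope quotient_scope.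
Local Open Scope ring_scope.

(** * Primes avoiding a multiplicative set, integral equations *)

(** The normalization comes only with a family of homogeneous parts; that it is their sum would be a
    separate theorem. What is available is that these parts are independent, as inherited from RS,
    and that every element is integral over R_A, which is the sum of its parts. Hence the detour
    through a subring for homogeneous primes, and hence integral equations are made homogeneous by
    extracting a single degree. Independence is transported in stages: in K_V it follows from a
    common denominator; in R_A from the homogeneity of the relations, which lets the rule x -> x X^d
    in degree d extend to a ring morphism into R_A[X]; in RS from clearing denominators. Germs of
    the twists are elements of iterated tensor products. Multiplying the factors sends them into the
    localization at the point, injectively because some generator is invertible there. After this
    evaluation a section is just a family of fractions. *)

Definition is_prime (R : comPzRingType) (P : set R) : Prop :=
  ~ P 1 /\ forall x y, P (x * y) -> P x \/ P y.

Lemma prime_avoiding (R : comPzRingType) (I : ideal R) (T : set R) :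
  T 1 -> (forall x y, T x -> T y -> T (x * y)) -> (forall x, I x -> ~ T x) ->
  exists P : ideal R, [/\ is_prime P, forall x, I x -> P x & forall x, P x -> ~ T x].
Proof.
move=> T1 TM IT.
(* The ideal condition is imposed on the union of A with I so that the empty set, the union of the
   empty chain, is good. *)
pose good (A : set R) := is_ideal (A `|` I) /\ forall x, A x -> ~ T x.
have [|A [[Aid AT] Amax]] := @Zorn_bigcup R good.
  move=> F Fgood Ftot; split; last by move=> x [A FA Ax]; case: (Fgood A FA) => _; exact.
  have sub A x : F A -> (A `|` I) x -> (\bigcup_(X in F) X `|` I) x.
    by move=> FA [Ax|Ix]; [left; exists A|right].
  split=> [|x y|a x].
  - by right; exact: ideal0.
  - case=> [[A FA Ax]|Ix] [[B FB By]|Iy].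
    + have [AB|BA] := Ftot A B FA FB.
        have [[_ h _] _] := Fgood B FB.
        by apply: (sub B) => //; apply: h; left=> //; exact: AB.
      have [[_ h _] _] := Fgood A FA.
      by apply: (sub A) => //; apply: h; left=> //; exact: BA.
    + have [[_ h _] _] := Fgood A FA.
      by apply: (sub A) => //; apply: h; [left|right].
    + have [[_ h _] _] := Fgood B FB.
      by apply: (sub B) => //; apply: h; [right|left].
    + by right; exact: idealD.
  - case=> [[A FA Ax]|Ix]; last by right; exact: idealM.
    have [[_ _ h] _] := Fgood A FA.
    by apply: (sub A) => //; apply: h; left.
pose P : ideal R := Ideal Aid.
have PT x : P x -> ~ T x by case=> [|/IT//]; exact: AT.
(* Maximality of A, tested on the ideal P + Rx. *)
have meet (x : R) : ~ P x -> exists p a, P p /\ T (p + a * x).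
  move=> Px; apply: contrapT => nmeet.
  pose B : set R := [set z | exists p a, P p /\ z = p + a * x].
  have PB z : P z -> B z by move=> Pz; exists z, 0; rewrite mul0r addr0.
  apply: (Amax B); last split.
  - split=> [z Az|h]; first by apply: PB; left.
    apply: Px; left; apply: h; exists 0, 1; split; last by rewrite mul1r add0r.
    exact: ideal0.
  - have -> : B `|` I = B.
      by rewrite setUidl// => z Iz; apply: PB; right.
    split=> [|_ _ [p [a [Pp ->]]] [q [b [Pq ->]]]|c _ [p [a [Pp ->]]]].
    + by apply: PB; exact: ideal0.
    + by exists (p + q), (a + b); split; [exact: idealD|ring].
    + by exists (c * p), (c * a); split; [exact: idealM|ring].
  - by move=> _ [p [a [Pp ->]]] Tz; apply: nmeet; exists p, a.
exists P; split=> //; last by move=> x Ix; right.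
split=> [P1|x y Pxy]; first exact: (PT 1).
apply: contrapT => /not_orP[/meet[p [a [Pp Tp]]] /meet[q [b [Pq Tq]]]].
apply: (PT _ _ (TM _ _ Tp Tq)).
have -> : (p + a * x) * (q + b * y) =
  (q + b * y) * p + a * x * q + a * b * (x * y) by ring.
by do ?apply: idealD; apply: idealM.
Qed.

Lemma prime_exp (R : comPzRingType) (P : set R) x n :
  is_prime P -> P (x ^+ n) -> P x.
Proof.
move=> [P1 PM]; elim: n => [|n IHn]; first by rewrite expr0 => /P1.
by rewrite exprS => /PM[|/IHn].
Qed.

Lemma ideal_gen_span (R : comPzRingType) (A : set R) x : ideal_gen A x ->
  exists n (a b : 'I_n -> R), (forall i, A (a i)) /\ x = \sum_(i < n) a i * b i.
Proof.
pose J : set R := [set x | exists n (a b : 'I_n -> R),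
  (forall i, A (a i)) /\ x = \sum_(i < n) a i * b i].
have Jid : is_ideal J.
  split=> [|_ _ [n [a [b [ha ->]]]] [m [c [d [hc ->]]]]|z _ [n [a [b [ha ->]]]]].
  - by exists 0%N, (fun=> 0), (fun=> 0); split=> [[]//|]; rewrite big_ord0.
  - exists (n + m)%N,
      (fun i => match fintype.split i with inl i => a i | inr i => c i end),
      (fun i => match fintype.split i with inl i => b i | inr i => d i end).
    split=> [i|]; first by case: (fintype.split i).
    rewrite big_split_ord /=; congr (_ + _); apply: eq_bigr => i _.
      by rewrite (unsplitK (inl i)).
    by rewrite (unsplitK (inr i)).
  - exists n, a, (fun i => z * b i); split=> //.
    by rewrite mulr_sumr; apply: eq_bigr => i _; rewrite mulrCA.
move=> /(_ (Ideal Jid)); apply=> y hy.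
by exists 1%N, (fun=> y), (fun=> 1); split=> //; rewrite big_ord1 mulr1.
Qed.

(** The coefficients come from a set rather than from a ring with a morphism, because this is
    applied to [gsum], a subset of R. *)
Definition integral_in (R : comPzRingType) (H : set R) (b : R) : Prop :=
  exists n (c : 'I_n -> R), (forall i, H (c i)) /\
    b ^+ n + \sum_(i < n) c i * b ^+ i = 0.

(** * Integral equations with coefficients in an ideal *)

Section Rees.
Variables (R : comNzRingType) (H I : set R).
Hypotheses (H1 : H 1) (HB : forall x y, H x -> H y -> H (x - y)).
Hypothesis HM : forall x y, H x -> H y -> H (x * y).
Hypotheses (IH : I `<=` H) (I0 : I 0) (IB : forall x y, I x -> I y -> I (x - y)).
Hypothesis IM : forall x y, H x -> I y -> I (x * y).

(** Degree k > 0 carries I instead of its k-th power: only membership of coefficients in I is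
    wanted. *)
Definition rees_pred : {pred {poly R}} := fun q =>
  `[< (forall k, H q`_k) /\ forall k, I q`_k.+1 >].

Lemma rees_subring : subring_closed rees_pred.
Proof.
have H0 : H 0 by exact: IH.
have HD x y : H x -> H y -> H (x + y).
  by move=> hx hy; rewrite -[y]opprK; apply: HB => //; rewrite -sub0r; exact: HB.
have ID x y : I x -> I y -> I (x + y).
  by move=> hx hy; rewrite -[y]opprK; apply: IB => //; rewrite -sub0r; exact: IB.
split=> [|p q /asboolP[p1 p2] /asboolP[q1 q2]|p q /asboolP[p1 p2] /asboolP[q1 q2]];
  apply/asboolP.
- by split=> k; rewrite coef1; case: k => [|k] //=.
- by split=> k; rewrite coefB; [exact: HB|exact: IB].
- split=> k; rewrite coefM.
    by apply: big_ind => // i _; exact: HM.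
  apply: big_ind => // -[[|i] ik] _ /=; first by rewrite subn0; exact: IM.
  by rewrite mulrC; apply: IM.
Qed.
HB.instance Definition _ :=
  GRing.isSubringClosed.Build {poly R} rees_pred rees_subring.
Definition rees := {q : {poly R} | rees_pred q}.
HB.instance Definition _ := SubType.on rees.
HB.instance Definition _ := Choice.on rees.
HB.instance Definition _ :=
  GRing.SubChoice_isSubComNzRing.Build {poly R} rees_pred rees rees_subring.

(* If x = sum of a_i * b_i with a_i in I, then xT is integral over the Rees
   ring H + I T + I T^2 + ..., because each a_i T lies in it; the equation for
   x is the coefficient of T^n. *)
Lemma integral_in_ideal n (a b : 'I_n -> R) :
  (forall i, I (a i)) -> (forall i, integral_in H (b i)) ->
  exists k (c : 'I_k -> R), let x := \sum_(i < n) a i * b i in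
    (forall i, I (c i)) /\ x ^+ k + \sum_(i < k) c i * x ^+ i = 0.
Proof.
move=> Ia bint; set x := \sum_(i < n) _.
have H0 : H 0 by exact: IH.
pose v : {rmorphism rees -> {poly R}} := val.
have inv (q : rees) : integralOver v (v q) by exact: integral_id.
have cst (c : R) : H c -> rees_pred c%:P.
  move=> Hc; apply/asboolP; split=> k; rewrite coefC; case: eqP => //.
have lin (c : R) : I c -> rees_pred (c *: 'X).
  move=> Ic; apply/asboolP; split=> k; rewrite coefZ coefX.
    by case: eqP; rewrite ?mulr1 ?mulr0 => // _; exact: IH.
  by case: eqP; rewrite ?mulr1 ?mulr0.
have xint : integralOver v (x *: 'X).
  rewrite /x scaler_suml; apply: big_ind => [||i _]; first exact: integral0.
    by move=> p q; exact: integral_add.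
  have -> : (a i * b i) *: 'X = (a i *: 'X) * (b i)%:P.
    by rewrite [RHS]mulrC mul_polyC scalerA [b i * _]mulrC.
  apply: integral_mul; first by have := inv (exist (fun q => rees_pred q) _ (lin _ (Ia i))).
  have [m [c [Hc e]]] := bint i.
  apply/integralE; exists m, (fun j => exist (fun q => rees_pred q) _ (cst _ (Hc j))).
  rewrite /= -polyC_exp -[RHS](rmorph0 (@polyC R)) -e rmorphD rmorph_sum /=.
  by congr (_ + _); apply: eq_bigr => j _; rewrite polyCM polyC_exp.
have [k [c e]] := (integralE _ _).2 xint.
(* Since i < k, the index k - i is positive, which places the coefficient in I and not merely in
   H. *)
exists k, (fun i => (val (c i))`_(k - i)); split.
  move=> i; have /asboolP[_] := valP (c i).
  by rewrite -(subnSK (ltn_ord i)) => h; exact: h.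
have := congr1 (fun p : {poly R} => p`_k) e; rewrite coef0 => h; rewrite -[RHS]h.
rewrite coefD coef_sum exprZn coefZ coefXn eqxx mulr1; congr (_ + _).
apply: eq_bigr => i _.
by rewrite exprZn -scalerAr coefZ coefMXn ltnNge ltnW//= mulrC.
Qed.

End Rees.

(** * The determinant trick *)

Section Determinant.
Variables (S L : comNzRingType) (f : {rmorphism S -> L}).

(** The vector of the e_i is killed by u - C, hence by its determinant after multiplication by the
    adjugate. As one e_i is a unit, the determinant, which is the characteristic polynomial of C at
    u, vanishes. *)
Lemma integral_det n (u : L) (e : 'I_n -> L) (C : 'M[S]_n) :
  (forall i, u * e i = \sum_j f (C i j) * e j) ->
  (exists i z, z * e i = 1) -> integral f u.
Proof.
move=> ue [i0 [z ez]].
pose D : 'M[L]_n := map_mx f C.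
pose E : 'cV[L]_n := \col_i e i.
have DE : D *m E = u *: E.
  by apply/colP => i; rewrite !mxE ue; apply: eq_bigr => j _; rewrite !mxE.
have AE : (u%:M - D) *m E = 0 by rewrite mulmxBl DE mul_scalar_mx subrr.
have dE : \det (u%:M - D) *: E = 0.
  by rewrite -mul_scalar_mx -mul_adj_mx -mulmxA AE mulmx0.
have d0 : \det (u%:M - D) = 0.
  have := congr1 (fun M : 'cV[L]_n => M i0 0) dE; rewrite !mxE => h.
  by rewrite -[LHS]mulr1 -ez mulrCA h mulr0.
apply/integralE; exists (char_poly C); first exact: char_poly_monic.
rewrite map_char_poly /char_poly rootE -horner_evalE -det_map_mx.
rewrite -[X in _ == X]d0; apply/eqP; congr (\det _).
apply/matrixP => i j; rewrite !mxE /= /horner_eval hornerD hornerN hornerC.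
by congr (_ - _); rewrite hornerMn hornerX.
Qed.

End Determinant.

(** The zero ring is treated apart: there the equation of degree 0, which reads 1 = 0, holds. *)
Lemma integral_in_ideal_pz (R : comPzRingType) (H I : set R) :
  H 1 -> (forall x y, H x -> H y -> H (x - y)) ->
  (forall x y, H x -> H y -> H (x * y)) -> I `<=` H -> I 0 ->
  (forall x y, I x -> I y -> I (x - y)) ->
  (forall x y, H x -> I y -> I (x * y)) ->
  forall n (a b : 'I_n -> R),
  (forall i, I (a i)) -> (forall i, integral_in H (b i)) ->
  exists k (c : 'I_k -> R), let x := \sum_(i < n) a i * b i in
    (forall i, I (c i)) /\ x ^+ k + \sum_(i < k) c i * x ^+ i = 0.
Proof.
move=> H1 HB HM IH I0 IB IM n a b Ia bint.
have [R0|R1] := eqVneq (1 : R) 0.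
  exists 0%N, (fun=> 0); split=> [[]//|].
  by rewrite expr0 big_ord0 addr0.
pose Rn : comNzRingType := HB.pack (GRing.ComPzRing.sort R)
  (GRing.PzSemiRing_isNonZero.Build (GRing.ComPzRing.sort R) R1).
exact: (@integral_in_ideal Rn H I H1 HB HM IH I0 IB IM n a b Ia bint).
Qed.

Lemma integral_det_pz (S L : comPzRingType) (f : {rmorphism S -> L}) n (u : L)
    (e : 'I_n -> L) (C : 'M[S]_n) :
  (forall i, u * e i = \sum_j f (C i j) * e j) ->
  (exists i z, z * e i = 1) -> integral f u.
Proof.
move=> ue unit; have [L0|L1] := eqVneq (1 : L) 0.
  exists 0%N, (fun=> 0).
  by rewrite expr0 big_ord0 addr0.
have S1 : (1 : S) != 0.
  by apply: contraNneq L1 => /(congr1 f); rewrite rmorph1 rmorph0 => ->.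
pose Sn : comNzRingType := HB.pack (GRing.ComPzRing.sort S)
  (GRing.PzSemiRing_isNonZero.Build (GRing.ComPzRing.sort S) S1).
pose Ln : comNzRingType := HB.pack (GRing.ComPzRing.sort L)
  (GRing.PzSemiRing_isNonZero.Build (GRing.ComPzRing.sort L) L1).
exact: (@integral_det Sn Ln f n u e C ue unit).
Qed.

(** * Homogeneous primes *)

Definition graded_independent (R : comPzRingType) (gp : nat -> set R) : Prop :=
  forall n (x : 'I_n -> R), (forall i : 'I_n, gp i (x i)) ->
    \sum_(i < n) x i = 0 -> forall i, x i = 0.

Definition homogeneous_set (R : comPzRingType) (gp : nat -> set R) (P : set R) :=
  forall n (x : 'I_n -> R), (forall i : 'I_n, gp i (x i)) ->
    P (\sum_(i < n) x i) -> forall i, P (x i).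

(* In this section homogeneous components are handled through polynomials whose
   k-th coefficient has degree k: by independence, evaluation at 1 is injective
   on them. *)
Section GradedPolynomials.
Variables (R : comNzRingType) (gp : nat -> set R).
Hypotheses (gp0 : forall d, gp d 0)
  (gpB : forall d x y, gp d x -> gp d y -> gp d (x - y)) (gp1 : gp 0 1)
  (gpM : forall d e x y, gp d x -> gp e y -> gp (d + e) (x * y))
  (gind : graded_independent gp).

Let gpN d x : gp d x -> gp d (- x).
Proof. by move=> hx; rewrite -sub0r; exact: gpB. Qed.
Let gpD d x y : gp d x -> gp d y -> gp d (x + y).
Proof. by move=> hx hy; rewrite -[y]opprK; apply: gpB => //; exact: gpN. Qed.
Let gp_sum d (I : Type) (r : seq I) (P : pred I) (F : I -> R) :
  (forall i, P i -> gp d (F i)) -> gp d (\sum_(i <- r | P i) F i).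
Proof. by move=> h; apply: big_ind => //; exact: gpD. Qed.

Definition gpoly (q : {poly R}) : Prop := forall k, gp k q`_k.

Lemma gpoly_inj q : gpoly q -> q.[1] = 0 -> q = 0.
Proof.
move=> gq; rewrite horner_coef => e; apply/polyP => k; rewrite coef0.
have [kq|kq] := ltnP k (size q); last by rewrite nth_default.
have := @gind (size q) (fun i => q`_i) (fun i => gq i) _ (Ordinal kq); apply.
by rewrite -[RHS]e; apply: eq_bigr => i _; rewrite expr1n mulr1.
Qed.

Lemma gpolyB p q : gpoly p -> gpoly q -> gpoly (p - q).
Proof. by move=> hp hq k; rewrite coefB; exact: gpB. Qed.
Lemma gpoly0 : gpoly 0. Proof. by move=> k; rewrite coef0. Qed.
Lemma gpolyD p q : gpoly p -> gpoly q -> gpoly (p + q).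
Proof. by move=> hp hq k; rewrite coefD; exact: gpD. Qed.
Lemma gpoly_sum (I : Type) (r : seq I) (P : pred I) (F : I -> {poly R}) :
  (forall i, P i -> gpoly (F i)) -> gpoly (\sum_(i <- r | P i) F i).
Proof. by move=> h; apply: big_ind => //; [exact: gpoly0|exact: gpolyD]. Qed.
Lemma gpolyM p q : gpoly p -> gpoly q -> gpoly (p * q).
Proof.
move=> hp hq k; rewrite coefM; apply: gp_sum => i _.
by have := gpM (hp i) (hq (k - i)%N); rewrite subnKC// -ltnS.
Qed.
Lemma gpolyZXn d x : gp d x -> gpoly (x *: 'X^d).
Proof.
move=> hx k; rewrite coefZ coefXn; case: eqP => [->|_]; first by rewrite mulr1.
by rewrite mulr0.
Qed.
Lemma gpoly1 : gpoly 1.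
Proof. by move=> k; rewrite coef1; case: k. Qed.
Definition gsum : set R := [set x | exists2 q, gpoly q & x = q.[1]].

Lemma gsum1 : gsum 1. Proof. by exists 1; rewrite ?hornerE//; exact: gpoly1. Qed.
Lemma gsumB x y : gsum x -> gsum y -> gsum (x - y).
Proof.
by move=> [p hp ->] [q hq ->]; exists (p - q); rewrite ?hornerE//; exact: gpolyB.
Qed.
Lemma gsumM x y : gsum x -> gsum y -> gsum (x * y).
Proof.
by move=> [p hp ->] [q hq ->]; exists (p * q); rewrite ?hornerE//; exact: gpolyM.
Qed.
Lemma gsum_part d x : gp d x -> gsum x.
Proof.
by move=> hx; exists (x *: 'X^d); [exact: gpolyZXn|rewrite !hornerE expr1n mulr1].
Qed.

Lemma gsum_sum n (c : nat -> R) : (forall k, gp k (c k)) -> gsum (\sum_(k < n) c k).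
Proof.
move=> gc; exists (\sum_(k < n) c k *: 'X^k).
  by apply: gpoly_sum => k _; exact: gpolyZXn.
by rewrite horner_sum; apply: eq_bigr => k _; rewrite !hornerE expr1n mulr1.
Qed.

Section Star.
Variable Q : set R.
Hypotheses (Qid : is_ideal Q) (Qprime : is_prime Q).

(* The complement in [gsum] of the largest homogeneous ideal contained in Q. *)
Definition some_comp_out : set R :=
  [set x | exists q, [/\ gpoly q, x = q.[1] & exists k, ~ Q q`_k]].
Definition all_comp_in : set R :=
  [set x | exists q, [/\ gpoly q, x = q.[1] & forall k, Q q`_k]].

Let Q0 : Q 0. Proof. by case: Qid. Qed.
Let QD x y : Q x -> Q y -> Q (x + y). Proof. by case: Qid => _ + _; exact. Qed.
Let QM a x : Q x -> Q (a * x). Proof. by case: Qid => _ _; exact. Qed.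
Let QN x : Q x -> Q (- x). Proof. by rewrite -mulN1r; exact: QM. Qed.
Let QMr a x : Q x -> Q (x * a). Proof. by rewrite mulrC; exact: QM. Qed.

Lemma first_out (q : {poly R}) : (exists k, ~ Q q`_k) ->
  exists k, ~ Q q`_k /\ forall i, (i < k)%N -> Q q`_i.
Proof.
move=> [k0 hk0].
have ex : exists k, ~~ `[< Q q`_k >] by exists k0; apply/asboolP.
case: (ex_minnP ex) => k /asboolP hk kmin; exists k; split=> // i ik.
apply: contrapT => hi; have := kmin i; rewrite leqNgt ik => /(_ _)/negP; apply.
  by apply/asboolP.
by [].
Qed.

(** Let k and l be the lowest degrees in which the two factors leave Q. In degree k + l of the
    product every other term lies in Q, and primality keeps the remaining one outside. *)
Lemma some_comp_outM x y :
  some_comp_out x -> some_comp_out y -> some_comp_out (x * y).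
Proof.
move=> [p [gp_p -> /first_out[k [pk pmin]]]] [q [gq -> /first_out[l [ql qmin]]]].
exists (p * q); split; [exact: gpolyM|by rewrite hornerM|exists (k + l)%N].
have kl : (k < (k + l).+1)%N by rewrite ltnS leq_addr.
rewrite coefM (bigD1 (Ordinal kl)) //= addKn; set s := \sum_(_ < _ | _) _ => h.
have Qs : Q s.
  apply: big_ind => // i; rewrite -val_eqE /= => ik.
  have [ik'|ik'] := ltnP i k; first by apply: QMr; exact: pmin.
  by apply: QM; apply: qmin; have := ltn_ord i; lia.
have : Q (p`_k * q`_l) by rewrite -[X in Q X](addrK s); apply: QD => //; exact: QN.
by case: Qprime => _ h' /h'[].
Qed.

Lemma some_comp_out1 : some_comp_out 1.
Proof.
exists 1; split; [exact: gpoly1|by rewrite hornerE|exists 0%N; rewrite coef1/=].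
by case: Qprime.
Qed.

Lemma all_comp_in_out x : all_comp_in x -> ~ some_comp_out x.
Proof.
move=> [p [hp -> Qp]] [q [hq e [k Qk]]].
have /eqP : p - q = 0.
  by apply: gpoly_inj; [exact: gpolyB|rewrite hornerD hornerN e subrr].
by rewrite subr_eq0 => /eqP pq; apply: Qk; rewrite -pq.
Qed.

Lemma all_comp_in0 : all_comp_in 0.
Proof.
by exists 0; split=> [||k]; [exact: gpoly0|rewrite horner0|rewrite coef0].
Qed.

Lemma all_comp_inB x y : all_comp_in x -> all_comp_in y -> all_comp_in (x - y).
Proof.
move=> [p [hp -> Qp]] [q [hq -> Qq]]; exists (p - q).
split=> [||k]; [exact: gpolyB|by rewrite !hornerE|rewrite coefB].
by apply: QD => //; exact: QN.
Qed.

Lemma all_comp_inM x y : gsum x -> all_comp_in y -> all_comp_in (x * y).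
Proof.
move=> [p hp ->] [q [hq -> Qq]]; exists (p * q).
split=> [||k]; [exact: gpolyM|by rewrite !hornerE|rewrite coefM].
by apply: big_ind => // i _; apply: QM.
Qed.

Hypothesis int : forall b, integral_in gsum b.

(** Lying over for R over [gsum]. An element of [gsum] in the ideal extended from [all_comp_in] has
    an integral equation with lower coefficients in [all_comp_in], so one of its powers is there;
    hence the extended ideal misses [some_comp_out]. A prime P with this property meets [gsum]
    exactly in [all_comp_in], which makes it homogeneous. *)
Lemma homogeneous_prime_over : exists P : ideal R,
  [/\ is_prime P, homogeneous_set gp P, forall x, all_comp_in x -> P x &
      forall x, P x -> ~ some_comp_out x].
Proof.
have [x|P [Pp PI PT]] := prime_avoiding (I := ideal_gen all_comp_in)
    some_comp_out1 some_comp_outM.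
  move=> Ix Tx.
  have := ideal_gen_span Ix.
  move=> [n [a [b [ha xE]]]].
  have sub : all_comp_in `<=` gsum by move=> y [q [gq -> _]]; exists q.
  have [k [c [hc]]] := integral_in_ideal_pz gsum1 gsumB gsumM sub
    all_comp_in0 all_comp_inB all_comp_inM ha (fun i => int (b i)).
  rewrite -xE => /eqP; rewrite addr_eq0 => /eqP xk.
  have gx : gsum x by case: Tx => q [gq -> _]; exists q.
  have gxn m : gsum (x ^+ m).
    elim: m => [|m IHm]; first exact: gsum1.
    by rewrite exprS; exact: gsumM.
  have Txn m : some_comp_out (x ^+ m).
    elim: m => [|m IHm]; first exact: some_comp_out1.
    by rewrite exprS; exact: some_comp_outM.
  apply: (all_comp_in_out _ (Txn k)); rewrite xk -sub0r.
  apply: all_comp_inB; first exact: all_comp_in0.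
  apply: big_ind => [|y z hy hz|i _]; first exact: all_comp_in0.
    rewrite -[z]opprK; apply: all_comp_inB => //; rewrite -sub0r.
    by apply: all_comp_inB => //; exact: all_comp_in0.
  by rewrite mulrC; exact: all_comp_inM.
exists P; split=> //; last first.
  by move=> x hx; apply: PI => J; exact.
move=> n x gx Px i.
pose q := \sum_(j < n) x j *: 'X^j : {poly R}.
have gq : gpoly q by apply: gpoly_sum => j _; exact: gpolyZXn.
have qi (j : 'I_n) : q`_j = x j.
  rewrite coef_sum (bigD1 j)//= coefZ coefXn eqxx mulr1 big1 ?addr0// => l lj.
  rewrite coefZ coefXn; case: eqP => [/val_inj jl|]; last by rewrite mulr0.
  by rewrite jl eqxx in lj.
have q1 : q.[1] = \sum_(j < n) x j.
  rewrite horner_sum; apply: eq_bigr => j _.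
  by rewrite !hornerE expr1n mulr1.
have qQ : forall k, Q q`_k.
  by apply: contrapT => /existsNP[k hk]; apply: (PT _ Px); exists q; split=> //; exists k.
apply: PI => J; apply; exists (x i *: 'X^i); split.
- exact: gpolyZXn.
- by rewrite !hornerE expr1n mulr1.
- move=> k; rewrite coefZ coefXn; case: eqP => _; rewrite ?mulr0// mulr1 -qi.
  exact: qQ.
Qed.

End Star.

Hypothesis int : forall b, integral_in gsum b.

(* Quasi-compactness of D(g). *)
Lemma homogeneous_cover (E : nat -> set R) (g : R) (eg : nat) :
  (forall e h, E e h -> gp e h) -> gp eg g ->
  (forall P : ideal R, is_prime P -> homogeneous_set gp P -> ~ P g ->
    exists e h, E e h /\ ~ P h) ->
  exists m (l : seq (R * R * nat)), g ^+ m = \sum_(t <- l) t.1.1 * t.1.2 /\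
    forall t, t \in l -> [/\ E t.2 t.1.2, (t.2 <= m * eg)%N &
                            gp (m * eg - t.2) t.1.1].
Proof.
move=> Eh gg cov.
(* The ideal of [gsum] generated by the sets E, with the degrees of both factors recorded. *)
pose combi (x : R) := exists l : seq (R * R * nat * nat),
  x = \sum_(t <- l) t.1.1.1 * t.1.1.2 /\
  forall t, t \in l -> E t.1.2 t.1.1.2 /\ gp t.2 t.1.1.1.
have combi0 : combi 0 by exists [::]; rewrite big_nil.
have combiB x y : combi x -> combi y -> combi (x - y).
  move=> [l [-> hl]] [m [-> hm]].
  exists (l ++ [seq (- t.1.1.1, t.1.1.2, t.1.2, t.2) | t <- m]); split.
    rewrite big_cat big_map -sumrN /=; congr (_ + _).
    by apply: eq_bigr => t _; rewrite mulNr.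
  move=> t; rewrite mem_cat => /orP[/hl//|/mapP[s /hm[h1 h2] ->]] /=.
  by split=> //; exact: gpN.
have combiD x y : combi x -> combi y -> combi (x + y).
  move=> hx hy; rewrite -[y]opprK; apply: (combiB _ _ hx); rewrite -sub0r.
  exact: combiB.
have combi_sum n (F : 'I_n -> R) : (forall i, combi (F i)) -> combi (\sum_(i < n) F i).
  by move=> h; apply: big_ind.
have combiM x y : gsum x -> combi y -> combi (x * y).
  move=> [q gq ->] hy; rewrite horner_coef mulr_suml; apply: combi_sum => i.
  rewrite expr1n mulr1; case: hy => l [-> hl].
  exists [seq (q`_i * t.1.1.1, t.1.1.2, t.1.2, (i + t.2)%N) | t <- l]; split.
    by rewrite big_map mulr_sumr; apply: eq_bigr => t _; rewrite mulrA.
  by move=> _ /mapP[t /hl[h1 h2] ->] /=; split=> //; exact: gpM.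
have combi_gsum : combi `<=` gsum.
  move=> _ [l [-> hl]].
  have : forall t, t \in l -> gsum (t.1.1.1 * t.1.1.2).
    by move=> t /hl[/Eh h1 h2]; apply: gsumM; [exact: gsum_part h2|exact: gsum_part h1].
  elim: l {hl} => [|t l IHl] hl.
    by rewrite big_nil -(subrr 1); apply: gsumB; exact: gsum1.
  rewrite big_cons -[X in _ + X]opprK; apply: gsumB.
    by apply: hl; rewrite mem_head.
  rewrite -sub0r; apply: gsumB; first by rewrite -(subrr 1); apply: gsumB; exact: gsum1.
  by apply: IHl => s sl; apply: hl; rewrite in_cons sl orbT.
have Ecombi e h : E e h -> combi h.
  move=> Eeh; exists [:: (1, h, e, 0%N)]; split; first by rewrite big_seq1 mul1r.
  by move=> t; rewrite inE => /eqP ->.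
have [m gm] : exists m, combi (g ^+ m).
  (* Otherwise some prime Q contains the extension of [combi] but no power of g. The homogeneous
     prime attached to Q contains every element of the sets E and not g, against the covering
     hypothesis. *)
  apply: contrapT => nm.
  pose T : set R := [set x | exists m, x = g ^+ m].
  have gsumg m : gsum (g ^+ m).
    elim: m => [|m IHm]; first exact: gsum1.
    by rewrite exprS; apply: gsumM => //; exact: gsum_part gg.
  have [|_ _ [m ->] [n ->]|x|Q [Qp QJ QT]] := @prime_avoiding R (ideal_gen combi) T.
  - by exists 0%N.
  - by exists (m + n)%N; rewrite exprD.
  - move=> /ideal_gen_span[n [a [b [ha xE]]]] [m xm].
    have [k [c [hc]]] := integral_in_ideal_pz gsum1 gsumB gsumM combi_gsum
      combi0 combiB combiM ha (fun i => int (b i)).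
    rewrite -xE xm => /eqP; rewrite addr_eq0 => /eqP e; apply: nm.
    exists (m * k)%N; rewrite exprM e -sub0r; apply: combiB => //.
    apply: combi_sum => i; rewrite mulrC; apply: combiM => //.
    by rewrite -exprM; exact: gsumg.
  have [P [Pp Phom PI PT]] := homogeneous_prime_over (idealP Q) Qp int.
  have QN (x : R) d : gp d x -> ~ Q x -> some_comp_out Q x.
    move=> gx Qx; exists (x *: 'X^d); split; first exact: gpolyZXn.
      by rewrite !hornerE expr1n mulr1.
    by exists d; rewrite coefZ coefXn eqxx mulr1.
  have [|e [h [Eeh Ph]]] := cov P Pp Phom.
    move=> Pg; apply: (PT _ Pg); apply: (QN _ eg gg) => Qg.
    by apply: (QT _ Qg); exists 1%N.
  apply: Ph; apply: PI; exists (h *: 'X^e); split.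
  - by apply: gpolyZXn; exact: Eh.
  - by rewrite !hornerE expr1n mulr1.
  - move=> k; rewrite coefZ coefXn; case: eqP => _; rewrite ?mulr0 ?mulr1.
      by apply: QJ => J; apply; exact: Ecombi Eeh.
    exact: ideal0.
case: gm => l [gm hl]; exists m.
(* By independence, the terms of total degree m * eg already sum to g^m. *)
exists [seq (t.1.1.1, t.1.1.2, t.1.2) | t <- l & (t.2 + t.1.2 == m * eg)%N].
split; last first.
  move=> _ /mapP[t + ->] /=; rewrite mem_filter => /andP[/eqP <- /hl[h1 h2]].
  by rewrite leq_addl addnK.
rewrite big_map big_filter /=.
pose q := \sum_(t <- l) (t.1.1.1 * t.1.1.2) *: 'X^(t.2 + t.1.2) : {poly R}.
have gq : gpoly q.
  rewrite /q big_seq; apply: gpoly_sum => t /hl[/Eh h1 h2].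
  by apply: gpolyZXn; exact: gpM.
have ggm : gpoly (g ^+ m *: 'X^(m * eg)).
  apply: gpolyZXn; elim: m {gm hl q gq} => [|m IHm] //.
  by rewrite exprS mulSn; exact: gpM.
have : q - g ^+ m *: 'X^(m * eg) = 0.
  apply: gpoly_inj; first exact: gpolyB.
  rewrite hornerD hornerN horner_sum !hornerE expr1n mulr1 gm.
  apply/eqP; rewrite subr_eq0; apply/eqP; apply: eq_bigr => t _.
  by rewrite !hornerE expr1n mulr1.
move=> /(congr1 (fun p : {poly R} => p`_(m * eg))); rewrite coef0 coefB coefZ coefXn.
rewrite eqxx mulr1 => /eqP; rewrite subr_eq0 => /eqP <-.
rewrite coef_sum [RHS]big_mkcond /=; apply: eq_bigr => t _.
by rewrite coefZ coefXn eq_sym; case: eqP; rewrite ?mulr1 ?mulr0.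
Qed.

End GradedPolynomials.

(** * Sections as families of local fractions *)

Section LocalizationMapMorphism.
Variables (R R' : comPzRingType) (T : set R) (T' : set R').
Variable f : {rmorphism R -> R'}.
Hypothesis fT : forall t, T t -> T' (f t).

Lemma locmapD (u v : loc T) : locmap T' f (u + v) = locmap T' f u + locmap T' f v :> loc T'.
Proof.
elim/lfrac_ind: u => x s hs; elim/lfrac_ind: v => y t ht.
have st : mulgen T (s * t) := mulgenM hs ht.
rewrite lfracD// !(locmap_lfrac fT)//.
by rewrite lfracD ?rmorphD ?rmorphM//; exact: (mulgen_map fT).
Qed.

Lemma locmapM (u v : loc T) : locmap T' f (u * v) = locmap T' f u * locmap T' f v :> loc T'.
Proof.
elim/lfrac_ind: u => x s hs; elim/lfrac_ind: v => y t ht.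
have st : mulgen T (s * t) := mulgenM hs ht.
rewrite lfracM// !(locmap_lfrac fT)//.
by rewrite lfracM ?rmorphM//; exact: (mulgen_map fT).
Qed.

End LocalizationMapMorphism.

(** * Pure tensors and maps induced by balanced maps *)

Section TensorElements.
Variables (A B : comPzRingType) (f : A -> B) (M : lmodType A) (P : lmodType B).
Implicit Types (m : M) (c : P).
Local Notation "m '%t' c" := (tens_pure f m c) (at level 40).

Lemma tens_pureDl m m' c : (m + m') %t c = m %t c + m' %t c.
Proof.
apply: tens_eq => G b hb; rewrite tens_evD// !tens_ev_class// /tens_ev !big_seq1.
by case: hb => /= bD bD' bZ; rewrite ?bD ?bD' ?bZ.
Qed.
Lemma tens_pureZl a m c : (a *: m) %t c = m %t (f a *: c).
Proof.
apply: tens_eq => G b hb; rewrite !tens_ev_class// /tens_ev !big_seq1.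
by case: hb => /= bD bD' bZ; rewrite ?bD ?bD' ?bZ.
Qed.
Lemma tens_pureZr k m c : m %t (k *: c) = k *: (m %t c).
Proof.
apply: tens_eq => G b hb; rewrite tens_evZ// !tens_ev_class// /tens_ev ?big_seq1//.
exact: balancedZ.
Qed.

Lemma tens_ind (Q : tens f M P -> Prop) :
  Q 0 -> (forall x y, Q x -> Q y -> Q (x + y)) -> (forall m c, Q (m %t c)) ->
  forall x, Q x.
Proof.
move=> Q0 QD Qp x; rewrite -[x]reprK; elim: (repr x) => [|[m c] l IHl].
  exact: Q0.
suff -> : \pi_(tens f M P) ((m, c) :: l) = m %t c + \pi l by exact: QD.
apply: tens_eq => G b hb; rewrite tens_evD// !tens_ev_class//.
by rewrite /tens_ev big_cons big_seq1.
Qed.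

(* [repr] picks a formal sum; by [tens_classP] a balanced map does not depend
   on the choice. *)
Definition tens_lift (G : zmodType) (b : M -> P -> G) (x : tens f M P) : G :=
  tens_ev b (repr x).

Section Lift.
Variables (G : zmodType) (b : M -> P -> G).
Hypothesis hb : balanced f b.

Lemma tens_lift_pure m c : tens_lift b (m %t c) = b m c.
Proof. by rewrite /tens_lift tens_ev_class// /tens_ev big_seq1. Qed.
Lemma tens_liftD x y : tens_lift b (x + y) = tens_lift b x + tens_lift b y.
Proof. exact: tens_evD. Qed.
Lemma tens_lift0 : tens_lift b 0 = 0.
Proof. exact: tens_ev0. Qed.
Lemma tens_lift_sum (I : Type) (r : seq I) (F : I -> tens f M P) :
  tens_lift b (\sum_(i <- r) F i) = \sum_(i <- r) tens_lift b (F i).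
Proof.
elim: r => [|i r IHr]; first by rewrite !big_nil tens_lift0.
by rewrite !big_cons tens_liftD IHr.
Qed.
End Lift.

End TensorElements.

(** * Local fractions and evaluation of germs *)

Section LocalFractions.
Variable S : gradedRing.
Implicit Types (J : ideal S) (p : proj S).

Lemma zopenI (U W : set (proj S)) : zopen U -> zopen W -> zopen (U `&` W).
Proof.
move=> [E [hE ->]] [D [hD ->]].
exists [set x | exists y z, [/\ E y, D z & x = y * z]]; split.
  move=> _ [y [z [/hE[d hy] /hD[e hz] ->]]]; exists (d + e)%N; exact: gpartM.
apply/seteqP; split=> [p [[y [Ey py]] [z [Dz pz]]]|p [_ [[y [z [Ey Dz ->]]] pyz]]].
  exists (y * z); split; first by exists y, z.
  by case/proj_primeM.
split.
  by exists y; split=> // py; apply: pyz; rewrite mulrC; exact: idealM.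
by exists z; split=> // pz; apply: pyz; exact: idealM.
Qed.

Lemma zopen_basic (x : S) d : gpart d x -> zopen [set p | ~ pideal p x].
Proof.
move=> gx; exists [set x]; split; first by move=> _ ->; exists d.
by apply/seteqP; split=> [p px|p [_ [-> px]]] //; exists x.
Qed.

(** The section condition of [sheaf_of], with germs read in the full localization at p, so that one
    notion serves all the sheaves once they are evaluated. *)
Definition local_fraction J n (U : set (proj S)) (s : forall p, loc (hden p)) : Prop :=
  forall p, U p -> exists W e x t,
      [/\ zopen W, W p & W `<=` U] /\ [/\ J x, gpart (n + e) x, gpart e t &
        forall q, W q -> ~ pideal q t /\ s q = lfrac (hden q) x t].

Lemma local_fraction_local J n (U : set (proj S)) (s : forall p, loc (hden p)) :
  (forall p, U p -> exists W, [/\ zopen W, W p, W `<=` U & local_fraction J n W s]) ->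
  local_fraction J n U s.
Proof.
move=> h p Up; have [W [oW Wp WU hW]] := h p Up.
have [W' [e [x [t [[oW' Wp' WW'] h']]]]] := hW p Wp.
by exists W', e, x, t; split=> //; split=> //; exact: subset_trans WU.
Qed.

Lemma local_fraction_eq J n (U : set (proj S)) (s s' : forall p, loc (hden p)) :
  (forall p, U p -> s p = s' p) -> local_fraction J n U s -> local_fraction J n U s'.
Proof.
move=> ss' h p Up; have [W [e [x [t [[oW Wp WU] [Jx gx gt hW]]]]]] := h p Up.
exists W, e, x, t; split=> //; split=> // q Wq.
by have [qt sq] := hW q Wq; rewrite -ss'//; exact: WU.
Qed.

Lemma local_fraction0 J n (U : set (proj S)) : zopen U ->
  local_fraction J n U (fun p => 0).
Proof.
move=> oU p Up; exists U, 0%N, 0, 1; split; first by split. split.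
- exact: ideal0.
- exact: gpart0.
- exact: gpart1.
- by move=> q _; split; [exact: proj_prime1|].
Qed.

Lemma local_fractionD J n (U : set (proj S)) (s s' : forall p, loc (hden p)) :
  local_fraction J n U s -> local_fraction J n U s' ->
  local_fraction J n U (fun p => s p + s' p).
Proof.
move=> h h' p Up; have [W [e [x [t [[oW Wp WU] [Jx gx gt hW]]]]]] := h p Up.
have [W' [e' [x' [t' [[oW' Wp' WU'] [Jx' gx' gt' hW']]]]]] := h' p Up.
exists (W `&` W'), (e + e')%N, (x * t' + x' * t), (t * t'); split.
  by split=> //; [exact: zopenI|move=> q []/WU].
split.
- by apply: idealD; rewrite mulrC; exact: idealM.
- apply: gpartD; first by rewrite addnA; exact: gpartM.
  by rewrite (addnC e) addnA; exact: gpartM.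
- exact: gpartM.
- move=> q [/hW[qt ->] /hW'[qt' ->]]; split; first by case/proj_primeM.
  by rewrite lfracD//; apply: hden_mulgen; eassumption.
Qed.

Lemma local_fractionM J n m (U : set (proj S)) (s s' : forall p, loc (hden p)) :
  local_fraction J n U s -> local_fraction ideal_full m U s' ->
  local_fraction J (n + m) U (fun p => s p * s' p).
Proof.
move=> h h' p Up; have [W [e [x [t [[oW Wp WU] [Jx gx gt hW]]]]]] := h p Up.
have [W' [e' [x' [t' [[oW' Wp' WU'] [Jx' gx' gt' hW']]]]]] := h' p Up.
exists (W `&` W'), (e + e')%N, (x * x'), (t * t'); split.
  by split=> //; [exact: zopenI|move=> q []/WU].
split.
- by rewrite mulrC; exact: idealM.
- by rewrite addnACA; exact: gpartM.
- exact: gpartM.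
- move=> q [/hW[qt ->] /hW'[qt' ->]]; split; first by case/proj_primeM.
  by rewrite lfracM//; apply: hden_mulgen; eassumption.
Qed.

Lemma local_fraction_sum J n (U : set (proj S)) (I : Type) (l : seq I)
    (s : I -> forall p, loc (hden p)) : zopen U ->
  List.Forall (fun i => local_fraction J n U (s i)) l ->
  local_fraction J n U (fun p => \sum_(i <- l) s i p).
Proof.
move=> oU; elim: l => [|i l IHl] hl.
  by apply: local_fraction_eq (local_fraction0 J n oU) => p _; rewrite big_nil.
have [hi /IHl hl'] := proj1 (List.Forall_cons_iff _ _ _) hl.
by apply: local_fraction_eq (local_fractionD hi hl') => p _; rewrite big_cons.
Qed.

(** Equality in the iterated tensor products is hard to test directly; an evaluation moves it to the
    localization at p, compatibly with the module structure. *)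
Definition evaluation (F : modSheaf S) (phi : forall p, mstalk F p -> loc (hden p)) :=
  (forall p u v, phi p (u + v) = phi p u + phi p v) /\
  forall p (a : ostalk p) u, phi p (a *: u) = val a * phi p u.

Definition evaluates_to (F : modSheaf S) (phi : forall p, mstalk F p -> loc (hden p))
    J n : Prop :=
  forall U s, msection U s -> local_fraction J n U (fun p => phi p (s p)).

Lemma sheaf_of_evaluates J n :
  evaluates_to (F := sheaf_of J n) (fun p u => val u) J n.
Proof. by move=> U s h. Qed.

Lemma sheaf_of_evaluation J n : evaluation (F := sheaf_of J n) (fun p u => val u).
Proof. by split. Qed.

Section TensorEvaluation.
Variables (F G : modSheaf S).
Variables (phi : forall p, mstalk F p -> loc (hden p)).
Variables (psi : forall p, mstalk G p -> loc (hden p)).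
Hypotheses (phiE : evaluation phi) (psiE : evaluation psi).

Definition tensor_eval p (x : mstalk (tensor_sheaf F G) p) : loc (hden p) :=
  tens_lift (fun a b => phi a * psi b) x.

Lemma tensor_balanced p :
  @balanced _ _ idfun (mstalk F p) (mstalk G p) _ (fun a b => phi a * psi b).
Proof.
have [phiD phiZ] := phiE; have [psiD psiZ] := psiE.
split=> [m m' c|m c c'|a m c].
- by rewrite phiD mulrDl.
- by rewrite psiD mulrDr.
- by rewrite phiZ psiZ mulrCA mulrA.
Qed.

Lemma tensor_eval_pure p (a : mstalk F p) (b : mstalk G p) :
  tensor_eval (tens_pure idfun a b) = phi a * psi b.
Proof. exact: tens_lift_pure (tensor_balanced p) _ _. Qed.

Lemma tensor_evaluation : evaluation tensor_eval.
Proof.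
split=> [p u v|p a u]; first exact: tens_liftD (tensor_balanced p) _ _.
elim/tens_ind: u => [|x y hx hy|m c].
- by rewrite scaler0 /tensor_eval (tens_lift0 (tensor_balanced p)) mulr0.
- rewrite scalerDr.
  rewrite /tensor_eval (tens_liftD (tensor_balanced p)).
  by rewrite (tens_liftD (tensor_balanced p)) mulrDr; congr (_ + _).
- rewrite -tens_pureZr !tensor_eval_pure; case: psiE => _ psiZ.
  by rewrite psiZ mulrCA.
Qed.

Lemma tensor_evaluates J n m :
  evaluates_to phi J n -> evaluates_to psi ideal_full m ->
  evaluates_to tensor_eval J (n + m).
Proof.
move=> hphi hpsi U s sU; apply: local_fraction_local => p Up.
have [W [l [[oW Wp WU] [hl hW]]]] := sU p Up.
exists W; split=> //.
apply: (@local_fraction_eq _ _ _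
  (fun q => \sum_(ab <- l) (phi (ab.1 q) * psi (ab.2 q)))).
  move=> q Wq; rewrite hW// /tensor_eval (tens_lift_sum (tensor_balanced q)).
  by apply: eq_bigr => ab _; rewrite (tens_lift_pure (tensor_balanced q)).
apply: local_fraction_sum => //; apply: List.Forall_impl hl => ab [ha hb].
by apply: local_fractionM; [exact: hphi|exact: hpsi].
Qed.

End TensorEvaluation.
End LocalFractions.

(** * Evaluation of the twisted sheaves *)

Section TwistEvaluation.
Variables (S S' : gradedRing) (f : gradedMorphism S S') (rho : projMorphism f).
Implicit Types (J : ideal S') (p : proj S').

Lemma val_hfrac_elt (T : gradedRing) (J : ideal T) n (p : proj T) e x t :
  J x -> gpart (n + e) x -> gpart e t -> ~ pideal p t ->
  val (hfrac_elt J n p x t) = lfrac (hden p) x t.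
Proof.
move=> Jx gx gt pt; rewrite /hfrac_elt insubdK//; apply/asboolP.
by exists e, x, t.
Qed.

Definition pullback_eval p (x : mstalk (pullback_O1 rho) p) : loc (hden p) :=
  tens_lift (fun (a : hfrac ideal_full 1 (rho p)) (b : hfrac ideal_full 0 p) =>
    locmap (hden p) f (val a) * val b) x.

Lemma pullback_balanced p :
  @balanced _ _ (@ostalk_map _ _ _ rho p) (hfrac ideal_full 1 (rho p))
    (hfrac ideal_full 0 p) _
    (fun a b => locmap (hden p) f (val a) * val b).
Proof.
have fT := @hden_pmap _ _ _ rho p.
split=> [m m' c|m c c'|a m c] /=.
- by rewrite (locmapD fT) mulrDl.
- by rewrite mulrDr.
- by rewrite (locmapM fT) mulrCA mulrA.
Qed.

Lemma pullback_eval_pure p a b :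
  @pullback_eval p (tens_pure (@ostalk_map _ _ _ rho p) a b) =
  locmap (hden p) f (val a) * val b.
Proof. exact: tens_lift_pure (pullback_balanced p) _ _. Qed.

Lemma pullback_evaluation : evaluation (F := pullback_O1 rho) pullback_eval.
Proof.
split=> [p u v|p a u]; first exact: tens_liftD (pullback_balanced p) _ _.
elim/tens_ind: u => [|x y hx hy|m c].
- by rewrite scaler0 /pullback_eval (tens_lift0 (pullback_balanced p)) mulr0.
- rewrite scalerDr.
  rewrite /pullback_eval (tens_liftD (pullback_balanced p)).
  by rewrite (tens_liftD (pullback_balanced p)) mulrDr; congr (_ + _).
- by rewrite -tens_pureZr !pullback_eval_pure /= mulrCA.
Qed.

Lemma zopen_pmap (V : set (proj S)) : zopen V -> zopen [set p | V (rho p)].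
Proof.
move=> [E [hE ->]]; exists [set f x | x in E]; split.
  by move=> _ [x /hE[d gx] <-]; exists d; exact: gmorP.
apply/seteqP; split=> [p [x [Ex px]]|p [_ [[x Ex <-] px]]].
  by exists (f x); split; [exists x|move=> /pmapP].
by exists x; split=> // /pmapP.
Qed.

Lemma pullback_evaluates : evaluates_to (F := pullback_O1 rho) pullback_eval ideal_full 1.
Proof.
move=> U s sU; apply: local_fraction_local => p Up.
have [W [V [l [[oW Wp WU oV WV] [hl hW]]]]] := sU p Up.
exists W; split=> //.
apply: (@local_fraction_eq _ _ _ _
  (fun q => \sum_(ab <- l) (locmap (hden q) f (val (ab.1 (rho q))) * val (ab.2 q)))).
  move=> q Wq; rewrite hW// /pullback_eval (tens_lift_sum (pullback_balanced q)).
  by apply: eq_bigr => ab _; rewrite (tens_lift_pure (pullback_balanced q)).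
apply: local_fraction_sum => //; apply: List.Forall_impl hl => ab [ha hb].
apply: (@local_fractionM _ _ 1 0); last exact: hb.
move=> q Wq; have [V' [e [x [t [[oV' Vq' VV'] [_ gx gt hV']]]]]] := ha (rho q) (WV q Wq).
exists (W `&` [set q | V' (rho q)]), e, (f x), (f t); split.
  by split; [apply: zopenI => //; exact: zopen_pmap|split|exact: subIsetl].
split=> //; [exact: (gmorP f gx)|exact: (gmorP f gt)|move=> z [_ /= /hV'[zt ->]]].
have ht : mulgen (hden (rho z)) t by exact: hden_mulgen gt zt.
split; first by move=> /pmapP.
by rewrite (locmap_lfrac (@hden_pmap _ _ _ rho z)).
Qed.

Fixpoint power_eval d : forall p, mstalk (tensor_power (pullback_O1 rho) d) p -> loc (hden p) :=
  match d return forall p, mstalk (tensor_power (pullback_O1 rho) d) p -> loc (hden p) with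
  | 0 => fun p (u : hfrac ideal_full 0 p) => val u
  | d'.+1 => tensor_eval (F := pullback_O1 rho) (G := tensor_power (pullback_O1 rho) d')
      pullback_eval (@power_eval d')
  end.

Lemma power_evaluation d : evaluation (@power_eval d).
Proof.
elim: d => [|d IHd]; first exact: sheaf_of_evaluation.
exact: tensor_evaluation pullback_evaluation IHd.
Qed.

Lemma power_evaluates d : evaluates_to (@power_eval d) ideal_full d.
Proof.
elim: d => [|d IHd]; first exact: sheaf_of_evaluates.
have := tensor_evaluates pullback_evaluation (power_evaluation d)
  pullback_evaluates IHd; exact.
Qed.

Definition twist_eval J d p (u : mstalk (twist rho (sheaf_of J 0) d) p) :
    loc (hden p) :=
  tensor_eval (F := sheaf_of J 0) (G := tensor_power (pullback_O1 rho) d)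
    (fun p u => val u) (@power_eval d) u.

Lemma twist_evaluation J d : evaluation (@twist_eval J d).
Proof. exact: tensor_evaluation (sheaf_of_evaluation J 0) (power_evaluation d). Qed.

Lemma twist_evaluates J d : evaluates_to (@twist_eval J d) J d.
Proof.
have := tensor_evaluates (sheaf_of_evaluation J 0) (power_evaluation d)
  (@sheaf_of_evaluates _ J 0) (@power_evaluates d); exact.
Qed.

(** * Trivialization of the twists where an element of degree 1 does not vanish *)

Section Trivialization.
Variables (p : proj S') (y : S).
Hypotheses (gy : gpart 1 y) (py : ~ pideal p (f y)).

Let rpy : ~ pideal (rho p) y. Proof. by move=> /pmapP. Qed.
Let gy0 : gpart (1 + 0) y. Proof. exact: gy. Qed.

(** Since y does not vanish at the point, x/t = (x/(ty)) (y/1). *)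
Lemma hfrac_O1_gen (a : hfrac ideal_full 1 (rho p)) :
  exists c : ostalk (rho p), a = c *: hfrac_elt ideal_full 1 (rho p) y 1.
Proof.
case: a => u hu; have /asboolP[e [x [t [_ gx gt pt ux]]]] := hu.
have gty : gpart (e + 1) (t * y) by exact: gpartM.
have ty : ~ pideal (rho p) (t * y) by case/proj_primeM.
have hc : ostalk_pred (rho p) (lfrac (hden (rho p)) x (t * y)).
  apply/asboolP; exists (e + 1)%N, x, (t * y); split=> //.
  by rewrite add0n addnC.
exists (exist (fun w => ostalk_pred (rho p) w) _ hc).
apply: val_inj => /=; rewrite (val_hfrac_elt _ gy0 (gpart1 S))//; last exact: proj_prime1.
have h1 := hden_mulgen gty ty; have h2 := hden_mulgen gt pt.
by rewrite ux lfracM//; [rewrite mulr1; apply: lfrac_eq => //; ring|exact: mulgen1].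
Qed.

Lemma pullback_O1_gen (u : mstalk (pullback_O1 rho) p) :
  exists c : ostalk p, u = c *: germ_O1 rho y p.
Proof.
elim/tens_ind: u => [|u v [c ->] [c' ->]|a b].
- by exists 0; rewrite scale0r.
- by exists (c + c'); rewrite scalerDl.
have [k ->] := hfrac_O1_gen a.
exists (ostalk_map k * b); rewrite -tens_pureZr tens_pureZl; congr (tens_pure _ _ _).
apply: val_inj => /=; rewrite (@val_hfrac_elt _ _ _ _ 0)//; last exact: proj_prime1.
- by rewrite -mulrA [X in _ = _ * (_ * X)](_ : _ = 1)// mulr1.
- exact: gpart1.
- exact: gpart1.
Qed.

Lemma power_gen d (u : mstalk (tensor_power (pullback_O1 rho) d) p) :
  exists c : ostalk p, u = c *: stalk_power (germ_O1 rho y p) d.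
Proof.
elim: d u => [|d IHd] u.
  exists u; apply: val_inj => /=.
  rewrite (@val_hfrac_elt _ _ _ _ 0)//; last exact: proj_prime1.
  - by rewrite [X in _ = _ * X](_ : _ = 1)// mulr1.
  - exact: gpart1.
  - exact: gpart1.
elim/tens_ind: u => [|u v [c ->] [c' ->]|a b].
- by exists 0; rewrite scale0r.
- by exists (c + c'); rewrite scalerDl.
have [k ->] := pullback_O1_gen a; have [k' ->] := IHd b.
exists (k * k'); rewrite /= tens_pureZl /= scalerA.
by rewrite tens_pureZr.
Qed.

Lemma twist_gen J d (u : mstalk (twist rho (sheaf_of J 0) d) p) :
  exists a : hfrac J 0 p, u = tens_pure idfun a (stalk_power (germ_O1 rho y p) d).
Proof.
elim/tens_ind: u => [|u v [a ->] [b ->]|a b].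
- exists 0; rewrite -[0 in RHS](scale0r (0 : hfrac J 0 p)) tens_pureZl.
  by rewrite /= scale0r -(scale0r 0) tens_pureZr scale0r.
- by exists (a + b); rewrite tens_pureDl.
have [k ->] := power_gen b.
by exists (k *: a); rewrite tens_pureZl.
Qed.

Lemma power_eval_germ d :
  power_eval (stalk_power (germ_O1 rho y p) d) = lfrac (hden p) (f y ^+ d) 1.
Proof.
have e0 : val (hfrac_elt (ideal_full : ideal S') 0 p 1 1) = 1 :> loc (hden p).
  rewrite (@val_hfrac_elt _ _ _ _ 0)//; last exact: proj_prime1.
    exact: gpart1.
  exact: gpart1.
elim: d => [|d IHd].
  by rewrite /= e0 expr0.
rewrite /= (tensor_eval_pure pullback_evaluation (power_evaluation d)) IHd.
rewrite pullback_eval_pure e0 mulr1.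
rewrite (val_hfrac_elt _ gy0 (gpart1 S))//; last exact: proj_prime1.
rewrite (locmap_lfrac (@hden_pmap _ _ _ rho p)); last exact: mulgen1.
by rewrite rmorph1 lfracM ?mulr1 ?exprS//; exact: mulgen1.
Qed.

Lemma twist_eval_germ J d (a : hfrac J 0 p) :
  twist_eval (tens_pure idfun a (stalk_power (germ_O1 rho y p) d)) =
  val a * lfrac (hden p) (f y ^+ d) 1.
Proof.
rewrite /twist_eval.
rewrite (tensor_eval_pure (sheaf_of_evaluation J 0) (power_evaluation d)).
by rewrite power_eval_germ.
Qed.

Lemma gpart_exp (T : gradedRing) (x : T) e d : gpart e x -> gpart (d * e) (x ^+ d).
Proof.
move=> gx; elim: d => [|d IHd]; first by rewrite expr0; exact: gpart1.
by rewrite exprS mulSn; exact: gpartM.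
Qed.

Lemma proj_exp (T : gradedRing) (q : proj T) (x : T) d :
  ~ pideal q x -> ~ pideal q (x ^+ d).
Proof.
move=> qx; elim: d => [|d IHd]; first by rewrite expr0; exact: proj_prime1.
by rewrite exprS => /proj_primeM[].
Qed.

(** Every germ is a pure tensor whose second factor is the fixed generator, and this generator
    evaluates to the unit (f y)^d, which cancels. *)
Lemma twist_eval_inj_at J d (u v : mstalk (twist rho (sheaf_of J 0) d) p) :
  twist_eval u = twist_eval v -> u = v.
Proof.
have [a ->] := twist_gen u; have [b ->] := twist_gen v.
rewrite !twist_eval_germ => e; congr (tens_pure _ _ _); apply: val_inj.
have gfy : gpart (d * 1) (f y ^+ d) by apply: gpart_exp; exact: (gmorP f gy).
have mfy : mulgen (hden p) (f y ^+ d).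
  by apply: hden_mulgen gfy _; exact: proj_exp.
have inv : lfrac (hden p) (f y ^+ d) 1 * lfrac (hden p) 1 (f y ^+ d) = 1.
  rewrite lfracM//; last exact: mulgen1.
  by apply: lfrac_eq; rewrite ?mul1r ?mulr1//; exact: mulgen1.
by rewrite -[LHS]mulr1 -[RHS]mulr1 -inv !mulrA e.
Qed.

(** The powers of [f y] cancel, so the value does not depend on y. With injectivity, the
    prescriptions of [is_associated_section] for different y agree. *)
Lemma twist_eval_associated J d x : J x -> gpart d x ->
  twist_eval (tens_pure idfun (hfrac_elt J 0 p x (f y ^+ d))
                          (stalk_power (germ_O1 rho y p) d)) = lfrac (hden p) x 1.
Proof.
move=> Jx gx; rewrite twist_eval_germ.
have gfy : gpart d (f y ^+ d).
  by rewrite -[X in gpart X]muln1; apply: gpart_exp; exact: (gmorP f gy).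
have pfy : ~ pideal p (f y ^+ d) by exact: proj_exp.
have mfy := hden_mulgen gfy pfy.
rewrite (@val_hfrac_elt _ _ _ _ d)// lfracM//; last exact: mulgen1.
by apply: lfrac_eq; rewrite ?mulr1//; exact: mulgen1.
Qed.

End Trivialization.

Lemma germ_O1_section y : gpart 1 y ->
  msection [set p | ~ pideal p (f y)] (germ_O1 rho y).
Proof.
(* The second open set is all of Proj S, written as the locus where 1 does not vanish. *)
move=> gy p py; exists [set p | ~ pideal p (f y)], [set p | ~ pideal p 1].
exists [:: (fun q => hfrac_elt ideal_full 1 q y 1, fun q => hfrac_elt ideal_full 0 q 1 1)].
split.
  split=> //; [exact: zopen_basic (gmorP f gy)|exact: zopen_basic (gpart1 S)|].
  by move=> q _; exact: proj_prime1.
split; last by move=> q _; rewrite big_seq1.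
constructor=> //; split.
  move=> q /= q1; exists [set p | ~ pideal p 1], 0%N, y, 1; split.
    by split=> //; exact: zopen_basic (gpart1 S).
  split=> //; first exact: gpart1.
  move=> z z1; split=> //; rewrite (@val_hfrac_elt _ _ _ _ 0)//; exact: gpart1.
move=> q /= qy; exists [set p | ~ pideal p (f y)], 0%N, 1, 1; split.
  by split=> //; exact: zopen_basic (gmorP f gy).
split=> //; [exact: gpart1|exact: gpart1|move=> z zy; split; first exact: proj_prime1].
rewrite (@val_hfrac_elt _ _ _ _ 0)//; [exact: gpart1|exact: gpart1|exact: proj_prime1].
Qed.

Lemma stalk_power_section y d : gpart 1 y ->
  msection [set p | ~ pideal p (f y)] (fun p => stalk_power (germ_O1 rho y p) d).
Proof.
move=> gy; have oW : zopen [set p | ~ pideal p (f y)] := zopen_basic (gmorP f gy).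
elim: d => [|d IHd] p py.
  exists [set p | ~ pideal p (f y)], 0%N, 1, 1; split; first by split.
  split=> //; [exact: gpart1|exact: gpart1|move=> z zy; split; first exact: proj_prime1].
  rewrite (@val_hfrac_elt _ _ _ _ 0)//; [exact: gpart1|exact: gpart1|exact: proj_prime1].
exists [set p | ~ pideal p (f y)].
exists [:: (germ_O1 rho y, fun q => stalk_power (germ_O1 rho y q) d)].
split; first by split.
split; last by move=> q _; rewrite big_seq1.
by constructor=> //; split=> //; exact: germ_O1_section.
Qed.
End TwistEvaluation.

(** * Sections of the twists over Proj *)

(** It equalizes finitely many exponents, degrees of equations or lengths of sums. *)
Lemma uniform_bound (T : eqType) (s : seq T) (P : nat -> T -> Prop) :
  (forall i n, P n i -> P n.+1 i) -> (forall i, i \in s -> exists n, P n i) ->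
  exists n, forall i, i \in s -> P n i.
Proof.
move=> mono; have monoD i n k : P n i -> P (k + n)%N i.
  by elim: k => // k IHk /IHk; exact: mono.
elim: s => [|a s IHs] h; first by exists 0%N.
have [n hn] := h a (mem_head _ _).
have [|m hm] := IHs; first by move=> i si; apply: h; rewrite in_cons si orbT.
exists (n + m)%N => i; rewrite in_cons => /predU1P[->|/hm]; last exact: monoD.
by rewrite addnC; exact: monoD.
Qed.

Lemma sum_count_mem (T : finType) (s : seq T) :
  (\sum_(i : T) count_mem i s)%N = size s.
Proof.
elim: s => [|x s IHs] /=; first by rewrite big1.
rewrite big_split /= IHs -[RHS]add1n; congr (_ + _)%N.
by rewrite (bigD1 x)//= eqxx big1 ?addn0// => i; rewrite eq_sym => /negbTE ->.
Qed.

(** Pigeonhole; it finds a high power of one generator in a long word. *)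
Lemma frequent_letter (T : finType) (s : seq T) M :
  (#|T| * M < size s)%N -> exists i, (M <= count_mem i s)%N.
Proof.
move=> sM; apply: contrapT => /forallNP h; move: sM; rewrite ltnNge => /negP; apply.
rewrite -sum_count_mem -sum_nat_const; apply: leq_sum => i _.
by rewrite ltnW// ltnNge; apply/negP/h.
Qed.

Section HomogeneousSets.
Variable S : gradedRing.

Lemma gpart_sum d (I : Type) (r : seq I) (P : pred I) (F : I -> S) :
  (forall i, P i -> gpart d (F i)) -> gpart d (\sum_(i <- r | P i) F i).
Proof. by move=> h; apply: big_ind => //; [exact: gpart0|exact: gpartD]. Qed.

(** Terms of arbitrary degrees are regrouped by degree, below a bound M exceeding all of them, so
    that [homogeneous_set] applies. With P reduced to 0 this extracts one degree from an
    equation. *)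
Lemma homogeneous_part (P : set S) (T : finType) (D : nat) (z : S)
    (x : T -> S) (dg : T -> nat) :
  homogeneous_set (@gpart S) P -> gpart D z -> (forall i, gpart (dg i) (x i)) ->
  P (z + \sum_i x i) -> P (z + \sum_(i | dg i == D) x i).
Proof.
move=> Ph gz gx; pose M := (D + \sum_i dg i).+1.
pose X (k : 'I_M) := (if val k == D then z else 0) + \sum_(i | dg i == k) x i.
have DM : (D < M)%N by rewrite ltnS leq_addr.
have gX (k : 'I_M) : gpart k (X k).
  apply: gpartD; first by case: eqP => [->//|_]; exact: gpart0.
  by apply: gpart_sum => i /eqP <-.
have XE : \sum_k X k = z + \sum_i x i.
  rewrite big_split /=; congr (_ + _).
    rewrite (bigD1 (Ordinal DM))//= eqxx big1 ?addr0// => k kD.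
    by rewrite -val_eqE /= in kD; rewrite (negbTE kD).
  have dM i : (dg i < M)%N.
    by rewrite ltnS (bigD1 i)//= addnCA leq_addr.
  rewrite [RHS](partition_big (fun i => Ordinal (dM i)) predT)//=.
by rewrite -XE => /(Ph _ _ gX)/(_ (Ordinal DM)); rewrite /X /= eqxx.
Qed.

End HomogeneousSets.

(** * Abstract setting: S, S', L stand for R_A, its normalization and RS, and y for the generators
    1/v *)

Section Setup.
Variables (S S' L : gradedRing) (f : gradedMorphism S S') (j : gradedMorphism S' L).
Variables (I : finType) (y : I -> S).
Hypotheses (j_inj : injective j) (j_part : forall d x, gpart d (j x) -> gpart d x).
Hypothesis int_closed : forall u : L, integral (j \o f) u -> exists x, j x = u.
Hypothesis int_over : forall x : S', integral f x.
Hypothesis L_ind : graded_independent (@gpart L).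
Hypothesis y_part : forall i, gpart 1 (y i).
Hypothesis S_span : forall d x, gpart d x -> exists l : seq (S * seq I),
  (forall t, t \in l -> gpart 0 t.1 /\ size t.2 = d) /\
  x = \sum_(t <- l) t.1 * \prod_(i <- t.2) y i.
Hypothesis S_sum : forall x : S, exists n (c : nat -> S),
  [/\ forall k, gpart k (c k), forall k, (n <= k)%N -> c k = 0 &
      x = \sum_(k < n) c k].
Hypothesis y_unit : forall i, exists z, z * j (f (y i)) = 1.

Let fy i := f (y i).

Lemma S'_ind : graded_independent (@gpart S').
Proof.
move=> n x gx xs i; apply: j_inj; rewrite rmorph0.
apply: (L_ind (x := fun i => j (x i))); first by move=> k; exact: gmorP.
by rewrite -rmorph_sum xs rmorph0.
Qed.

Lemma word_part (s : seq I) : gpart (size s) (\prod_(i <- s) y i).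
Proof.
elim: s => [|i s IHs]; first by rewrite big_nil; exact: gpart1.
by rewrite big_cons; exact: (gpartM (y_part i) IHs).
Qed.

(** Each word of length D + e is cut after its first D letters; the tails go into the
    coefficients. *)
Lemma span_words D e x : gpart (D + e) x -> exists c : D.-tuple I -> S,
  (forall t, gpart e (c t)) /\ x = \sum_t c t * \prod_(i <- t) y i.
Proof.
move=> /S_span[l [hl ->]].
exists (fun t : D.-tuple I => \sum_(s <- l | take D s.2 == val t) s.1 * \prod_(i <- drop D s.2) y i).
split.
  move=> t; rewrite big_seq_cond; apply: gpart_sum => s /andP[/hl[s1 s2] _].
  have -> : e = (0 + size (drop D s.2))%N by rewrite size_drop s2 addKn.
  by apply: gpartM => //; exact: word_part.
under [RHS]eq_bigr do rewrite big_distrl /=.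
rewrite (exchange_big_dep predT)//= big_seq [RHS]big_seq.
apply: eq_bigr => s /hl[_ s2].
have sD : size (take D s.2) == D by rewrite size_takel ?s2 ?leq_addr.
rewrite (big_pred1 (Tuple sD)) => [|t /=]; last by rewrite -[RHS]val_eqE eq_sym.
rewrite /= -mulrA -[in LHS](cat_take_drop D s.2) big_cat /=.
by rewrite (mulrC (\prod_(i <- drop _ _) _)).
Qed.

(** The equation is the part of degree e * n of an arbitrary integral equation, whose coefficients
    in S split into components. *)
Lemma homogeneous_integral e (x : S') : gpart e x ->
  exists n (c : 'I_n -> S), (forall i : 'I_n, gpart (e * (n - i)) (c i)) /\
    x ^+ n + \sum_(i < n) f (c i) * x ^+ i = 0.
Proof.
move=> gx; have [n [c ce]] := int_over x.
pose P m (i : 'I_n) := exists c' : nat -> S,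
  [/\ forall k, gpart k (c' k), forall k, (m <= k)%N -> c' k = 0 &
      c i = \sum_(k < m) c' k].
have [i m|i _|m hm] := @uniform_bound _ (enum 'I_n) P.
- move=> [c' [h1 h2 h3]]; exists c'; split=> // [k mk|].
    by apply: h2; rewrite ltnW.
  by rewrite big_ord_recr /= h2// addr0.
- by have [m [c' h]] := S_sum (c i); exists m, c'.
have {}hm i : exists c' : nat -> S, (forall k, gpart k (c' k)) /\ c i = \sum_(k < m) c' k.
  by have [|c' [h1 _ h2]] := hm i; [rewrite mem_enum|exists c'].
have [c' hc'] := choice hm.
have gxn k : gpart (e * k) (x ^+ k) by rewrite mulnC; exact: gpart_exp.
pose d (t : 'I_n * 'I_m) := (t.2 + e * t.1)%N.
have := @homogeneous_part S' [set 0] ('I_n * 'I_m)%type (e * n) (x ^+ n)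
  (fun t => f (c' t.1 t.2) * x ^+ t.1) d.
move=> h; have {h}: x ^+ n + \sum_(i | d i == (e * n)%N) f (c' i.1 i.2) * x ^+ i.1 = 0.
  apply: h => //.
  - by move=> k z gz; exact: S'_ind.
  - by move=> [i k]; apply: gpartM => //; apply: gmorP; case: (hc' i).
  - rewrite /= -[RHS]ce; congr (_ + _); rewrite -(pair_big xpredT xpredT
      (fun i k => f (c' i (val k)) * x ^+ i))/=.
    apply: eq_bigr => i _; rewrite -mulr_suml -rmorph_sum.
    by case: (hc' i) => _ <-.
(* All components of the coefficients in degree m or above are zero, which explains the default
   value 0. *)
move=> e0; exists n, (fun i : 'I_n => if (e * (n - i) < m)%N then c' i (e * (n - i))%N else 0).
split=> [i|].
  by case: ifP => _; [case: (hc' i)|exact: gpart0].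
rewrite -[RHS]e0; congr (_ + _).
rewrite [RHS]big_mkcond [RHS](eq_bigr (fun t : 'I_n * 'I_m =>
  if d (t.1, t.2) == (e * n)%N then f (c' t.1 t.2) * x ^+ t.1 else 0)); last by case.
rewrite -(pair_big xpredT xpredT (fun (i : 'I_n) (k : 'I_m) =>
  if d (i, k) == (e * n)%N then f (c' i k) * x ^+ i else 0))/=.
apply: eq_bigr => i _; rewrite -[RHS]big_mkcond /d /=.
have ke (k : 'I_m) : (k + e * i == e * n)%N = (val k == e * (n - i))%N.
  have -> : (e * n = e * (n - i) + e * i)%N by rewrite -mulnDr subnK// ltnW.
  by rewrite eqn_add2r.
under eq_bigl do rewrite ke.
case: ifPn => km.
  by rewrite (big_pred1 (Ordinal km))// => k; rewrite -val_eqE.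
rewrite rmorph0 mul0r big1// => k /eqP kE.
by rewrite -kE ltn_ord in km.
Qed.

Lemma positive_part_in (P : ideal S') d (x : S) : (forall i, P (fy i)) ->
  (0 < d)%N -> gpart d x -> P (f x).
Proof.
move=> hP d0 /S_span[l [hl ->]]; rewrite rmorph_sum big_seq.
apply: big_ind => [||t /hl[_ ts]]; [exact: ideal0|exact: idealD|].
rewrite rmorphM; apply: idealM; case: (t.2) ts => [|i s _]; first by move: d0 => /[swap] <-.
by rewrite big_cons rmorphM mulrC; apply: idealM; exact: hP.
Qed.

(** If P contained every generator, it would contain the lower coefficients of a homogeneous
    equation of x, which have positive degree, hence a power of x. *)
Lemma some_generator_out (P : ideal S') d (x : S') : is_prime P ->
  (0 < d)%N -> gpart d x -> ~ P x -> exists i, ~ P (fy i).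
Proof.
move=> Pp d0 gx Px; apply: contrapT => /forallNP h.
have hP i : P (fy i) by apply: contrapT; exact: h.
have [n [c [gc /eqP e]]] := homogeneous_integral gx; apply: Px.
apply: (prime_exp (n := n) Pp); move: e; rewrite addr_eq0 => /eqP ->.
rewrite -mulN1r; apply: idealM; apply: big_ind => [||i _].
- exact: ideal0.
- exact: idealD.
rewrite mulrC; apply: idealM; apply: positive_part_in (gc i) => //.
by rewrite muln_gt0 d0 subn_gt0 /=.
Qed.

Lemma proj_is_prime (p : proj S') : is_prime (pideal p).
Proof. by split; [exact: proj_prime1|exact: proj_primeM]. Qed.

Lemma proj_generator_out (p : proj S') : exists i, ~ pideal p (fy i).
Proof.
have [d [x [d0 gx px]]] := proj_relevant p.
exact: some_generator_out (proj_is_prime p) d0 gx px.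
Qed.

(** The contraction of a point of Proj S' is relevant because some f (y_i) lies outside that point.
    This is where integrality makes the morphism defined everywhere. *)
Lemma exists_projMorphism : inhabited (projMorphism f).
Proof.
have h (p : proj S') : exists q : proj S, forall x, pideal q x <-> pideal p (f x).
  have id : is_ideal [set x | pideal p (f x)].
    split=> [|x z px pz|a x px] /=.
    - by rewrite rmorph0; exact: ideal0.
    - by rewrite rmorphD; exact: idealD.
    - by rewrite rmorphM; exact: idealM.
  have n1 : ~ Ideal id 1 by move=> /=; rewrite rmorph1; exact: proj_prime1.
  have pM x z : Ideal id (x * z) -> Ideal id x \/ Ideal id z.
    by move=> /=; rewrite rmorphM; exact: proj_primeM.
  have ph n (x : 'I_n -> S) : (forall i : 'I_n, gpart i (x i)) ->
      Ideal id (\sum_(i < n) x i) -> forall i, Ideal id (x i).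
    move=> gx /=; rewrite rmorph_sum => hx.
    by apply: (proj_homog (x := fun i => f (x i))) => // i; exact: gmorP.
  have pr : exists d x, [/\ (0 < d)%N, gpart d x & ~ Ideal id x].
    by have [i hi] := proj_generator_out p; exists 1%N, (y i).
  by exists (Proj n1 pM ph pr).
have [g hg] := choice h.
by exists; exact: (@ProjMorphism _ _ f g hg).
Qed.

(** Multiplying the equation by x adds a zero constant coefficient; thus finitely many elements can
    share one degree n. *)
Lemma integral_step e n (x : S') : (exists c : 'I_n -> S,
    (forall i : 'I_n, gpart (e * (n - i)) (c i)) /\
    x ^+ n + \sum_(i < n) f (c i) * x ^+ i = 0) ->
  exists c : 'I_n.+1 -> S, (forall i : 'I_n.+1, gpart (e * (n.+1 - i)) (c i)) /\
    x ^+ n.+1 + \sum_(i < n.+1) f (c i) * x ^+ i = 0.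
Proof.
move=> [c [gc ce]]; exists (fun i => if unlift ord0 i is Some k then c k else 0).
split.
  move=> i; case: unliftP => [k ->|_]; last exact: gpart0.
  by rewrite /= subSS; exact: gc.
rewrite big_ord_recl unlift_none rmorph0 mul0r add0r.
under eq_bigr do rewrite liftK /= exprS mulrCA.
by rewrite exprS -mulr_sumr -mulrDr ce mulr0.
Qed.

(* The S-module spanned by the words of large length D times 1, u, .., u^(n-1)
   is stable under u: a long word contains a high power of some y_i, and
   y_i^m u is integral over S. *)
Lemma integral_of_denominators d (u : L) m (w : I -> S') :
  I -> gpart d u -> (forall i, j (w i) = j (fy i) ^+ m * u) -> integral (j \o f) u.
Proof.
move=> i0 gu jw.
have gfy i : gpart 1 (fy i) by apply: (gmorP f); exact: y_part.
have gw i : gpart (m + d) (w i).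
  apply: j_part; rewrite jw; apply: gpartM => //.
  by rewrite -[X in gpart X]muln1; apply: gpart_exp; apply: (gmorP j).
pose Q n i := exists c : 'I_n -> S,
  (forall k : 'I_n, gpart ((m + d) * (n - k)) (c k)) /\
  w i ^+ n + \sum_(k < n) f (c k) * w i ^+ k = 0.
have [i n||n0 hn0] := @uniform_bound _ (enum I) Q; first exact: integral_step.
  by move=> i _; have [n [c h]] := homogeneous_integral (gw i); exists n, c.
(* The successor makes n positive, so that the exponent 0 of u, [ord0] below, exists. *)
pose n := n0.+1.
have hn i : Q n i by apply: integral_step; apply: hn0; rewrite mem_enum.
(* A word of length D has a letter occurring at least M times, enough to absorb the denominator
   y_a^(m n) of u^n. *)
pose M := (m * n)%N; pose D := (#|I| * M).+1.
pose K := (D.-tuple I * 'I_n)%type.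
pose w_ (t : D.-tuple I) : S := \prod_(i <- t) y i.
pose e (k : K) : L := j (f (w_ k.1)) * u ^+ k.2.
have key (k : K) : exists c : K -> S, u * e k = \sum_k' j (f (c k')) * e k'.
  case: k => t i; have [ni|ni] := ltnP i.+1 n.
    exists (fun k' => (k' == (t, Ordinal ni))%:R).
    rewrite (bigD1 (t, Ordinal ni))//= eqxx !rmorph1 mul1r big1 => [|k' /negbTE ->].
      by rewrite addr0 /e /= exprS mulrCA.
    by rewrite !rmorph0 mul0r.
  have {ni} ni : i.+1 = n by apply/eqP; rewrite eqn_leq ni andbT; exact: ltn_ord.
  have [|a ha] := @frequent_letter _ t M; first by rewrite size_tuple.
  have [r [gr rE]] : exists r, gpart (D - M) r /\ w_ t = y a ^+ M * r.
    exists (y a ^+ (count_mem a t - M) * \prod_(i <- t | i != a) y i); split.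
      have -> : (D - M = (count_mem a t - M) * 1 + size [seq i <- t | i != a])%N.
        have : (count_mem a t + count (fun i => i != a) t = D)%N.
          by rewrite -[RHS](size_tuple t) -(count_predC (pred1 a)).
        by rewrite size_filter; move: ha; rewrite -/M; lia.
      apply: gpartM; first by apply: gpart_exp; exact: y_part.
      by rewrite -big_filter; exact: word_part.
    rewrite mulrA -exprD subnKC// /w_ (bigID (pred1 a))/=; congr (_ * _).
    rewrite (eq_bigr (fun=> y a)) => [|i' /eqP ->//].
    by rewrite big_const_seq iter_mulr_1.
  have [c [gc ce]] := hn a.
  (* The coefficient of u^k has degree D + d (n - k), at least D because d is a natural number, so
     it is again a combination of words of length D. *)
  have gg (k : 'I_n) : gpart (D + d * (n - k)) (r * c k * y a ^+ (m * k)).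
    have -> : (D + d * (n - k) = (D - M) + (m + d) * (n - k) + (m * k) * 1)%N.
      have MD : (M <= D)%N.
        by rewrite (leq_trans ha)// -[X in (_ <= X)%N](size_tuple t) count_size.
      have -> : ((m + d) * (n - k) = M - m * k + d * (n - k))%N.
        by rewrite mulnDl mulnBr.
      have : (m * k <= M)%N by rewrite leq_mul2l ltnW ?orbT.
      by move: MD; lia.
    apply: gpartM; last by apply: gpart_exp; exact: y_part.
    by apply: gpartM.
  have [b hb] := choice (fun k => span_words (gg k)).
  exists (fun k => - b k.2 k.1).
  have uE : u * e (t, i) = j (f r) * j (w a ^+ n).
    rewrite /e /= mulrCA -exprS ni rE !rmorphM /= !rmorphXn /= jw exprMn -exprM.
    by rewrite -/(fy a) -/M -mulrA mulrCA.
  rewrite uE (_ : w a ^+ n = - \sum_(k < n) f (c k) * w a ^+ k); last first.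
    by apply/eqP; rewrite -addr_eq0 ce.
  transitivity (\sum_(k < n) \sum_t' j (f (- b k t')) * e (t', k)); last first.
    rewrite exchange_big /= (pair_big xpredT xpredT
      (fun t' k => j (f (- b k t')) * e (t', k)))/=.
    by apply: eq_bigr => -[].
  rewrite -sumrN rmorph_sum mulr_sumr; apply: eq_bigr => k _.
  transitivity (- (j (f (r * c k * y a ^+ (m * k))) * u ^+ k)).
    rewrite rmorphN mulrN; congr (- _).
    rewrite !rmorphM /= !rmorphXn /= jw exprMn -exprM -!mulrA.
    by rewrite -/(fy a).
  case: (hb k) => _ ->; rewrite !rmorph_sum /= mulr_suml -sumrN.
  by apply: eq_bigr => t' _; rewrite !rmorphN mulNr /e /= !rmorphM mulrA.
have [c hc] := choice key.
pose C : 'M[S]_#|{: K}| := \matrix_(i, i') c (enum_val i) (enum_val i').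
have := @integral_det_pz S L (GRing.RMorphism.clone _ _ (j \o f) _) #|{: K}| u
  (fun i => e (enum_val i)) C.
apply.
  move=> i; rewrite hc (reindex_onto (fun i' : 'I_#|{: K}| => enum_val i') enum_rank)/=; last first.
    by move=> k _; rewrite enum_rankK.
  under eq_bigl do rewrite enum_valK eqxx.
  by apply: eq_bigr => i' _; rewrite mxE.
(* The word y_(i0)^D with u^0 is the unit required by the determinant trick. *)
have [z hz] := y_unit i0.
exists (enum_rank ((nseq_tuple D i0, ord0) : K)), (z ^+ D).
have wE : w_ (nseq_tuple D i0) = y i0 ^+ D by rewrite /w_ big_nseq iter_mulr_1.
rewrite enum_rankK /e [(_, _).1]/= [(_, _).2]/= expr0 mulr1 wE.
by rewrite !rmorphXn /= -exprMn hz expr1n.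
Qed.

(** A prime containing J and no power of x misses some f (y_i); since it contains (f y_i)^m x, it
    would contain x. *)
Lemma radical_saturated (J : ideal S') d (x : S') :
  (forall z n, J (z ^+ n) -> J z) -> (0 < d)%N -> gpart d x ->
  (forall i, exists m, J (fy i ^+ m * x)) -> J x.
Proof.
move=> Jrad d0 gx hJ; apply: contrapT => Jx.
have [|_ _ [m ->] [n ->]|z Jz [n zE]|P [Pp JP PT]] :=
    @prime_avoiding _ J [set z | exists n, z = x ^+ n].
- by exists 0%N.
- by exists (m + n)%N; rewrite exprD.
- by apply: Jx; apply: (Jrad _ n); rewrite -zE.
have Px : ~ P x by move=> Px; apply: (PT _ Px); exists 1%N.
have [i Pi] := some_generator_out Pp d0 gx Px.
have [m /JP] := hJ i; case: Pp => P1 PM; case/PM => // h.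
by apply: Pi; exact: prime_exp h.
Qed.


(** * Quasi-compactness of basic open sets of Proj S' *)

Hypothesis y_part_inv : forall i k u, gpart k.+1 (j (f (y i)) * u) -> gpart k u.
Hypothesis L_nonzero : (1 : L) != 0.
Variable i0 : I.

Lemma S'_nonzero : (1 : S') != 0.
Proof. by apply: contraNneq L_nonzero => /(congr1 j); rewrite rmorph1 rmorph0 => ->. Qed.

(** A homogeneous prime missing g is a point of Proj, since g itself, of positive degree, witnesses
    relevance. *)
Lemma proj_cover (E : nat -> set S') (g : S') (eg : nat) :
  (forall e h, E e h -> gpart e h) -> gpart eg g -> (0 < eg)%N ->
  (forall p : proj S', ~ pideal p g -> exists e h, E e h /\ ~ pideal p h) ->
  exists m (l : seq (S' * S' * nat)), g ^+ m = \sum_(t <- l) t.1.1 * t.1.2 /\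
    forall t, t \in l -> [/\ E t.2 t.1.2, (t.2 <= m * eg)%N &
                            gpart (m * eg - t.2) t.1.1].
Proof.
move=> gE gg eg0 cov.
pose Rn : comNzRingType := HB.pack (GRing.ComPzRing.sort (gcarrier S'))
  (GRing.PzSemiRing_isNonZero.Build (GRing.ComPzRing.sort (gcarrier S')) S'_nonzero).
have int b : @integral_in Rn (@gsum Rn (@gpart S')) b.
  have [n [c e]] := int_over b; exists n, (fun i => f (c i)); split=> // i.
  have [m [c' [gc' _ ->]]] := S_sum (c i); rewrite rmorph_sum.
  apply: (@gsum_sum Rn (@gpart S') (@gpart0 S') (@gpartB S') m (fun k => f (c' k))).
  by move=> k; exact: gmorP.
apply: (@homogeneous_cover Rn (@gpart S') (@gpart0 S') (@gpartB S') (@gpart1 S')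
  (@gpartM S') S'_ind int E g eg gE gg).
move=> P Pp Ph Pg.
pose P' : ideal S' := @Ideal S' (idealset P) (idealP P).
have rel : exists d x, [/\ (0 < d)%N, gpart d x & ~ P' x] by exists eg, g.
case: Pp => P1 PM.
exact: (cov (@Proj S' P' P1 PM Ph rel) Pg).
Qed.

Lemma mulgen_hden (p : proj S') t : mulgen (hden p) t -> hden p t.
Proof.
move=> [l hl ->]; rewrite big_seq; elim/big_rec: _ => [|x z /hl[e [gx px]] [e' [gz pz]]].
  by exists 0%N; split; [exact: gpart1|exact: proj_prime1].
by exists (e + e')%N; split; [exact: gpartM|case/proj_primeM].
Qed.

Lemma lfrac_eq0 (p : proj S') z : lfrac (hden p) z 1 = 0 ->
  exists e w, [/\ gpart e w, ~ pideal p w & w * z = 0].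
Proof.
move=> /(lfracP _ _ (mulgen1 _) (mulgen1 _))[w /mulgen_hden[e [gw pw]] ewz].
by exists e, w; split=> //; rewrite !mulr1 mulr0 in ewz.
Qed.

(** The homogeneous elements killing z cover the locus of g, so a power of g is a combination of
    them. *)
Lemma vanishing_power (z g : S') eg : gpart eg g -> (0 < eg)%N ->
  (forall p, ~ pideal p g -> lfrac (hden p) z 1 = 0) -> exists n, g ^+ n * z = 0.
Proof.
move=> gg eg0 h; pose E e := [set w | gpart e w /\ w * z = 0].
have [e w []//|p pg|m [l [gm hl]]] := @proj_cover E g eg _ gg eg0.
  by have [e [w [gw pw wz]]] := lfrac_eq0 (h p pg); exists e, w.
exists m; rewrite gm mulr_suml big_seq big1 => // t /hl[[_ tz] _ _].
by rewrite -mulrA tz mulr0.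
Qed.

Lemma fy_regular i n (z : S') : fy i ^+ n * z = 0 -> z = 0.
Proof.
move=> e; have [u hu] := y_unit i; apply: j_inj.
rewrite rmorph0 -[LHS]mul1r -(expr1n _ n) -hu exprMn -mulrA.
by rewrite -rmorphXn -rmorphM e rmorph0 mulr0.
Qed.

Lemma section_eq0 (x : S') : (forall p, lfrac (hden p) x 1 = 0) -> x = 0.
Proof.
move=> h; have gi0 : gpart 1 (fy i0) by apply: (gmorP f); exact: y_part.
have [n] := vanishing_power gi0 isT (fun p _ => h p).
exact: fy_regular.
Qed.

(** The locus where this product does not vanish plays the role of the open stratum: its image in L
    is a unit. *)
Let pi : S' := \prod_i fy i.
Let D := #|I|.

Let D_gt0 : (0 < D)%N. Proof. by apply/card_gt0P; exists i0. Qed.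

Let pi_part : gpart D pi.
Proof.
rewrite /pi /D cardE -[X in gpart _ X](rmorph_prod f) -big_enum.
apply: (gmorP f); exact: word_part.
Qed.

Let pi_unit : exists z, z * j pi = 1.
Proof.
rewrite /pi; elim/big_rec: _ => [|i x _ [z hz]]; first by exists 1; rewrite rmorph1 mulr1.
have [u hu] := y_unit i; exists (u * z).
by rewrite rmorphM mulrACA hu hz mulr1.
Qed.

Let pi_regular n (z : S') : pi ^+ n * z = 0 -> z = 0.
Proof.
move=> e; have [u hu] := pi_unit; apply: j_inj.
rewrite rmorph0 -[LHS]mul1r -(expr1n _ n) -hu exprMn -mulrA.
by rewrite -rmorphXn -rmorphM e rmorph0 mulr0.
Qed.

Let pi_part_inv m k u : gpart (m * D + k) (j pi ^+ m * u) -> gpart k u.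
Proof.
elim: m u => [|m IHm] u; first by rewrite expr0 mul1r.
rewrite exprS mulSn -addnA -mulrA => h; apply: IHm; move: h.
move: (m * D + k)%N (_ ^+ m * u) => {}k {}u.
rewrite /pi /D cardE -big_enum /=; elim: (enum I) => [|i s IHs].
  by rewrite big_nil rmorph1 mul1r.
by rewrite big_cons rmorphM -mulrA => /y_part_inv; exact: IHs.
Qed.

(** * Gluing over the open stratum and extension across the boundary *)

Section Gluing.
Variables (J : ideal S') (d : nat) (s : forall p : proj S', loc (hden p)).
Hypothesis s_local : local_fraction J d setT s.

Definition represents e (x t : S') : Prop :=
  [/\ J x, gpart (d + e) x, gpart e t & forall q, ~ pideal q t -> s q = lfrac (hden q) x t].

(** Numerator and denominator are multiplied by some g whose nonvanishing locus lies in the given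
    neighbourhood; the fraction is then valid wherever its own denominator is nonzero. *)
Lemma represents_at p : exists e x t, represents e x t /\ ~ pideal p t.
Proof.
have [W [e [x [t [[[E [hE WE]] Wp _] [Jx gx gt hW]]]]]] := @s_local p Logic.I.
move: (Wp); rewrite WE => -[g [Eg pg]]; have [eg gg] := hE g Eg.
have gW q : ~ pideal q g -> W q by rewrite WE => qg; exists g.
have pt : ~ pideal p t by case: (hW p Wp).
exists (eg + e)%N, (g * x), (g * t); split; last by case/proj_primeM.
split; [exact: idealM|by rewrite addnCA; exact: gpartM|exact: gpartM|].
move=> q qgt; have qg : ~ pideal q g.
  by move=> h; apply: qgt; rewrite mulrC; exact: idealM.
have [qt ->] := hW q (gW q qg).
apply: lfrac_eq; [exact: hden_mulgen gt qt| |by rewrite mulrCA mulrA].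
by apply: hden_mulgen qgt; exact: gpartM gg gt.
Qed.

(** The cross difference vanishes locally where t t' does not, so quasi-compactness applies. The
    extra factor pi secures a positive degree and is then removed by regularity. *)
Lemma represents_compat e x t e' x' t' : represents e x t -> represents e' x' t' ->
  exists n, (t * t') ^+ n * (x * t' - x' * t) = 0.
Proof.
move=> [Jx gx gt hx] [Jx' gx' gt' hx'].
have gg : gpart (D + (e + e')) (pi * (t * t')) by apply: gpartM => //; exact: gpartM.
have [|p pg|n] := vanishing_power (z := x * t' - x' * t) gg.
- by rewrite addn_gt0 D_gt0.
- have pt : ~ pideal p t.
    by move=> h; apply: pg; rewrite mulrA mulrC; apply: idealM; apply: idealM.
  have pt' : ~ pideal p t' by move=> h; apply: pg; rewrite mulrA; exact: idealM.
  have : lfrac (hden p) x t = lfrac (hden p) x' t' by rewrite -hx// -hx'.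
  move=> /(lfracP _ _ (hden_mulgen gt pt) (hden_mulgen gt' pt'))[w mw ew].
  apply/(lfracP _ _ (mulgen1 _) (mulgen1 _)); exists w => //.
  by rewrite !mulr1 mulr0 mulrBr ew subrr.
- by rewrite exprMn -mulrA => /pi_regular; exists n.
Qed.

(** The gluing is done in L, where pi is invertible. Agreement with a fraction x/t is only up to a
    power of t, as j t may be a zero divisor. *)
Lemma glue : exists u : L, gpart d u /\ forall e x t, represents e x t ->
  exists n, j t ^+ n * (j x - j t * u) = 0.
Proof.
pose E e := [set t | exists x, represents e x t].
have [e h [x []]//|p _|m [l [pm hl]]] := @proj_cover E pi D _ pi_part D_gt0.
  by have [e [x [t [rt pt]]]] := represents_at p; exists e, t; split=> //; exists x.
have /choice[X hX] (t : S' * S' * nat) : exists x, t \in l -> represents t.2 x t.1.2.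
  by case: (boolP (t \in l)) => [/hl[[x rx] _ _]|_]; [exists x|exists 0].
have [N hN] : exists N, forall t t', t \in l -> t' \in l ->
    (t.1.2 * t'.1.2) ^+ N * (X t * t'.1.2 - X t' * t.1.2) = 0.
  have [n t|t /allpairsP[[a b] [al bl ->]]|N hN] := @uniform_bound _
    [seq (a, b) | a <- l, b <- l] (fun N ab => (ab.1.1.2 * ab.2.1.2) ^+ N *
      (X ab.1 * ab.2.1.2 - X ab.2 * ab.1.1.2) = 0).
  - by move=> h; rewrite exprS -mulrA h mulr0.
  - exact: represents_compat (hX a al) (hX b bl).
  - by exists N => a b al bl; apply: (hN (a, b)); apply/allpairsP; exists (a, b).
(* Powers of the denominators in the cover still cover, by primality. *)
have cov n : exists m' (l' : seq (S' * (S' * S' * nat))),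
    pi ^+ m' = \sum_(r <- l') r.1 * r.2.1.2 ^+ n.+1 /\ forall r, r \in l' ->
    [/\ r.2 \in l, (n.+1 * r.2.2 <= m' * D)%N & gpart (m' * D - n.+1 * r.2.2) r.1].
  pose E' e := [set h | exists t, [/\ t \in l, h = t.1.2 ^+ n.+1 & e = (n.+1 * t.2)%N]].
  have [e h [t [/hX[_ _ gt _] -> ->]]|p pp|m' [l' [pm' hl']]] :=
      @proj_cover E' pi D _ pi_part D_gt0.
  - exact: gpart_exp.
  - apply: contrapT => np; apply: (proj_exp (d := m) pp); rewrite pm big_seq.
    apply: big_ind => [||t tl]; [exact: ideal0|exact: idealD|].
    apply: idealM; apply: contrapT => pt; apply: np.
    by exists (n.+1 * t.2)%N, (t.1.2 ^+ n.+1); split; [exists t|exact: proj_exp].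
  have /choice[T hT] (r : S' * S' * nat) : exists t, r \in l' ->
      [/\ t \in l, r.1.2 = t.1.2 ^+ n.+1 & r.2 = (n.+1 * t.2)%N].
    by case: (boolP (r \in l')) => [/hl'[[t ht] _ _]|_]; [exists t|exists (0, 0, 0%N)].
  exists m', [seq (r.1.1, T r) | r <- l']; split.
    rewrite pm' big_map big_seq [RHS]big_seq; apply: eq_bigr => r rl /=.
    by case: (hT r rl) => _ ->.
  move=> _ /mapP[r rl ->] /=; have [h1 _ h3] := hT r rl.
  by have [_ h4 h5] := hl' r rl; rewrite -h3.
have [m' [l' [pm' hl']]] := cov N.
(* Each term a t^(N+1) of pi^m' is replaced by a t^N X, that is by its product with the local value
   X/t. The spare factor t^N is consumed by pairwise compatibility with exponent N. *)
pose v := \sum_(r <- l') r.1 * (X r.2 * r.2.1.2 ^+ N).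
have gv : gpart (m' * D + d) v.
  rewrite /v big_seq; apply: gpart_sum => r /hl'[rl le gr].
  have [_ gX gT _] := hX _ rl.
  have -> : (m' * D + d = (m' * D - N.+1 * r.2.2) + ((d + r.2.2) + N * r.2.2))%N.
    by move: le; rewrite mulSn; lia.
  by do 2 apply: gpartM => //; exact: gpart_exp.
have [z hz] := pi_unit.
pose u := z ^+ m' * j v.
have uE : j pi ^+ m' * u = j v by rewrite /u mulrA -exprMn mulrC -(mulrC z) hz expr1n mulr1.
have glue_l t : t \in l -> j t.1.2 ^+ N.+1 * u = j t.1.2 ^+ N * j (X t).
  move=> tl; rewrite -[RHS]mul1r -(expr1n _ m') -hz exprMn -mulrA.
  rewrite /u mulrCA; congr (_ * _).
  rewrite -!(rmorphXn j) -!(rmorphM j); congr (j _).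
  rewrite pm' /v mulr_sumr mulr_suml big_seq [RHS]big_seq.
  apply: eq_bigr => r /hl'[rl _ _].
  have /eqP := hN r.2 t rl tl; rewrite mulrBr subr_eq0 exprMn => /eqP e.
  transitivity (r.1 * (r.2.1.2 ^+ N * t.1.2 ^+ N * (X r.2 * t.1.2))).
    by rewrite exprSr; ring.
  by rewrite e exprSr; ring.
exists u; split.
  by apply: (pi_part_inv (m := m')); rewrite uE; exact: gmorP.
move=> e x0 t0 r0.
have [n hn] : exists n, forall t, t \in l ->
    (t.1.2 * t0) ^+ n * (X t * t0 - x0 * t.1.2) = 0.
  apply: (@uniform_bound _ l (fun n t => (t.1.2 * t0) ^+ n * (X t * t0 - x0 * t.1.2) = 0)).
    by move=> t n h; rewrite exprS -mulrA h mulr0.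
  by move=> t tl; exact: represents_compat (hX t tl) r0.
(* M dominates the exponents of both comparisons: every t^(M+1) of the cover kills the difference,
   hence so does a power of the unit j pi. *)
pose M := (N + n)%N; exists M.
have [m2 [l2 [pm2 hl2]]] := cov M.
have [z2 hz2] := pi_unit.
set w := _ * _; rewrite -[LHS]mul1r -(expr1n _ m2) -hz2 exprMn -mulrA.
rewrite -[X in _ * X](_ : 0 = _) ?mulr0//.
rewrite -(rmorphXn j) pm2 (rmorph_sum j) mulr_suml big_seq big1 => // r /hl2[rl _ _].
rewrite (rmorphM j) (rmorphXn j) /= -mulrA; set t := r.2.1.2.
suff -> : j t ^+ M.+1 * w = 0 by rewrite mulr0.
have e1 : j t ^+ M.+1 * u = j t ^+ M * j (X r.2).
  rewrite (_ : M.+1 = n + N.+1)%N; last by rewrite /M addnS addnC.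
  by rewrite exprD -mulrA glue_l// /M [in RHS]addnC exprD -mulrA.
have e2 : j t ^+ M * j t0 ^+ M * (j (X r.2) * j t0 - j x0 * j t) = 0.
  rewrite -!(rmorphXn j) -!(rmorphM j) -(rmorphB j) -(rmorphM j) -exprMn.
  by rewrite /M exprD -mulrA hn// mulr0 rmorph0.
rewrite /w; transitivity (j t0 ^+ M * (j t ^+ M.+1 * j x0 - j t0 * (j t ^+ M.+1 * u))).
  by ring.
rewrite e1 exprSr -[RHS]oppr0 -e2; ring.
Qed.

Hypothesis J_radical : forall z n, J (z ^+ n) -> J z.
Hypothesis d_gt0 : (0 < d)%N.

(** Near each point a power of a denominator t carries u into J. Quasi-compactness of the locus of f
    y_i replaces these by one power of f y_i, which bounds the denominators of u. *)
Lemma global_fraction : exists x, [/\ J x, gpart d x & forall p, s p = lfrac (hden p) x 1].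
Proof.
have [u [gu hu]] := glue.
have gfy i : gpart 1 (fy i) by apply: (gmorP f); exact: y_part.
have den i : exists m, exists2 x, J x & j x = j (fy i) ^+ m * u.
  pose E e := [set h | gpart e h /\ exists2 x, J x & j x = j h * u].
  have [e h []//|p pi_|m [l [fm hl]]] := @proj_cover E (fy i) 1 _ (gfy i) isT.
    have [e [x [t [rt pt]]]] := represents_at p; have [n hn] := hu _ _ _ rt.
    have [Jx _ gt _] := rt.
    exists (n.+1 * e)%N, (t ^+ n.+1); split; last exact: proj_exp.
    split; first exact: gpart_exp.
    exists (t ^+ n * x); first exact: idealM.
    move/eqP: hn; rewrite mulrBr subr_eq0 rmorphM !rmorphXn /= => /eqP ->.
    by rewrite exprSr mulrA.
  exists m; rewrite -rmorphXn fm rmorph_sum mulr_suml.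
  have : forall t, t \in l -> exists2 x, J x & j x = j (t.1.1 * t.1.2) * u.
    move=> t /hl[[_ [x Jx jx]] _ _]; exists (t.1.1 * x); first exact: idealM.
    by rewrite !rmorphM /= jx mulrA.
  elim: (l) => [|t l' IHl] h.
    by exists 0; [exact: ideal0|rewrite big_nil rmorph0].
  have [x Jx jx] := h t (mem_head _ _).
  have [|x' Jx' jx'] := IHl; first by move=> t' tl; apply: h; rewrite in_cons tl orbT.
  by exists (x + x'); [exact: idealD|rewrite rmorphD big_cons jx jx'].
have [i m|i _|m hm] := @uniform_bound _ (enum I)
    (fun m i => exists2 x, J x & j x = j (fy i) ^+ m * u); [|exact: den|].
  move=> [x Jx jx]; exists (fy i * x); first exact: idealM.
  by rewrite rmorphM jx exprS mulrA.
have /choice[w hw] i : exists x, J x /\ j x = j (fy i) ^+ m * u.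
  by have [|x Jx jx] := hm i; [rewrite mem_enum|exists x].
have [x xu] := int_closed (integral_of_denominators i0 gu (fun i => proj2 (hw i))).
have gx : gpart d x by apply: j_part; rewrite xu.
exists x; split=> //.
  apply: radical_saturated J_radical d_gt0 gx _ => i; exists m.
  have [Jw jw] := hw i; suff <- : w i = fy i ^+ m * x by [].
  by apply: j_inj; rewrite jw rmorphM rmorphXn /= xu.
move=> p; have [e [x' [t [rt pt]]]] := represents_at p.
have [n hn] := hu _ _ _ rt; have [_ _ gt ->//] := rt.
have mt := hden_mulgen gt pt.
apply/(lfracP _ _ mt (mulgen1 _)); exists (t ^+ n).
  apply: (@hden_mulgen _ _ (n * e)); [exact: gpart_exp|exact: proj_exp].
apply: j_inj; move/eqP: hn; rewrite mulrBr subr_eq0 => /eqP hn.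
by rewrite mulr1 !rmorphM rmorphXn /= hn xu (mulrC u).
Qed.

End Gluing.

(** A generator nonvanishing at p is chosen for every p. All identities of germs are then checked
    after evaluation, where the section of x is x/1. *)
Lemma sections_isomorphism (rho : projMorphism f) (J : ideal S') d :
  (forall z n, J (z ^+ n) -> J z) -> (0 < d)%N -> natural_isomorphism rho J d.
Proof.
move=> Jrad d0.
have /choice[gen hgen] (p : proj S') := proj_generator_out p.
pose Phi (x : S') p : mstalk (twist rho (sheaf_of J 0) d) p :=
  tens_pure idfun (hfrac_elt J 0 p x (f (y (gen p)) ^+ d))
                  (stalk_power (germ_O1 rho (y (gen p)) p) d).
have inj p (a b : mstalk (twist rho (sheaf_of J 0) d) p) :
    twist_eval a = twist_eval b -> a = b.
  exact: (twist_eval_inj_at (y_part (gen p)) (hgen p)).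
have PhiE x p : J x -> gpart d x -> twist_eval (Phi x p) = lfrac (hden p) x 1.
  by move=> Jx gx; exact: twist_eval_associated (y_part (gen p)) (hgen p) _ _ _ Jx gx.
have [evD evZ] := twist_evaluation rho J d.
have ass x : J x -> gpart d x -> is_associated_section x (Phi x).
  move=> Jx gx p y' gy' py'; apply: inj; rewrite PhiE//.
  by rewrite (twist_eval_associated rho gy' py').
exists Phi; split=> //.
- split.
  + move=> x [Jx gx] p _; set i := gen p.
    exists [set p | ~ pideal p (fy i)].
    exists [:: (fun q => hfrac_elt J 0 q x (fy i ^+ d),
                fun q => stalk_power (germ_O1 rho (y i) q) d)].
    have gfy : gpart 1 (fy i) by apply: (gmorP f); exact: y_part.
    have oW := zopen_basic gfy.
    split; first by split=> //; exact: hgen.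
    split; last first.
      by move=> q qi; rewrite big_seq1 /=; exact: (ass x Jx gx q (y i) (y_part i) qi).
    constructor=> //; split; last exact: stalk_power_section (y_part i).
    move=> q qi; exists [set p | ~ pideal p (fy i)], d, x, (fy i ^+ d).
    have gfyd : gpart d (fy i ^+ d).
      by rewrite -[X in gpart X]muln1; exact: gpart_exp.
    split; first by split.
    split=> // z zi; have zid : ~ pideal z (fy i ^+ d) by exact: proj_exp.
    by split=> //; rewrite (@val_hfrac_elt _ _ _ _ d).
  + move=> x x' /set_mem[Jx gx] /set_mem[Jx' gx'] e.
    apply/eqP; rewrite -subr_eq0; apply/eqP; apply: section_eq0 => p.
    have : lfrac (hden p) x 1 = lfrac (hden p) x' 1 by rewrite -!PhiE// e.
    move/eqP; rewrite -subr_eq0 lfracB; [|exact: mulgen1|exact: mulgen1].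
    by rewrite !mulr1 => /eqP.
  + move=> s hs; have := twist_evaluates hs => /(global_fraction) [//|//|x [Jx gx hx]].
    exists x => //; apply: functional_extensionality_dep => p; apply: inj.
    by rewrite PhiE// hx.
- move=> x x' Jx gx Jx' gx'; apply: functional_extensionality_dep => p; apply: inj.
  rewrite evD !PhiE//; [|exact: idealD|exact: gpartD].
  by rewrite lfracD ?mulr1//; exact: mulgen1.
- move=> c x gc Jx gx; apply: functional_extensionality_dep => p; apply: inj.
  rewrite evZ !PhiE//; [|exact: idealM|exact: (gpartM gc gx)].
  rewrite insubdK; first by rewrite lfracM ?mulr1//; exact: mulgen1.
  by apply/asboolP; exists 0%N, c, 1; split=> //; [exact: gpart1|exact: proj_prime1].
Qed.

End Setup.

(** * The grading of R_V *)

(** Here Proj S' has no points, so there is exactly one section, matching the zero part of degree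
    d. *)
Lemma trivial_isomorphism (S S' : gradedRing) (f : gradedMorphism S S') :
  (forall d x, (0 < d)%N -> @gpart S' d x -> x = 0) ->
  exists rho : projMorphism f, forall (J : ideal S') d, (0 < d)%N ->
    natural_isomorphism rho J d.
Proof.
move=> h0.
have empty (p : proj S') : False.
  by have [d [x [d0 /(h0 _ _ d0)-> px]]] := proj_relevant p; apply/px/ideal0.
exists (@ProjMorphism _ _ f (fun p => match empty p return proj S with end)
  (fun p => match empty p with end)) => J d d0.
exists (fun _ p => match empty p with end).
split=> [x _ _ p|||]; first by case: (empty p).
- split.
  + by move=> x _ p; case: (empty p).
  + move=> x x' /set_mem[_ /(h0 _ _ d0)->] /set_mem[_ /(h0 _ _ d0)->] //.
  + move=> s _; exists 0; first by split; [exact: ideal0|exact: gpart0].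
    by apply: functional_extensionality_dep => p; case: (empty p).
- by move=> x x' _ _ _ _; apply: functional_extensionality_dep => p; case: (empty p).
- by move=> c x _ _ _; apply: functional_extensionality_dep => p; case: (empty p).
Qed.

Section HomogeneousFractionsKV.
Variables (Fq : finFieldType) (V : lmodType Fq).
Local Notation K := (KV V).
Local Notation P := {mpoly Fq[symdim V]}.

(* Degree is that of the denominator minus that of the numerator, so that 1/v
   has degree 1; the case q = 0 only contributes x = 0. *)
Definition KV_part (k : nat) : set K := [set x | exists a (p q : P),
  [/\ p \is (a.-homog), q \is (a + k).-homog & x = tofrac p / tofrac q]].

Lemma KV_part0 k : KV_part k 0.
Proof. by exists 0%N, 0, 0; split; rewrite ?rpred0// rmorph0 mul0r. Qed.

Lemma KV_partN k x : KV_part k x -> KV_part k (- x).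
Proof.
move=> [a [p [q [hp hq ->]]]]; exists a, (- p), q.
by split; rewrite ?rpredN// rmorphN mulNr.
Qed.

Lemma KV_partB k x x' : KV_part k x -> KV_part k x' -> KV_part k (x - x').
Proof.
move=> hx hx'; move: (hx) (hx') => [a [p [q [hp hq xE]]]] [b [p' [q' [hp' hq' x'E]]]].
have [q0|q0] := eqVneq q 0.
  rewrite xE q0 rmorph0 invr0 mulr0 sub0r; exact: KV_partN.
have [q0'|q0'] := eqVneq q' 0.
  by rewrite x'E q0' rmorph0 invr0 mulr0 subr0.
exists (a + b + k)%N, (p * q' - p' * q), (q * q'); split.
- apply: rpredB; first by rewrite -addnA; exact: dhomogM.
  by rewrite addnAC (addnC (a + k)%N); exact: dhomogM.
- by rewrite (_ : a + b + k + k = a + k + (b + k))%N; [exact: dhomogM|lia].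
- rewrite xE x'E -mulNr addf_div ?tofrac_eq0// rmorphM rmorphB !rmorphM /=.
  by rewrite mulNr.
Qed.

Lemma KV_partM k l x x' : KV_part k x -> KV_part l x' -> KV_part (k + l) (x * x').
Proof.
move=> [a [p [q [hp hq ->]]]] [b [p' [q' [hp' hq' ->]]]].
exists (a + b)%N, (p * p'), (q * q'); split; first exact: dhomogM.
  by rewrite addnACA; exact: dhomogM.
by rewrite !rmorphM mulf_div.
Qed.

Lemma KV_part_const c : KV_part 0 (KV_const V c).
Proof.
exists 0%N, c%:MP, 1; split; [|exact: dhomog1|by rewrite rmorph1 divr1].
by rewrite -[c%:MP]mulr1 mul_mpolyC; apply: rpredZ; exact: dhomog1.
Qed.

Lemma KV_part_inv v : KV_part 1 (KV_of v)^-1.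
Proof.
exists 0%N, 1, (sym_of v); split; [exact: dhomog1| |by rewrite rmorph1 mul1r].
apply: rpred_sum => i _; apply: rpredZ; rewrite dhomogX; apply/eqP; exact: mdeg1.
Qed.

(** The alternative N i = 0 serves components written with denominator 0, for which no a with a + i
    = b need exist. *)
Lemma KV_part_common n (x : 'I_n -> K) : (forall i : 'I_n, KV_part i (x i)) ->
  exists b (Q : P) (N : 'I_n -> P), Q != 0 /\ Q \is b.-homog /\
    forall i, x i * tofrac Q = tofrac (N i) /\
              (N i = 0 \/ exists a, (a + i = b)%N /\ N i \is (a.-homog)).
Proof.
elim: n x => [|n IHn] x hx.
  by exists 0%N, 1, (fun=> 0); split; [exact: oner_neq0|split; [exact: dhomog1|case]].
have [i|b [Q [N [Q0 [hQ hN]]]]] := IHn (fun i => x (widen_ord (leqnSn n) i)).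
  exact: (hx (widen_ord (leqnSn n) i)).
have [a [p [q [hp hq xE]]]] := hx ord_max.
pose ext (g : 'I_n -> P) z (i : 'I_n.+1) := if unlift ord_max i is Some k then g k else z.
have liftE (i : 'I_n) : lift ord_max i = widen_ord (leqnSn n) i.
  by apply: val_inj; rewrite /= /bump leqNgt ltn_ord.
have [q0|q0] := eqVneq q 0.
  exists b, Q, (ext N 0); do 2 split=> //.
  move=> i; rewrite /ext; case: unliftP => [k ->|->].
    rewrite liftE; exact: hN.
  by rewrite xE q0 rmorph0 invr0 mulr0 mul0r; split=> //; left.
exists (b + (a + n))%N, (Q * q), (ext (fun i => N i * q) (p * Q)).
split; first by rewrite mulf_neq0.
split; first exact: dhomogM.
move=> i; rewrite /ext; case: unliftP => [k ->|->].
  rewrite liftE; have [xk Nk] := hN k; split.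
    by rewrite !rmorphM mulrA xk.
  case: Nk => [->|[c [ck hc]]]; first by left; rewrite mul0r.
  right; exists (c + (a + n))%N; split; last exact: dhomogM.
  by rewrite -ck /=; lia.
split.
  rewrite xE !rmorphM [tofrac Q * _]mulrC mulrA divfK// ?tofrac_eq0//.
right; exists (a + b)%N; split; last exact: dhomogM.
by rewrite /=; lia.
Qed.

(** Over a common denominator of degree b the numerators have the distinct degrees b - i, so they
    cannot cancel. *)
Lemma KV_independent : graded_independent KV_part.
Proof.
move=> n x hx xs i; have [b [Q [N [Q0 [hQ hN]]]]] := KV_part_common hx.
have Ns : \sum_(k < n) N k = 0.
  apply/eqP; rewrite -tofrac_eq0 rmorph_sum; apply/eqP.
  transitivity ((\sum_(k < n) x k) * tofrac Q); last by rewrite xs mul0r.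
  by rewrite mulr_suml; apply: eq_bigr => k _; case: (hN k).
suff Ni : N i = 0.
  have [e _] := hN i; move: e; rewrite Ni rmorph0 => /eqP.
  by rewrite mulf_eq0 tofrac_eq0 (negbTE Q0) orbF => /eqP.
case: (hN i) => _ [//|[a [ai ha]]].
apply/mpolyP => m; rewrite mcoeff0.
have [ma|ma] := eqVneq (mdeg m) a; last first.
  exact: dhomog_nemf_coeff ha ma.
have := congr1 (mcoeff m) Ns; rewrite mcoeff0 raddf_sum (bigD1 i)//= big1 ?addr0//.
move=> k ki; case: (hN k) => _ [->|[c [ck hc]]]; first by rewrite mcoeff0.
apply: (dhomog_nemf_coeff hc); apply: contraNneq ki => mc.
have ac : a = c by rewrite -ma -mc.
by rewrite -val_eqE; apply/eqP/(@addnI a); rewrite ai ac.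
Qed.

Definition RV_part (k : nat) : set (RV V) := [set x | KV_part k (val x)].

Lemma RV_independent : graded_independent RV_part.
Proof.
move=> n x hx xs i; apply: val_inj; rewrite rmorph0.
apply: (KV_independent (x := fun i => val (x i))) => //.
by rewrite -rmorph_sum xs rmorph0.
Qed.

Lemma RV_part0 k : RV_part k 0. Proof. exact: KV_part0. Qed.
Lemma RV_partB k x x' : RV_part k x -> RV_part k x' -> RV_part k (x - x').
Proof. exact: KV_partB. Qed.
Lemma RV_part1 : RV_part 0 1.
Proof. by rewrite /RV_part /= -(rmorph1 (KV_const V)); exact: KV_part_const. Qed.
Lemma RV_partM k l x x' : RV_part k x -> RV_part l x' -> RV_part (k + l) (x * x').
Proof. exact: KV_partM. Qed.

Lemma RV_ind (Q : RV V -> Prop) : (forall c, Q (RV_of V c)) ->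
  (forall v, v != 0 -> Q (rinv v)) ->
  (forall x x', Q x -> Q x' -> Q (x - x')) ->
  (forall x x', Q x -> Q x' -> Q (x * x')) -> forall x, Q x.
Proof.
move=> Qc Qi QB QM x; have /asboolP h := valP x.
have [|v v0|z Qz /val_inj <-//] := h [set u | exists2 z : RV V, Q z & val z = u].
- split=> [c|_ _ [z hz <-] [z' hz' <-]|_ _ [z hz <-] [z' hz' <-]].
  + by exists (RV_of V c).
  + by exists (z - z'); [exact: QB|].
  + by exists (z * z'); [exact: QM|].
- by exists (rinv v); [exact: Qi|].
Qed.

Lemma RV_gsum x : gsum RV_part x.
Proof.
elim/RV_ind: x => [c|v _|x x'|x x'].
- by apply: (gsum_part RV_part0 (d := 0)); exact: KV_part_const.
- by apply: (gsum_part RV_part0 (d := 1)); exact: KV_part_inv.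
- exact: gsumB RV_partB _ _.
- exact: gsumM RV_part0 RV_partB RV_partM _ _.
Qed.

End HomogeneousFractionsKV.

(** * The grading of R_A *)

(** The coaction of the multiplicative group defining the grading. As a ring morphism, unlike a
    family of parts, it passes to tensor products and quotients. *)
Lemma grading_morphism (R : comNzRingType) (gp : nat -> set R) :
  (forall d, gp d 0) -> (forall d x y, gp d x -> gp d y -> gp d (x - y)) ->
  gp 0 1 -> (forall d e x y, gp d x -> gp e y -> gp (d + e) (x * y)) ->
  graded_independent gp -> (forall x, gsum gp x) ->
  exists delta : {rmorphism R -> {poly R}},
    forall d x, gp d x -> delta x = x *: 'X^d.
Proof.
move=> gp0 gpB gp1 gpM gind gs.
have /choice[dl hdl] x : exists q, gpoly gp q /\ x = q.[1].
  by have [q gq xq] := gs x; exists q.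
have uniq q : gpoly gp q -> dl q.[1] = q.
  move=> gq; have [gd e] := hdl q.[1].
  apply/eqP; rewrite -subr_eq0; apply/eqP; apply: (gpoly_inj gind).
    exact: gpolyB.
  by rewrite hornerD hornerN -e subrr.
have dlB : zmod_morphism dl.
  move=> x y; have [gx ex] := hdl x; have [gy ey] := hdl y.
  by rewrite -[RHS]uniq; [rewrite hornerD hornerN -ex -ey|exact: gpolyB].
have dlM : monoid_morphism dl.
  split; first by rewrite -[RHS](uniq 1) ?hornerC//; exact: gpoly1.
  move=> x y; have [gx ex] := hdl x; have [gy ey] := hdl y.
  by rewrite -[RHS]uniq; [rewrite hornerM -ex -ey|exact: gpolyM].
pose delta : {rmorphism R -> {poly R}} := HB.pack dl
  (GRing.isZmodMorphism.Build _ _ dl dlB) (GRing.isMonoidMorphism.Build _ _ dl dlM).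
exists delta => d x gx.
rewrite -(uniq (x *: 'X^d)); last exact: gpolyZXn.
by rewrite hornerZ hornerXn expr1n mulr1.
Qed.

(** * Universal properties of the tensor product and of the quotient ring *)

Lemma tring_pureM (k B C : comPzRingType) (iB : {rmorphism k -> B})
    (iC : {rmorphism k -> C}) b c b' c' :
  tring_pure iB iC b c * tring_pure iB iC b' c' = tring_pure iB iC (b * b') (c * c').
Proof.
apply: tring_eq => U f g fg; rewrite tring_evM// !tring_ev_class//.
by rewrite /tring_ev !big_seq1 /= !rmorphM mulrACA.
Qed.

Lemma tring_pureBl (k B C : comPzRingType) (iB : {rmorphism k -> B})
    (iC : {rmorphism k -> C}) b b' c :
  tring_pure iB iC (b - b') c = tring_pure iB iC b c - tring_pure iB iC b' c.
Proof.
apply: tring_eq => U f g fg.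
rewrite tring_evD// tring_evN// !tring_ev_class//.
by rewrite /tring_ev !big_seq1 /= rmorphB mulrBl.
Qed.

Lemma tring_pure_base (k B C : comPzRingType) (iB : {rmorphism k -> B})
    (iC : {rmorphism k -> C}) x :
  tring_pure iB iC (iB x) 1 = tring_inr iB iC (iC x).
Proof.
apply: tring_eq => U f g fg; rewrite !tring_ev_class//.
by rewrite /tring_ev !big_seq1 /= !rmorph1 mulr1 mul1r fg.
Qed.

Lemma tring_ind (k B C : comPzRingType) (iB : {rmorphism k -> B})
    (iC : {rmorphism k -> C}) (Q : tring iB iC -> Prop) :
  Q 0 -> (forall x y, Q x -> Q y -> Q (x + y)) ->
  (forall b c, Q (tring_pure iB iC b c)) -> forall x, Q x.
Proof.
move=> Q0 QD Qp x; rewrite -[x]reprK; elim: (repr x) => [|[b c] l IHl].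
  exact: Q0.
suff -> : \pi_(tring iB iC) ((b, c) :: l) = tring_pure iB iC b c + \pi l by exact: QD.
apply: tring_eq => U f g fg; rewrite tring_evD// !tring_ev_class//.
by rewrite /tring_ev big_cons big_seq1.
Qed.

Lemma tring_lift (k B C U : comPzRingType) (iB : {rmorphism k -> B})
    (iC : {rmorphism k -> C}) (f : {rmorphism B -> U}) (g : {rmorphism C -> U}) :
  (forall x, f (iB x) = g (iC x)) ->
  exists h : {rmorphism tring iB iC -> U}, forall b c, h (tring_pure iB iC b c) = f b * g c.
Proof.
move=> fg; pose ev (x : tring iB iC) := tring_ev f g (repr x).
have evB : zmod_morphism ev.
  by move=> x y; rewrite /ev tring_evD// tring_evN.
have evM : monoid_morphism ev.
  by split; [rewrite /ev tring_ev1|move=> x y; rewrite /ev tring_evM].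
pose h : {rmorphism tring iB iC -> U} := HB.pack ev
  (GRing.isZmodMorphism.Build _ _ ev evB) (GRing.isMonoidMorphism.Build _ _ ev evM).
exists h => b c; rewrite /h /= /ev tring_ev_class//.
by rewrite /tring_ev big_seq1.
Qed.

Lemma quoring_lift (R U : comPzRingType) (G : set R) (h : {rmorphism R -> U}) :
  (forall x, G x -> h x = 0) ->
  exists h' : {rmorphism quoring (ideal_gen G) -> U}, forall x, h' (qproj (ideal_gen G) x) = h x.
Proof.
move=> hG.
have kid : is_ideal [set x | h x = 0].
  split=> [|x y /= hx hy|a x /= hx]; first exact: rmorph0.
    by rewrite rmorphD hx hy addr0.
  by rewrite rmorphM hx mulr0.
have kE x : ideal_gen G x -> h x = 0 by move=> /(_ (Ideal kid)); apply; exact: hG.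
pose h0 (z : quoring (ideal_gen G)) := h (repr z).
have h0E x : h0 (qproj _ x) = h x.
  apply/eqP; rewrite -subr_eq0 -rmorphB; apply/eqP/kE/qprojP; exact: qproj_repr.
have h0B : zmod_morphism h0.
  move=> x y; rewrite -[x]qproj_repr -[y]qproj_repr -rmorphB !h0E; exact: rmorphB.
have h0M : monoid_morphism h0.
  split; first by rewrite -(rmorph1 (qproj (ideal_gen G))) h0E rmorph1.
  move=> x y; rewrite -[x]qproj_repr -[y]qproj_repr -rmorphM !h0E; exact: rmorphM.
pose h' : {rmorphism quoring (ideal_gen G) -> U} := HB.pack h0
  (GRing.isZmodMorphism.Build _ _ h0 h0B) (GRing.isMonoidMorphism.Build _ _ h0 h0M).
by exists h'.
Qed.

Section Instance.
Variables (Fq : finFieldType) (F : fieldType) (iota : {rmorphism Fq -> F}).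
Variables (infty : set F) (N : ideal (coefRing iota infty)) (s : nat).
Local Notation V := (VNq N s).
Local Notation RA := (RA N s).
Local Notation RV := (RV V).

Definition RA_of_RV (b : RV) : RA :=
  qproj (ideal_gen (@RA_relations Fq F iota infty N s)) (tring_pure _ _ b 1).

Lemma RA_of_RV_is_zmod_morphism : zmod_morphism RA_of_RV.
Proof. by move=> x y; rewrite /RA_of_RV tring_pureBl rmorphB. Qed.
Lemma RA_of_RV_is_monoid_morphism : monoid_morphism RA_of_RV.
Proof.
split; first exact: (rmorph1 (qproj _)).
move=> x y; rewrite /RA_of_RV -[X in tring_pure _ _ _ X](mulr1 1) -tring_pureM.
exact: (rmorphM (qproj _)).
Qed.
HB.instance Definition _ :=
  GRing.isZmodMorphism.Build RV RA RA_of_RV RA_of_RV_is_zmod_morphism.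
HB.instance Definition _ :=
  GRing.isMonoidMorphism.Build RV RA RA_of_RV RA_of_RV_is_monoid_morphism.

Lemma RA_of_RV_const c : RA_of_RV (RV_of V c) = RA_const N s (iota c).
Proof. by rewrite /RA_of_RV tring_pure_base. Qed.

Lemma qproj_pure b c :
  qproj (ideal_gen (@RA_relations Fq F iota infty N s)) (tring_pure _ _ b c) =
  RA_of_RV b * RA_const N s c.
Proof.
rewrite /RA_of_RV /RA_const.
rewrite -[RHS](rmorphM (qproj _)); congr (qproj _ _).
by rewrite /tring_inr tring_pureM mulr1 mul1r.
Qed.

Lemma RA_words (x : RA) : exists2 l : seq (F * seq (VN N s)),
  (forall t, t \in l -> all (fun v => v != 0) t.2) &
  x = \sum_(t <- l) RA_const N s t.1 * RA_prod t.2.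
Proof.
pose Q (x : RA) := exists2 l : seq (F * seq (VN N s)),
  (forall t, t \in l -> all (fun v => v != 0) t.2) &
  x = \sum_(t <- l) RA_const N s t.1 * RA_prod t.2.
have Q0 : Q 0 by exists [::]; rewrite ?big_nil.
have QB a b : Q a -> Q b -> Q (a - b).
  move=> [l hl ->] [m hm ->]; exists (l ++ [seq (- t.1, t.2) | t <- m]).
    by move=> t; rewrite mem_cat => /orP[/hl//|/mapP[w /hm ? ->]].
  rewrite big_cat big_map -sumrN; congr (_ + _).
  by apply: eq_bigr => z _; rewrite rmorphN mulNr.
have QM a b : Q a -> Q b -> Q (a * b).
  move=> [l hl ->] [m hm ->].
  exists [seq (y.1 * z.1, y.2 ++ z.2) | y <- l, z <- m].
    by move=> _ /allpairsP[[y z] [/hl ay /hm az ->]] /=; rewrite all_cat ay.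
  rewrite big_allpairs_dep /= mulr_suml; apply: eq_bigr => z _.
  rewrite mulr_sumr; apply: eq_bigr => w _.
  by rewrite /RA_prod big_cat rmorphM mulrACA.
have Qc c : Q (RA_const N s c).
  exists [:: (c, [::])]; first by move=> t; rewrite inE => /eqP->.
  by rewrite big_seq1 /RA_prod big_nil mulr1.
have Qb b : Q (RA_of_RV b).
  elim/RV_ind: b => [c|v v0|b b' hb hb'|b b' hb hb'].
  - by rewrite RA_of_RV_const.
  - exists [:: (1, [:: v])]; first by move=> t; rewrite inE => /eqP-> /=; rewrite andbT.
    by rewrite big_seq1 /RA_prod big_seq1 /= rmorph1 mul1r.
  - by rewrite rmorphB; exact: QB.
  - by rewrite rmorphM; exact: QM.
suff : forall z, Q (qproj (ideal_gen (@RA_relations Fq F iota infty N s)) z).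
  by move=> /(_ (repr x)); rewrite qproj_repr.
elim/tring_ind => [|z z' hz hz'|b c].
- by rewrite (rmorph0 (qproj _)).
- rewrite (rmorphD (qproj _)) -[X in _ + X]opprK; apply: (QB _ _ hz).
  by rewrite -sub0r; exact: QB.
- by rewrite qproj_pure; exact: QM.
Qed.

Lemma RA_homogeneous_sum (x : RA) : exists n (c : nat -> RA),
  [/\ forall k, RA_part k (c k), forall k, (n <= k)%N -> c k = 0 & x = \sum_(k < n) c k].
Proof.
have [l hl ->] := RA_words x.
pose c k := \sum_(t <- [seq t <- l | size t.2 == k]) RA_const N s t.1 * RA_prod t.2.
exists (\max_(t <- l) size t.2).+1, c; split=> [k|k lk|].
- exists [seq t <- l | size t.2 == k] => // t.
  by rewrite mem_filter => /andP[/eqP tk /hl at2].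
- rewrite /c; case E : [seq t <- l | size t.2 == k] => [|t r]; first by rewrite big_nil.
  have : t \in [seq t <- l | size t.2 == k] by rewrite E mem_head.
  rewrite mem_filter => /andP[/eqP tk tl].
  by move: lk; rewrite ltnNge -tk => /negP[]; exact: leq_bigmax_seq.
- rewrite /c; under [RHS]eq_bigr do rewrite big_filter.
  rewrite (exchange_big_dep predT)//= big_seq [RHS]big_seq.
  apply: eq_bigr => t tl.
  have lt : (size t.2 < (\max_(t <- l) size t.2).+1)%N.
    by rewrite ltnS; exact: leq_bigmax_seq.
  by rewrite (big_pred1 (Ordinal lt))// => k; rewrite -[RHS]val_eqE eq_sym.
Qed.

(** The relations are homogeneous of degree 1, so the coaction of R_V, with F in degree 0, descends
    to a morphism from R_A to R_A[X]. Reading off a coefficient of the image of a vanishing sum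
    isolates one component. *)
Lemma RA_independent : finite_set [set: VN N s] -> graded_independent (@RA_part _ _ _ _ N s).
Proof.
move=> Vfin n x gx xs i.
have [R0|R1] := eqVneq (1 : RA) 0; first by rewrite -[LHS]mul1r R0 mul0r.
pose Rn : comNzRingType := HB.pack (GRing.ComPzRing.sort RA)
  (GRing.PzSemiRing_isNonZero.Build (GRing.ComPzRing.sort RA) R1).
pose gam : {rmorphism RV -> Rn} := RA_of_RV.
pose cst : {rmorphism F -> Rn} := RA_const N s.
have [dl hdl] := grading_morphism (@RV_part0 _ V) (@RV_partB _ V) (@RV_part1 _ V)
  (@RV_partM _ V) (@RV_independent _ V) (@RV_gsum _ V).
pose f : {rmorphism RV -> {poly Rn}} := GRing.RMorphism.clone _ _ (map_poly gam \o dl) _.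
pose g : {rmorphism F -> {poly Rn}} := GRing.RMorphism.clone _ _ (polyC \o cst) _.
have fE d b : RV_part d b -> f b = gam b *: 'X^d.
  by move=> hb; rewrite /f /= (hdl d)// linearZ /= map_polyXn.
have fg c : f (RV_of V c) = g (iota c).
  rewrite (fE 0%N); last exact: KV_part_const.
  by rewrite expr0 alg_polyC /g /= /gam /cst /= RA_of_RV_const.
have [h hE] := tring_lift fg.
have hp b c : RV_part 1 b -> h (tring_pure _ _ b c) =
    (qproj (ideal_gen (@RA_relations Fq F iota infty N s)) (tring_pure _ _ b c) : Rn) *: 'X.
  move=> hb; rewrite hE (fE _ _ hb) expr1 qproj_pure /g /=.
  by rewrite mulrC mul_polyC scalerA mulrC.
have hinv v c : h (tring_pure _ _ (rinv (v : V)) c) =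
    (qproj (ideal_gen (@RA_relations Fq F iota infty N s)) (tring_pure _ _ (rinv v) c) : Rn) *: 'X.
  by apply: hp; exact: KV_part_inv.
have [|del hdel] := @quoring_lift _ _ (@RA_relations Fq F iota infty N s) h.
  move=> z hz; have : qproj (ideal_gen (@RA_relations Fq F iota infty N s)) z = 0.
    rewrite -(rmorph0 (qproj _)); apply/qprojP; rewrite subr0 => J; exact.
  move: hz => [a [v [_ _ ->]]].
  (* Finiteness turns the sum in the relation into an ordinary one, with which the morphisms
     commute. *)
  have Afin : finite_set (@Va Fq F iota infty N s a) by exact: sub_finite_set Vfin.
  rewrite fsbig_finite//= (rmorphB (qproj _)) (rmorph_sum (qproj _)) => e.
  rewrite rmorphB rmorph_sum hinv.
  under eq_bigr do rewrite hinv.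
  by rewrite -scaler_suml -scalerBl [X in X *: _]e scale0r.
have delc c : del (RA_const N s c) = (cst c)%:P.
  by rewrite /RA_const hdel hE rmorph1 mul1r.
have delg v : del (RA_gen v) = (RA_gen v : Rn) *: 'X.
  by rewrite /RA_gen hdel hp//; exact: KV_part_inv.
have delp d z : RA_part d z -> del z = (z : Rn) *: 'X^d.
  move=> [l hl ->]; rewrite rmorph_sum scaler_suml big_seq [RHS]big_seq.
  apply: eq_bigr => t /hl[<- _]; rewrite rmorphM delc mul_polyC -scalerA.
  congr (_ *: _); rewrite /RA_prod; elim: (t.2) => [|v w IHw].
    by rewrite !big_nil expr0 scale1r rmorph1.
  rewrite !big_cons rmorphM delg IHw /= exprS -scalerAl -scalerAr scalerA.
  by [].
have : \sum_(k < n) (x k : Rn) *: 'X^k = 0 :> {poly Rn}.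
  rewrite -[RHS](rmorph0 del) -xs rmorph_sum; apply: eq_bigr => k _.
  by rewrite (delp k).
move=> /(congr1 (fun p : {poly Rn} => p`_i)); rewrite coef0 coef_sum.
rewrite (bigD1 i)// big1 => [|k ki].
  by rewrite coefZ coefXn eqxx mulr1 [X in X = 0 -> _]addr0.
by rewrite coefZ coefXn eq_sym -[_ == _]/(k == i) (negbTE ki) mulr0.
Qed.

End Instance.

(** * The case of Satake compactifications *)

Lemma lfrac_lofV (R : comPzRingType) (T : set R) t : mulgen T t ->
  lfrac T 1 t * lof T t = 1.
Proof.
move=> mt; have m1 := mulgen1 T.
by rewrite /lof lfracM//; apply: lfrac_eq; rewrite ?mulr1 ?mul1r.
Qed.

Lemma lfrac_divl (R : comPzRingType) (T : set R) t x r (u : loc T) :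
  mulgen T t -> mulgen T r -> lof T t * u = lfrac T x r -> u = lfrac T x (t * r).
Proof.
move=> mt mr e; rewrite -[LHS]mul1r -(lfrac_lofV mt) -mulrA e.
by rewrite lfracM// mul1r.
Qed.

Lemma integral_icl (R S : comPzRingType) (f : {rmorphism R -> S}) (x : icl f) :
  integral (to_icl f) x.
Proof.
have /asboolP[n [c e]] := valP x; exists n, c.
apply: val_inj; rewrite rmorphD rmorphXn rmorph_sum rmorph0 -[RHS]e.
congr (_ + _); apply: eq_bigr => i _.
by rewrite rmorphM rmorphXn.
Qed.

(** * The grading of RS and its comparison with R_A *)

Section InstanceRS.
Variables (Fq : finFieldType) (F : fieldType) (iota : {rmorphism Fq -> F}).
Variables (infty : set F) (N : ideal (coefRing iota infty)) (s : nat).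
Local Notation V := (VNq N s).
Local Notation RA := (RA N s).
Local Notation RS := (RS N s).
Local Notation gens := [set x : RA | exists2 v, v != 0 & x = RA_gen v].

Definition RS_graded : gradedRing :=
  GradedRing (@RS_part0 _ _ _ _ N s) (@RS_partB _ _ _ _ N s) (@RS_part1 _ _ _ _ N s)
    (@RS_partM _ _ _ _ N s).

Definition Rnorm_val : gradedMorphism (Rnorm_graded N s) RS_graded :=
  @GradedMorphism (Rnorm_graded N s) RS_graded
    (val : {rmorphism Rnorm N s -> RS}) (fun d x hx => hx).

Lemma RA_gen_part (v : VN N s) : v != 0 -> RA_part 1 (RA_gen v).
Proof.
move=> v0; have := @RA_prod_part _ _ _ _ N s 1 [:: v].
by rewrite /RA_prod big_seq1; apply; split; rewrite //= v0.
Qed.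

Lemma RS_common n (u : 'I_n -> RS) : (forall i : 'I_n, RS_part i (u i)) ->
  exists e (l : seq (VN N s)) (x : 'I_n -> RA), nonzero_word e l /\
    forall i : 'I_n, RA_part (i + e) (x i) /\ u i = lfrac _ (x i) (RA_prod l).
Proof.
elim: n u => [|n IHn] u hu.
  by exists 0%N, [::], (fun=> 0); split=> // -[].
have [i|e [l [x [hl hx]]]] := IHn (fun i => u (widen_ord (leqnSn n) i)).
  exact: (hu (widen_ord (leqnSn n) i)).
have [e' [z [l' [hz hl' uE]]]] := hu ord_max.
pose ext (i : 'I_n.+1) := if unlift ord_max i is Some k then x k * RA_prod l'
                          else z * RA_prod l.
have liftE (i : 'I_n) : lift ord_max i = widen_ord (leqnSn n) i.
  by apply: val_inj; rewrite /= /bump leqNgt ltn_ord.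
exists (e + e')%N, (l ++ l'), ext; split; first exact: nonzero_word_cat.
have ml := RA_prod_mulgen hl; have ml' := RA_prod_mulgen hl'.
have mll : mulgen gens (RA_prod l * RA_prod l') by exact: mulgenM.
move=> i; rewrite /ext; case: unliftP => [k ->|->].
  rewrite liftE; have [gk ->] := hx k; split.
    by rewrite addnA; apply: RA_partM => //; exact: RA_prod_part.
  by apply: lfrac_eq; rewrite /RA_prod ?big_cat//= mulrA mulrAC.
split; first by rewrite (addnC e) addnA; apply: RA_partM => //; exact: RA_prod_part.
by rewrite uE; apply: lfrac_eq; rewrite /RA_prod ?big_cat//= -mulrA.
Qed.

(** Clearing denominators leaves w times a sum equal to 0 in R_A, where w is a product of generators
    and hence homogeneous; independence there kills each term. *)
Lemma RS_independent :
  graded_independent (@RA_part _ _ _ _ N s) -> graded_independent (@RS_part _ _ _ _ N s).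
Proof.
move=> RAind n u hu us i; have [e [l [x [hl hx]]]] := RS_common hu.
have ml := RA_prod_mulgen hl.
have u0 : lfrac gens (\sum_(k < n) x k) (RA_prod l) = lfrac gens 0 1.
  rewrite -[RHS]us.
  have toE k : lfrac gens k (RA_prod l) = RA_to_RS k * lfrac gens 1 (RA_prod l).
    by rewrite lfracM ?mulr1 ?mul1r//; exact: mulgen1.
  rewrite toE rmorph_sum mulr_suml; apply: eq_bigr => k _.
  by rewrite -toE; case: (hx k).
have /lfracP[||_ [m hm ->]] := u0; [by []|exact: mulgen1|].
rewrite mulr1 mul0r mulr0 mulr_sumr.
have [c gc] : exists c, RA_part c (\prod_(z <- m) z).
  elim: (m) hm => [|z r IHr] h; first by exists 0%N; rewrite big_nil; exact: RA_part1.
  have [|c gc] := IHr; first by move=> z' zr; apply: h; rewrite in_cons zr orbT.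
  have [v v0 ->] := h z (mem_head _ _).
  by exists (1 + c)%N; rewrite big_cons; apply: RA_partM => //; exact: RA_gen_part.
have mw : mulgen gens (\prod_(z <- m) z) by exists m.
move: (\prod_(z <- m) z) gc mw => w gc mw ws.
have [_ ->] := hx i; apply/lfracP => //; first exact: mulgen1.
exists w => //; rewrite mulr1 mul0r mulr0.
have := @homogeneous_part (RA_graded N s) [set 0] _ (c + (i + e))%N 0
  (fun k : 'I_n => w * x k) (fun k => c + (k + e))%N.
have -> : \sum_(k < n | (c + (k + e) == c + (i + e))%N) w * x k = w * x i.
  by rewrite (big_pred1 i)// => k; rewrite eqn_add2l eqn_add2r.
rewrite !add0r; apply=> //; first exact: RA_part0.
by move=> k; apply: RA_partM => //; case: (hx k).
Qed.

Lemma RS_gen_unit v : v != 0 -> exists z : RS, z * RA_to_RS (RA_gen v) = 1.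
Proof.
move=> v0; exists (lfrac _ 1 (RA_gen v)).
by apply: lfrac_lofV; apply: mulgen_sub; exists v.
Qed.

Lemma RS_part_gen v k (u : RS) : v != 0 ->
  RS_part k.+1 (RA_to_RS (RA_gen v) * u) -> RS_part k u.
Proof.
move=> v0 [e [x [l [hx hl uE]]]].
have mv : mulgen gens (RA_gen v) by apply: mulgen_sub; exists v.
have ml := RA_prod_mulgen hl.
exists e.+1, x, (v :: l); split.
- by rewrite addnS -addSn.
- by case: hl => <- al; split; rewrite //= v0.
by rewrite /RA_prod big_cons; exact: lfrac_divl.
Qed.

(** It shows that outside the trivial case coordinates and a nonzero vector exist. *)
Lemma RS_part_eq0 : (forall v : VN N s, v != 0 -> RA_gen v = 0) ->
  forall d (u : RS), (0 < d)%N -> RS_part d u -> u = 0.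
Proof.
move=> g0 d u d0 [e [x [l [[m hm xE] hl ->]]]].
suff -> : x = 0.
  apply: lfrac_eq; rewrite ?mul0r ?mul0r//; [exact: RA_prod_mulgen hl|exact: mulgen1].
rewrite xE big_seq big1 => // t /hm[st at2].
case: (t.2) st at2 => [|v w _ /= /andP[v0 _]]; first by move: d0; case: (d).
by rewrite /RA_prod big_cons g0// mul0r mulr0.
Qed.

End InstanceRS.

Theorem theorem2p11p3 (Fq : finFieldType) (F : fieldType)
    (iota : {rmorphism Fq -> F}) (F_gff : global_function_field iota)
    (infty : set F) (infty_place : place iota infty)
    (N : ideal (coefRing iota infty))
    (N_nonzero : exists2 x, N x & x != 0) (N_proper : ~ N 1)
    (N_level : level_assumption N) (r : nat) (r_ge1 : (1 <= r)%N) :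
  exists rho : projMorphism (RA_to_Rnorm_gmor N r),
    forall d : nat, (1 <= d)%N ->
      natural_isomorphism rho ideal_full d /\
      natural_isomorphism rho (I_norm N r) d.
Proof.
(* One morphism rho must serve both ideals, so the claim is generalized to all radical J. *)
suff [rho hrho] : exists rho : projMorphism (RA_to_Rnorm_gmor N r),
    forall (J : ideal (Rnorm_graded N r)) d, (forall z n, J (z ^+ n) -> J z) ->
      (0 < d)%N -> natural_isomorphism rho J d.
  exists rho => d d0; split; first by apply: hrho.
  apply: hrho => // z n [m hm]; exists (n * m)%N.
  by rewrite exprM.
have [triv|ntriv] := pselect (forall d (u : RS N r), (0 < d)%N -> RS_part d u -> u = 0).
  have [d x d0 gx|rho hrho] := @trivial_isomorphism _ _ (RA_to_Rnorm_gmor N r).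
    by apply: val_inj; exact: triv gx.
  by exists rho => J d _; exact: hrho.
have [[c _]|nocoords] := pselect (exists c : coordinates (VNq N r), True); last first.
  exfalso; apply: ntriv; apply: RS_part_eq0 => v v0.
  (* Without coordinates [chosen_coordinates] takes its default, a map to a space of dimension 0,
     and 1/0 = 0. *)
  have sym0 : sym_of (v : VNq N r) = 0.
    rewrite /sym_of big1// => i _.
    rewrite /coords /symdim /chosen_coordinates in i *.
    by case: pselect i => // ? i; rewrite /= mxE scale0r.
  rewrite /RA_gen /RVF_inv.
  suff -> : rinv (v : VNq N r) = 0.
    by rewrite -[0]subr0 tring_pureBl subrr rmorph0.
  by apply: val_inj; rewrite /= /KV_of sym0 rmorph0 invr0.
have [g cg gc] := cmap_bij c.
have Vfin : finite_set [set: VN N r].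
  have -> : [set: VN N r] = g @` [set: 'rV[Fq]_(cdim c)].
    by apply/seteqP; split=> // v _; exists (cmap c v); rewrite ?cg.
  exact/finite_image/finite_finset.
(* Indexing by coordinate vectors makes the index set a finite type. *)
pose I := {w : 'rV[Fq]_(cdim c) | g w != 0}.
pose y (i : I) : RA N r := RA_gen (g (val i) : VN N r).
have L1 : (1 : RS N r) != 0.
  apply/eqP => e; apply: ntriv => d u _ _.
  by rewrite -[u]mul1r e mul0r.
have idx (v : VN N r) : v != 0 -> exists i : I, g (val i) = v.
  move=> v0; have h : g (cmap c v) != 0 by rewrite cg.
  by exists (exist (fun w => is_true (g w != 0)) _ h); rewrite /= cg.
have [i0] : inhabited I.
  apply: contrapT => nI; apply: ntriv; apply: RS_part_eq0 => v /idx[i _].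
  by case: nI.
have RAind := RA_independent Vfin.
have y_span d (x : RA_graded N r) : gpart d x -> exists l : seq (RA_graded N r * seq I),
    (forall t, t \in l -> gpart 0 t.1 /\ size t.2 = d) /\
    x = \sum_(t <- l) t.1 * \prod_(i <- t.2) y i.
  move=> [l hl ->].
  have /choice[ix hix] (v : VN N r) : exists i : I, v != 0 -> g (val i) = v.
    by have [->|/idx[i]] := eqVneq v 0; [exists i0|exists i].
  exists [seq (RA_const N r t.1, map ix t.2) | t <- l]; split.
    move=> _ /mapP[t /hl[tl _] ->] /=; rewrite size_map; split=> //.
    exists [:: (t.1, [::])]; first by move=> z; rewrite inE => /eqP->.
    by rewrite big_seq1 /RA_prod big_nil mulr1.
  rewrite big_map big_seq [RHS]big_seq; apply: eq_bigr => t /hl[_ /allP at2] /=.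
  congr (_ * _); rewrite big_map /RA_prod big_seq [RHS]big_seq.
  by apply: eq_bigr => v /at2 v0; rewrite /y hix.
have y0 (i : I) : (g (val i) : VN N r) != 0 by exact: (valP i).
have y_unit (i : I) := RS_gen_unit (y0 i).
have int_over (x : Rnorm_graded N r) : integral (RA_to_Rnorm_gmor N r) x.
  exact: integral_icl.
have int_closed (u : RS_graded N r) :
    integral (Rnorm_val N r \o RA_to_Rnorm_gmor N r) u -> exists x, Rnorm_val N r x = u.
  move=> hu; have hu' : icl_pred (@RA_to_RS _ _ _ _ N r) u by apply/asboolP.
  by exists (exist (fun x => icl_pred (@RA_to_RS _ _ _ _ N r) x) u hu').
have y_part i : @gpart (RA_graded N r) 1 (y i).
  by apply: RA_gen_part; exact: y0.
have [rho] := @exists_projMorphism (RA_graded N r) (Rnorm_graded N r) (RS_graded N r)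
  (RA_to_Rnorm_gmor N r) (Rnorm_val N r) I y val_inj int_over
  (RS_independent RAind) y_part y_span (@RA_homogeneous_sum _ _ _ _ N r).
exists rho => J d Jrad d0.
apply: (@sections_isomorphism (RA_graded N r) (Rnorm_graded N r) (RS_graded N r)
  (RA_to_Rnorm_gmor N r) (Rnorm_val N r) I y val_inj).
- by [].
- exact: int_closed.
- exact: int_over.
- exact: RS_independent RAind.
- exact: y_part.
- exact: y_span.
- exact: RA_homogeneous_sum.
- exact: y_unit.
- move=> i k u; exact: (RS_part_gen (y0 i)).
- exact: L1.
- exact: i0.
- exact: Jrad.
- exact: d0.
Qed.
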